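(* Let $l\ge3$. Then $\left((\mathcal{BZ}_{\mathbb Z}^e)^{\sigma};\mathrm{wt},\widehat\varepsilon_p,\widehat\varphi_p,\widehat e_p,\widehat f_p\right)$ is a $U_q(\widehat{\mathfrak{sl}}_l)$-crystal.
   Context: **Finite intervals.** For $n\in\mathbb Z$, $m\ge1$ let $I=[n+1,n+m]$ (an interval of integers) and $\widetilde I=I\cup\{n+m+1\}$. $\mathcal M_I$ is the set of all subsets of $\widetilde I$, and $\mathcal M_I^\times=\mathcal M_I\setminus\{\emptyset,\widetilde I\}$. An $e$-BZ datum associated to $I$ is a collection of integers $\mathbf M=(M_{\mathbf k})_{\mathbf k\in\mathcal M_I^\times}$ such that, with the convention $M_\emptyset=M_{\widetilde I}=0$: (BZ-0) $M_{[n+1,i]}=0$ for all $i\in I$; (BZ-1) for $i\ne j$ in $\widetilde I$ and $\mathbf k\in\mathcal M_I$ with $\mathbf k\cap\{i,j\}=\emptyset$, $M_{\mathbf k\cup\{i\}}+M_{\mathbf k\cup\{j\}}\le M_{\mathbf k\cup\{i,j\}}+M_{\mathbf k}$; (BZ-2) for $i<j<k$ in $\widetilde I$ and $\mathbf k\in\mathcal M_I$ with $\mathbf k\cap\{i,j,k\}=\emptyset$, $M_{\mathbf k\cup\{i,k\}}+M_{\mathbf k\cup\{j\}}=\min\{M_{\mathbf k\cup\{i,j\}}+M_{\mathbf k\cup\{k\}},\,M_{\mathbf k\cup\{j,k\}}+M_{\mathbf k\cup\{i\}}\}$. $\mathcal{BZ}_I^e$ is the set of all of them. **Ordinary operators on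 $\mathcal{BZ}_I^e$.** $\mathcal B_I$ (Lusztig data) is the set of families $\mathbf a=(a_{i,j})$ of nonnegative integers indexed by pairs $i<j$ in $\widetilde I$. For $\mathbf k=\{k_{n+1}<\dots<k_{n+u}\}\in\mathcal M_I^\times$, a $\mathbf k$-tableau is an upper-triangular integer array $C=(c_{p,q})_{n+1\le p\le q\le n+u}$ with $c_{p,p}=k_p$, $c_{p,q}\le c_{p,q+1}$, $c_{p,q}<c_{p+1,q}$ (whenever defined). Put $M_{\mathbf k}(\mathbf a)=-\sum_{j=n+1}^{n+u}\sum_{i=n+1}^{k_j-1}a_{i,k_j}+\min_C\sum_{n+1\le p<q\le n+u}a_{c_{p,q},\,c_{p,q}+(q-p)}$, the minimum over $\mathbf k$-tableaux $C$. It is known that $\mathbf a\mapsto\mathbf M(\mathbf a)=(M_{\mathbf k}(\mathbf a))_{\mathbf k}$ is a bijection $\mathcal B_I\to\mathcal{BZ}_I^e$. For $i\in I$ and $n+1\le k\le i$ put $A_k^{(i)}(\mathbf a)=\sum_{s=n+1}^k(a_{s,i+1}-a_{s-1,i})$ with $a_{n,i}=0$; $\varepsilon_i(\mathbf a)=\max_kA_k^{(i)}(\mathbf a)$; $k_e$ (resp. $k_f$) is the smallest (resp. largest) $k$ attaining this maximum. $\widetilde e_i\mathbf a$ is $0$ if $\varepsilon_i(\mathbf a)=0$, and otherwise is obtained from $\mathbf a$ by replacing $a_{k_e,i}$ by $a_{k_e,i}+1$ and $a_{k_e,i+1}$ by $a_{k_e,i+1}-1$; $\widetilde f_i\mathbf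 a$ is obtained by replacing $a_{k_f,i}$ by $a_{k_f,i}-1$ and $a_{k_f,i+1}$ by $a_{k_f,i+1}+1$ (changes of the non-existent entry $a_{i,i}$ are ignored). For $\mathbf M=\mathbf M(\mathbf a)$: $\varepsilon_i(\mathbf M)=\varepsilon_i(\mathbf a)$, $\widetilde e_i\mathbf M=\mathbf M(\widetilde e_i\mathbf a)$ (or $0$ if $\varepsilon_i(\mathbf a)=0$), $\widetilde f_i\mathbf M=\mathbf M(\widetilde f_i\mathbf a)$. **Data associated to $\mathbb Z$.** A Maya diagram of charge $r$ is a subset $\mathbf k\subset\mathbb Z$ with $\mathbb Z_{\le r-p}\subset\mathbf k\subset\mathbb Z_{\le r+q}$ and $|\mathbf k\cap\mathbb Z_{>r-p}|=p$ for some $p,q\ge0$; $\mathcal M_{\mathbb Z}$ is the set of Maya diagrams of all charges. Put $\mathbf k(\Lambda_p)=\mathbb Z_{\le p}$, $\mathbf k(\sigma_p\Lambda_p)=\mathbb Z_{\le p-1}\cup\{p+1\}$, and let $\sigma_p\mathbf k$ be the image of $\mathbf k$ under the transposition $(p,p+1)$. For $I=[n+1,n+m]$, $\mathcal M_{\mathbb Z}(I)=\{\mathbb Z_{\le n}\cup\mathbf k_I:\mathbf k_I\in\mathcal M_I^\times\}$; $\mathrm{res}_I(\mathbf k)=\mathbf k\cap\widetilde I$ is a bijection $\mathcal M_{\mathbb Z}(I)\to\mathcal M_I^\times$; for $\mathbf k\in\mathcal M_{\mathbb Z}(I)$ put $\Omega_I(\mathbf k)=\mathbb Z_{\le n}\cup(\widetilde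 I\setminus\mathrm{res}_I(\mathbf k))$. For a collection of integers $\mathbf M=(M_{\mathbf k})_{\mathbf k\in\mathcal M_{\mathbb Z}}$, $\mathbf M_I=(M_{\mathbf k})_{\mathbf k\in\mathcal M_{\mathbb Z}(I)}$ is viewed as indexed by $\mathcal M_I^\times$ via $\mathrm{res}_I$. $\mathcal{BZ}^e_{\mathbb Z}$ is the set of $\mathbf M$ such that (2-a) $\mathbf M_K\in\mathcal{BZ}_K^e$ for every finite interval $K$; (2-b) for each $\mathbf k\in\mathcal M_{\mathbb Z}$ there is a finite interval $I$ with $\mathbf k\in\mathcal M_{\mathbb Z}(I)$ and $M_{\Omega_J(\mathbf k)}=M_{\Omega_I(\mathbf k)}$ for every finite interval $J\supset I$. $\mathrm{Int}^e(\mathbf M;\mathbf k)$ is the set of all $I$ satisfying (2-b) for $\mathbf k$; write $\Theta_{\mathbf k}(\mathbf M)=M_{\Omega_I(\mathbf k)}$ for any $I\in\mathrm{Int}^e(\mathbf M;\mathbf k)$. **Ordinary operators on $\mathcal{BZ}_{\mathbb Z}^e$.** For $p\in\mathbb Z$, $\varepsilon_p(\mathbf M)=-M_{\mathbf k(\sigma_p\Lambda_p)}$. If $\varepsilon_p(\mathbf M)=0$, $\widetilde e_p\mathbf M=0$; if $\varepsilon_p(\mathbf M)>0$, $(\widetilde e_p\mathbf M)_{\mathbf k}=(\widetilde e_p\mathbf M_I)_{\mathrm{res}_I(\mathbf k)}$ for any finite interval $I$ with $\mathbf k,\sigma_p\mathbf k\in\mathcal M_{\mathbb Z}(I)$ and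 $I\in\mathrm{Int}^e(\mathbf M;\mathbf k')$ for $\mathbf k'=\mathbf k(\Lambda_p),\mathbf k(\sigma_p\Lambda_p),\mathbf k(\Lambda_{p+1}),\mathbf k(\Lambda_{p-1})$. $(\widetilde f_p\mathbf M)_{\mathbf k}=(\widetilde f_p\mathbf M_I)_{\mathrm{res}_I(\mathbf k)}$ for any $I$ with $\mathbf k,\sigma_p\mathbf k\in\mathcal M_{\mathbb Z}(I)$ and $I\in\mathrm{Int}^e(\mathbf M;\mathbf k(\Lambda_p))\cap\mathrm{Int}^e(\mathbf M;\mathbf k(\sigma_p\Lambda_p))$. These do not depend on $I$ and take values in $\mathcal{BZ}_{\mathbb Z}^e\cup\{0\}$; for $|q-q'|\ge2$ the operators indexed by $q$ and $q'$ commute. **Affine type.** Fix $l\ge3$, $\widehat I=\{0,\dots,l-1\}$, and let $\widehat h_p,\widehat\alpha_p$ ($p\in\widehat I$) be the simple coroots and simple roots of type $A_{l-1}^{(1)}$. Let $\sigma(j)=j+l$ on $\mathbb Z$, $\sigma(\mathbf M)_{\mathbf k}=M_{\sigma^{-1}(\mathbf k)}$, $(\mathcal{BZ}_{\mathbb Z}^e)^\sigma=\{\mathbf M\in\mathcal{BZ}_{\mathbb Z}^e:\sigma(\mathbf M)=\mathbf M\}$. For such $\mathbf M$ and $p\in\widehat I$: $\mathrm{wt}(\mathbf M)=\sum_{p\in\widehat I}\Theta_{\mathbf k(\Lambda_p)}(\mathbf M)\widehat\alpha_p$; $\widehat\varepsilon_p(\mathbf M)=\varepsilon_p(\mathbf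 M)$; $\widehat\varphi_p(\mathbf M)=\widehat\varepsilon_p(\mathbf M)+\langle\widehat h_p,\mathrm{wt}(\mathbf M)\rangle$. Let $L^e(\mathbf k,p)$ be the finite set of $q\in p+l\mathbb Z$ such that exactly one of $q,q+1$ lies in $\mathbf k$. $\widehat e_p\mathbf M=0$ if $\widehat\varepsilon_p(\mathbf M)=0$, otherwise $(\widehat e_p\mathbf M)_{\mathbf k}=(\prod_{q\in L^e(\mathbf k,p)}\widetilde e_q\,\mathbf M)_{\mathbf k}$; and $(\widehat f_p\mathbf M)_{\mathbf k}=(\prod_{q\in L^e(\mathbf k,p)}\widetilde f_q\,\mathbf M)_{\mathbf k}$. These operators take values in $(\mathcal{BZ}_{\mathbb Z}^e)^\sigma\cup\{0\}$. *)

(* Defs.v *)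
(* MathComp world: finmap and the classical layer of MathComp-Analysis. *)
From HB Require Import structures.
From mathcomp Require Import all_boot all_order all_algebra finmap.
From mathcomp Require Import zify.
From mathcomp Require Import boolp classical_sets functions cardinality.

Set Implicit Arguments.
Unset Strict Implicit.
Unset Printing Implicit Defensive.

Import Order.TTheory GRing.Theory Num.Theory.
Local Open Scope classical_set_scope.
Local Open Scope ring_scope.

(** * Finite intervals *)

(* The integer interval I = [n+1, n+m], m >= 1, encoded by n = lo and m = len;
   below I~ denotes [n+1, n+m+1]. *)
Record fitv := Fitv { lo : int; len : nat; len_gt0 : (0 < len)%N }.

Definition itv_seq (I : fitv) : seq int := [seq lo I + 1 + x%:Z | x <- iota 0 (len I)].

Definition tilde_seq (I : fitv) : seq int :=
  [seq lo I + 1 + x%:Z | x <- iota 0 (len I).+1].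

Definition tilde (I : fitv) : {fset int} := [fset x in tilde_seq I]%fset.

Definition sub_itv (I J : fitv) : Prop :=
  lo J <= lo I /\ lo I + (len I)%:Z <= lo J + (len J)%:Z.

Definition sub_proper (I : fitv) (K : {fset int}) : bool :=
  [&& (K `<=` tilde I)%fset, K != fset0%fset & K != tilde I].

(* A collection indexed by the proper nonempty subsets of I~ is represented by
   a function on all finite sets of integers of which only the values on
   [sub_proper I] are meaningful; the definitions below never read others. *)
Definition fcoll := {fset int} -> int.

(* M with the convention that the values at the empty set and at I~ are 0. *)
Definition ext (I : fitv) (M : fcoll) (K : {fset int}) : int :=
  if (K == fset0%fset) || (K == tilde I) then 0 else M K.

Definition is_eBZ (I : fitv) (M : fcoll) : Prop :=
  [/\ (forall i, i \in itv_seq I -> ext I M [fset x in tilde I | x <= i]%fset = 0),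
      (forall i j K, i \in tilde I -> j \in tilde I -> i != j ->
         (K `<=` tilde I)%fset -> i \notin K -> j \notin K ->
         ext I M (i |` K)%fset + ext I M (j |` K)%fset
           <= ext I M (i |` (j |` K))%fset + ext I M K)
    & (forall i j k K,
         i \in tilde I -> j \in tilde I -> k \in tilde I -> i < j -> j < k ->
         (K `<=` tilde I)%fset -> i \notin K -> j \notin K -> k \notin K ->
         ext I M (i |` (k |` K))%fset + ext I M (j |` K)%fset =
         Num.min (ext I M (i |` (j |` K))%fset + ext I M (k |` K)%fset)
                 (ext I M (j |` (k |` K))%fset + ext I M (i |` K)%fset))].

(** * Lusztig data *)

(* Families (a_{i,j}) indexed by pairs i < j in I~ are extended by 0 to all
   pairs of integers; this includes the convention a_{n,i} = 0. *)
Definition ldata := int -> int -> nat.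

Definition is_lusztig (I : fitv) (a : ldata) : Prop :=
  forall i j, ~~ [&& i \in tilde I, j \in tilde I & i < j] -> a i j = 0%N.

(* k_{n+1} < ... < k_{n+u}; here and in tableaux the row, column and entry
   numbers n+1, ..., n+u are shifted to 0, ..., u-1. *)
Definition sorted_elts (K : {fset int}) : seq int := sort <=%O (enum_fset K).

Definition is_tableau (K : {fset int}) (C : nat -> nat -> int) : Prop :=
  [/\ (forall p, (p < #|` K|)%N -> C p p = nth 0 (sorted_elts K) p),
      (forall p q, (p <= q)%N -> (q.+1 < #|` K|)%N -> C p q <= C p q.+1)
    & (forall p q, (p < q)%N -> (q < #|` K|)%N -> C p q < C p.+1 q)].

Definition tableau_weight (a : ldata) (K : {fset int}) (C : nat -> nat -> int) : nat :=
  (\sum_(q < #|` K|) \sum_(p < #|` K| | p < q) a (C p q) (C p q + (q - p)%N%:Z)%R)%N.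

Definition tableau_weights (a : ldata) (K : {fset int}) : set nat :=
  [set w | exists2 C, is_tableau K C & w = tableau_weight a K C].

Lemma tableau_weights_nonempty (a : ldata) (K : {fset int}) :
  exists w, w \in tableau_weights a K.
Proof.
pose C (p q : nat) := nth 0 (sorted_elts K) p.
exists (tableau_weight a K C); apply/mem_set; exists C => //; split=> //.
move=> p q pq qu; have su : sorted <%O (sorted_elts K).
  by rewrite lt_sorted_uniq_le sort_uniq fset_uniq sort_sorted //; exact: le_total.
rewrite (lt_sorted_ltn_nth 0 su) ?inE /sorted_elts ?size_sort //.
- exact: ltn_trans qu.
- exact: leq_ltn_trans qu.
Qed.

Definition M_of (I : fitv) (a : ldata) : fcoll := fun K =>
  - (\sum_(j <- enum_fset K) \sum_(i <- tilde_seq I | i < j) (a i j)%:Z)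
  + (ex_minn (tableau_weights_nonempty a K))%:Z.

Definition A_of (I : fitv) (a : ldata) (i k : int) : int :=
  \sum_(s <- itv_seq I | s <= k) ((a s (i + 1))%:Z - (a (s - 1) i)%:Z).

(* max of A_k^{(i)}(a) over n+1 <= k <= i (for i in I, so k = n+1 occurs) *)
Definition eps_l (I : fitv) (i : int) (a : ldata) : int :=
  \big[Num.max/A_of I a i (lo I + 1)]_(k <- itv_seq I | k <= i) A_of I a i k.

(* The increasing list of the k attaining the maximum. *)
Definition argmaxs (I : fitv) (i : int) (a : ldata) : seq int :=
  [seq k <- itv_seq I | (k <= i) && (A_of I a i k == eps_l I i a)].

Definition k_e (I : fitv) (i : int) (a : ldata) : int := head 0 (argmaxs I i a).
Definition k_f (I : fitv) (i : int) (a : ldata) : int := last 0 (argmaxs I i a).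

(* The truncated subtractions below are never truncating: the decremented
   entries are positive by the choice of k_e and k_f. *)
Definition e_l (I : fitv) (i : int) (a : ldata) : option ldata :=
  if eps_l I i a == 0 then None
  else let k := k_e I i a in
    Some (fun s t =>
      if [&& s == k, t == i & k < i] then (a s t + 1)%N
      else if (s == k) && (t == i + 1) then (a s t - 1)%N
      else a s t).

Definition f_l (I : fitv) (i : int) (a : ldata) : ldata :=
  let k := k_f I i a in
  fun s t =>
    if [&& s == k, t == i & k < i] then (a s t - 1)%N
    else if (s == k) && (t == i + 1) then (a s t + 1)%N
    else a s t.

(* The Lusztig datum a with M(a) = M (the default 0 is used only if there is
   none, which does not happen for e-BZ data). *)
Definition lusztig_of (I : fitv) (M : fcoll) : ldata :=
  xget (fun _ _ => 0%N)
    [set a | is_lusztig I a /\ forall K, sub_proper I K -> M_of I a K = M K].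

Definition e_I (I : fitv) (i : int) (M : fcoll) : option fcoll :=
  omap (M_of I) (e_l I i (lusztig_of I M)).

Definition f_I (I : fitv) (i : int) (M : fcoll) : fcoll :=
  M_of I (f_l I i (lusztig_of I M)).

(** * Maya diagrams *)

Definition Zle (a : int) : set int := [set x | x <= a].
Definition Zgt (a : int) : set int := [set x | a < x].

Definition is_maya (r : int) (k : set int) : Prop :=
  exists p q : nat,
    [/\ Zle (r - p%:Z) `<=` k, k `<=` Zle (r + q%:Z)
      & (k `&` Zgt (r - p%:Z) #= `I_p)%card].

Record maya := Maya { maya_set :> set int; mayaP : exists r, is_maya r maya_set }.

Lemma finite_int_interval (a b : int) : finite_set [set x : int | a < x <= b].
Proof.
apply: (sub_finite_set _ (finite_seq [seq a + i%:Z | i <- iota 0 `|b - a|.+1])).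
move=> x /andP[ax xb]; apply/mapP; exists `|x - a|%N; last by lia.
by rewrite mem_iota; lia.
Qed.

Lemma bounded_maya (a b : int) (k : set int) :
  Zle a `<=` k -> k `<=` Zle b -> exists r, is_maya r k.
Proof.
move=> ak kb; have /finite_setP[p kp] : finite_set (k `&` Zgt a).
  by apply: sub_finite_set (finite_int_interval a b) => x [/kb /= xb /= ax]; apply/andP.
exists (a + p%:Z), p, (absz (b - (a + p%:Z))%R); rewrite addrK; split=> //.
move=> x /kb /= xb; apply: (le_trans xb).
by rewrite /= -lerBlDl abszE ler_norm.
Qed.

Lemma maya_bounds (k : maya) : exists a b, Zle a `<=` k /\ k `<=` Zle b.
Proof. by have [r [p [q [ak kb _]]]] := mayaP k; exists (r - p%:Z), (r + q%:Z). Qed.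

Lemma maya_cup_subproof (n : int) (K : {fset int}) :
  exists r, is_maya r (Zle n `|` [set` K]).
Proof.
apply: (@bounded_maya n (\big[Num.max/n]_(x <- enum_fset K) x)) => x /=; first by left.
by case=> [xn|xK]; [apply: le_trans xn (bigmax_ge_id _ _ _ _)|apply: le_bigmax_seq].
Qed.

Definition maya_cup (n : int) (K : {fset int}) : maya :=
  Maya (maya_cup_subproof n K).

Definition kLambda (p : int) : maya := maya_cup p fset0%fset.
Definition ksLambda (p : int) : maya := maya_cup (p - 1) [fset (p + 1)%R]%fset.

Definition transp (p x : int) : int :=
  if x == p then p + 1 else if x == p + 1 then p else x.

Lemma sigma_maya_subproof (p : int) (k : maya) :
  exists r, is_maya r (transp p @` k).
Proof.
have [a [b [ak kb]]] := maya_bounds k.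
apply: (@bounded_maya (Num.min a (p - 1)) (Num.max b (p + 1))) => x; rewrite /Zle /=.
  rewrite le_min => /andP[xa xp]; exists x; first exact: ak.
  by rewrite /transp !ifF //; apply/eqP=> xE; move: xp; rewrite xE; lia.
case=> y /kb /= yb <-; rewrite le_max /transp; case: eqP => [_|_].
  by rewrite lexx orbT.
by case: eqP => [_|_]; [rewrite lerDl orbT|rewrite yb].
Qed.

Definition sigma_maya (p : int) (k : maya) : maya := Maya (sigma_maya_subproof p k).

Lemma shift_maya_subproof (d : int) (k : maya) :
  exists r, is_maya r ((fun j => j + d) @` k).
Proof.
have [a [b [ak kb]]] := maya_bounds k.
apply: (@bounded_maya (a + d) (b + d)) => x; rewrite /Zle /=.
  by move=> xa; exists (x - d); [apply: ak; rewrite /Zle /= lerBlDr|rewrite subrK].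
by case=> y /kb /= yb <-; rewrite lerD2r.
Qed.

Definition shift_maya (d : int) (k : maya) : maya := Maya (shift_maya_subproof d k).

Definition in_MZ (I : fitv) (k : maya) : Prop :=
  exists2 K, sub_proper I K & k = maya_cup (lo I) K.

Definition res (I : fitv) (k : maya) : {fset int} :=
  [fset x in tilde I | x \in (k : set int)]%fset.

Definition Omega (I : fitv) (k : maya) : maya :=
  maya_cup (lo I) (tilde I `\` res I k)%fset.

(** * e-BZ data associated to Z *)

Definition coll := maya -> int.

(* M_I, indexed by subsets of I~ via the inverse of res_I *)
Definition restr (I : fitv) (M : coll) : fcoll := fun K => M (maya_cup (lo I) K).

Definition Int_e (M : coll) (k : maya) : set fitv :=
  [set I | in_MZ I k /\ forall J, sub_itv I J -> M (Omega J k) = M (Omega I k)].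

Definition BZ_Z : set coll :=
  [set M | (forall K, is_eBZ K (restr K M)) /\ (forall k, Int_e M k !=set0)].

(* In Theta, e_Z and f_Z below, the value is the one computed with any interval
   I satisfying the stated conditions; the default 0 of [xget] is used only if
   there is no such I, which does not happen for M in BZ_Z. *)
Definition Theta (k : maya) (M : coll) : int :=
  xget 0 [set v | exists2 I, Int_e M k I & v = M (Omega I k)].

Definition eps_Z (p : int) (M : coll) : int := - M (ksLambda p).

Definition e_Z (p : int) (M : coll) : option coll :=
  if eps_Z p M == 0 then None
  else Some (fun k => xget 0
    [set v | exists I M',
       [/\ in_MZ I k /\ in_MZ I (sigma_maya p k),
           [/\ Int_e M (kLambda p) I, Int_e M (ksLambda p) I,
               Int_e M (kLambda (p + 1)) I & Int_e M (kLambda (p - 1)) I],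
           e_I I p (restr I M) = Some M'
         & v = M' (res I k)]]).

Definition f_Z (p : int) (M : coll) : coll := fun k => xget 0
  [set v | exists I,
     [/\ in_MZ I k /\ in_MZ I (sigma_maya p k),
         Int_e M (kLambda p) I /\ Int_e M (ksLambda p) I
       & v = f_I I p (restr I M) (res I k)]].

(** * Affine type *)

(* sigma(M)_k = M_{sigma^{-1}(k)} with sigma(j) = j + l *)
Definition sigma_coll (l : nat) (M : coll) : coll := fun k => M (shift_maya (- l%:Z) k).

Definition BZ_Z_sigma (l : nat) : set coll :=
  [set M | BZ_Z M /\ sigma_coll l M = M].

(* The Cartan matrix of type A_{l-1}^{(1)}, for l >= 3. *)
Definition cartan (l : nat) (p q : 'I_l) : int :=
  if p == q then 2
  else if (q == p.+1 %% l :> nat)%N || (p == q.+1 %% l :> nat)%N then -1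
  else 0.

(* The affine weight lattice: (lam, c) stands for
   \sum_q lam_q \hat\Lambda_q + c \delta. *)
Definition wlat (l : nat) : zmodType := ({ffun 'I_l -> int} * int)%type.

Definition simple_coroot (l : nat) (p : 'I_l) (lam : wlat l) : int := lam.1 p.

(* \hat\alpha_p = \sum_q <h_q, \hat\alpha_p> \hat\Lambda_q + \delta_{p,0} \delta *)
Definition simple_root (l : nat) (p : 'I_l) : wlat l :=
  ([ffun q => cartan q p], (nat_of_ord p == 0%N)%:Z).

Definition wt (l : nat) (M : coll) : wlat l :=
  \sum_(p < l) simple_root p *~ Theta (kLambda p%:Z) M.

Definition eps_hat (l : nat) (p : 'I_l) (M : coll) : int := eps_Z p%:Z M.

Definition phi_hat (l : nat) (p : 'I_l) (M : coll) : int :=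
  eps_hat p M + simple_coroot p (wt l M).

Definition L_e (l : nat) (k : maya) (p : 'I_l) : set int :=
  [set q | (q = p%:Z %[mod l%:Z])%Z /\
           ((k : set int) q /\ ~ (k : set int) (q + 1) \/
            ~ (k : set int) q /\ (k : set int) (q + 1))].

(* In the next two definitions the finite set L^e(k, p) is enumerated in some
   order, which is immaterial on BZ_Z since the factors commute.  The default 0
   for a vanishing product is not used when eps_hat p M != 0 and sigma(M) = M. *)
Definition e_hat (l : nat) (p : 'I_l) (M : coll) : option coll :=
  if eps_hat p M == 0 then None
  else Some (fun k =>
    if foldr (fun q N => obind (e_Z q) N) (Some M) (enum_fset (fset_set (L_e k p)))
      is Some N then N k else 0).

Definition f_hat (l : nat) (p : 'I_l) (M : coll) : coll := fun k =>
  foldr f_Z M (enum_fset (fset_set (L_e k p))) k.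

(** * Crystals *)

(* Z \cup {-oo}, with None for -oo *)
Definition addzo (x : option int) (n : int) : option int := omap (fun m => m + n) x.

(* A crystal (in the sense of Kashiwara) with index set J, weight lattice P,
   simple coroots h and simple roots alpha, on a subset B of T; None in
   [option T] is the extra element 0. *)
Record is_crystal (J : Type) (P : zmodType) (h : J -> P -> int) (alpha : J -> P)
    (T : Type) (B : set T) (wt : T -> P) (eps phi : J -> T -> option int)
    (e f : J -> T -> option T) : Prop := {
  crystal_e_closed : forall i b b', B b -> e i b = Some b' -> B b';
  crystal_f_closed : forall i b b', B b -> f i b = Some b' -> B b';
  crystal_phi : forall i b, B b -> phi i b = addzo (eps i b) (h i (wt b));
  crystal_e : forall i b b', B b -> e i b = Some b' ->
    [/\ wt b' = wt b + alpha i, eps i b' = addzo (eps i b) (-1)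
      & phi i b' = addzo (phi i b) 1];
  crystal_f : forall i b b', B b -> f i b = Some b' ->
    [/\ wt b' = wt b - alpha i, eps i b' = addzo (eps i b) 1
      & phi i b' = addzo (phi i b) (-1)];
  crystal_ef : forall i b b', B b -> B b' -> (f i b = Some b' <-> e i b' = Some b);
  crystal_infty : forall i b, B b -> phi i b = None -> e i b = None /\ f i b = None
}.

Definition is_affine_crystal (l : nat) (T : Type) (B : set T) (wt : T -> wlat l)
    (eps phi : 'I_l -> T -> option int) (e f : 'I_l -> T -> option T) : Prop :=
  is_crystal (@simple_coroot l) (@simple_root l) B wt eps phi e f.

(* Main.v *)
(* On a finite window the e-BZ conditions say that M is a tropical flag minor: (BZ-2) are the
   tropical three-term Pluecker relations, and they determine M from its values on intervals,
   which are partial sums of the Lusztig datum; given them, (BZ-1) reduces to the nonnegativity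
   of that datum.  The tropical Chevalley generator, which replaces M_K by
   min(M_K, M_{sigma_p K}) when K contains p but not p + 1, preserves the Pluecker relations.
   Two consequences carry the proof.  First, the tableau formula satisfies the Pluecker
   relations, as removing the diagonal of a tableau writes it as a product of such generators.
   Secondly, in terms of M the operator f_p is the Anderson-Mirkovic formula, in which M_K is
   replaced by
     min(M_K + 1, M_{sigma_p K} + eps_p) if p is in K and p + 1 is not,
     M_K - 1                             if p + 1 is in K and p is not,
     M_K                                 otherwise;
   it is enough to compare the two on intervals.  By the Pluecker relations this
   formula is injective in M, and e_p is its inverse.

   Over Z, supermodularity makes M_{Omega_J(k)} nonincreasing in J, so that condition (2-b)
   says that these values are bounded below, which is clear for all operators because each
   factor changes a value by at most 1.  The factors of \hat f_p commute, and those outside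
   L^e(k, p) do not change the value at k; hence \hat f_p is injective, it has \hat e_p as its
   inverse, and it lowers Theta at k(Lambda_p) by 1 and fixes the other ones. *)
From HB Require Import structures.
Require Import Defs.
From mathcomp Require Import all_boot all_order all_algebra finmap zify.
From mathcomp Require Import boolp classical_sets functions cardinality.

Set Implicit Arguments.
Unset Strict Implicit.
Unset Printing Implicit Defensive.

Import Order.TTheory GRing.Theory Num.Theory.
Local Open Scope ring_scope.

(** * Tropical Pluecker relations *)

(** A Chevalley generator with parameter t turns a Pluecker relation into a polynomial in t of
    degree 2. Its outer coefficients are Pluecker relations again. The middle one mixes two index
    sets, and since nothing can be subtracted tropically, it is obtained from two subtraction-free
    identities that share one term. The recursion for tableaux is multiplication by the triangular
    matrix of ones, whose nonzero minors belong to the interlacing pairs of index sets. Removing a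
    diagonal lowers the number of rows by 1, and a generic row is added to make up for it. The
    obstacle over Z is that \hat f_p is an infinite product, which makes sense only value by value,
    and that \hat e_p takes its values at different diagrams from different collections. Both are
    compared with one finite product on each window. If the ends of the window avoid the residue
    class of p, the factors can be cancelled one by one inside it; injectivity also makes the finite
    preimages of different products compatible. *)

Definition in_window (l r : int) (K : {fset int}) : Prop :=
  forall x : int, x \in K -> l <= x <= r.

(** The size of [K] is a parameter because the relations for the tableau formula are proved by
    induction on it. *)
Definition plucker (l r : int) (n : nat) (G : {fset int} -> int) : Prop :=
  forall (i j k : int) (K : {fset int}), l <= i -> i < j -> j < k -> k <= r -> in_window l r K ->
    i \notin K -> j \notin K -> k \notin K -> #|` K| = n ->
    G (i |` (k |` K))%fset + G (j |` K)%fset =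
    Num.min (G (i |` (j |` K))%fset + G (k |` K)%fset)
            (G (j |` (k |` K))%fset + G (i |` K)%fset).

Lemma fset1UC (a b : int) (K : {fset int}) :
  (a |` (b |` K) = b |` (a |` K))%fset.
Proof. exact: fsetUCA. Qed.

Lemma in_window1 l r x K : l <= x <= r -> in_window l r K -> in_window l r (x |` K)%fset.
Proof. by move=> hx hK y; rewrite !inE => /orP[/eqP->|/hK]. Qed.

Lemma in_windowS l r (A B : {fset int}) : (A `<=` B)%fset -> in_window l r B -> in_window l r A.
Proof. by move=> /fsubsetP AB hB x /AB /hB. Qed.

Lemma card1U (x : int) (K : {fset int}) : x \notin K -> #|` (x |` K)%fset| = (#|` K|).+1.
Proof. by move=> xK; rewrite cardfsU1 xK. Qed.


(** * The cross relation between two index sets *)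

Lemma plucker4_arith (ui uj uv vi vj ij uij vij uvi uvj : int) :
 uij + vi = Num.min (uvi + ij) (vij + ui) ->
 uij + vj = Num.min (uvj + ij) (vij + uj) ->
 uvj + ui = Num.min (uvi + uj) (uij + uv) ->
 uvj + vi = Num.min (uvi + vj) (vij + uv) ->
 ui + vj = Num.min (uv + ij) (uj + vi).
Proof. lia. Qed.

(** A name such as [uij] stands for the value at {u, i, j} joined to a fixed set; here u < v < i < j
    < k. Multiplicatively, the coefficient of t is uik vj + vik uj = uij vk + vij uk + ujk vi + vjk
    ui. This lemma and the next give it in two halves that share the term [ijk + uv]; the
    [cross_inner] lemmas do the same for i < u < v < j < k. *)
Lemma cross_outer1 (ui uj uk vi vj vk uij uik ujk ij ik jk uv ijk : int) :
 uik + ij = Num.min (uij + ik) (ijk + ui) ->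
 uik + uj = Num.min (uij + uk) (ujk + ui) ->
 ujk + ij = Num.min (uij + jk) (ijk + uj) ->
 ui + vj = Num.min (uv + ij) (uj + vi) ->
 vj + ik = Num.min (vi + jk) (vk + ij) ->
 uj + ik = Num.min (ui + jk) (uk + ij) ->
 uj + vk = Num.min (uv + jk) (uk + vj) ->
 ui + vk = Num.min (uv + ik) (uk + vi) ->
 uik + vj = Num.min (Num.min (ijk + uv) (ujk + vi)) (uij + vk).
Proof. lia. Qed.

Lemma cross_outer2 (ui uj uk vi vj vk vij vik vjk ij ik jk uv ijk : int) :
 vik + ij = Num.min (vij + ik) (ijk + vi) ->
 vik + vj = Num.min (vij + vk) (vjk + vi) ->
 vjk + ij = Num.min (vij + jk) (ijk + vj) ->
 ui + vj = Num.min (uv + ij) (uj + vi) ->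
 vj + ik = Num.min (vi + jk) (vk + ij) ->
 uj + ik = Num.min (ui + jk) (uk + ij) ->
 uj + vk = Num.min (uv + jk) (uk + vj) ->
 ui + vk = Num.min (uv + ik) (uk + vi) ->
 Num.min (vjk + ui) (vij + uk) = Num.min (vik + uj) (ijk + uv).
Proof. lia. Qed.

Lemma cross_inner1 (iu uj uk iv vj vk ivj ivk vjk ij ik jk uv ijk : int) :
 ivk + ij = Num.min (ivj + ik) (ijk + iv) ->
 ivk + vj = Num.min (ivj + vk) (vjk + iv) ->
 ijk + vj = Num.min (ivj + jk) (vjk + ij) ->
 ij + uk = Num.min (iu + jk) (ik + uj) ->
 ij + vk = Num.min (iv + jk) (ik + vj) ->
 iv + uj = Num.min (iu + vj) (ij + uv) ->
 iv + uk = Num.min (iu + vk) (ik + uv) ->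
 uj + vk = Num.min (uv + jk) (uk + vj) ->
 ivk + uj = Num.min (Num.min (ijk + uv) (vjk + iu)) (ivj + uk).
Proof. lia. Qed.

Lemma cross_inner2 (iu uj uk iv vj vk iuj iuk ujk ij ik jk uv ijk : int) :
 iuk + ij = Num.min (iuj + ik) (ijk + iu) ->
 iuk + uj = Num.min (iuj + uk) (ujk + iu) ->
 ijk + uj = Num.min (iuj + jk) (ujk + ij) ->
 ij + uk = Num.min (iu + jk) (ik + uj) ->
 ij + vk = Num.min (iv + jk) (ik + vj) ->
 iv + uj = Num.min (iu + vj) (ij + uv) ->
 iv + uk = Num.min (iu + vk) (ik + uv) ->
 uj + vk = Num.min (uv + jk) (uk + vj) ->
 Num.min (ujk + iv) (iuj + vk) = Num.min (iuk + vj) (ijk + uv).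
Proof. lia. Qed.

(** Expanding the product of minima gives the relation for u, the one for v and the cross relation.
    The shared term [x] enters with the third hypothesis and is absorbed, together with [vik + uj],
    by the fourth. *)
Lemma plucker_min_arith (ui uj uk vi vj vk uij uik ujk vij vik vjk x : int) :
 uik + uj = Num.min (uij + uk) (ujk + ui) ->
 vik + vj = Num.min (vij + vk) (vjk + vi) ->
 uik + vj = Num.min (Num.min x (ujk + vi)) (uij + vk) ->
 Num.min (vjk + ui) (vij + uk) = Num.min (vik + uj) x ->
 Num.min uik vik + Num.min uj vj =
 Num.min (Num.min uij vij + Num.min uk vk) (Num.min ujk vjk + Num.min ui vi).
Proof.
move=> hu hv h1 /(congr1 (fun z : int => (fun y : int => y <= z))) h2.
(* Comparing lower bounds turns each minimum into a conjunction, so that the goal becomes a Boolean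
   identity. *)
have ext (s t : int) : (forall y, (y <= s) = (y <= t)) -> s = t.
  by move=> st; apply/eqP; rewrite eq_le st lexx -st lexx.
apply: ext => y; move: h2 => /(congr1 (@^~ y)).
rewrite !addr_minl !addr_minr hu hv h1 !le_min.
by do 10 ?[case: (y <= _)].
Qed.

Section Cross.
Variables (g2 : int -> int -> int) (g3 : int -> int -> int -> int) (D : int -> Prop).
Hypothesis g2C : forall x y, g2 x y = g2 y x.
Hypothesis g3C12 : forall x y z, g3 x y z = g3 y x z.
Hypothesis g3C23 : forall x y z, g3 x y z = g3 x z y.
Hypothesis base : forall x i j k, D x -> D i -> D j -> D k -> x != i -> x != j -> x != k ->
  i < j -> j < k ->
  g3 x i k + g2 x j = Num.min (g3 x i j + g2 x k) (g3 x j k + g2 x i).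

Lemma plucker4 a b c d : D a -> D b -> D c -> D d -> a < b -> b < c -> c < d ->
  g2 a c + g2 b d = Num.min (g2 a b + g2 c d) (g2 a d + g2 b c).
Proof.
move=> Da Db Dc Dd ab bc cd.
have h1 := @base a b c d Da Db Dc Dd ltac:(lia) ltac:(lia) ltac:(lia) bc cd.
have h2 := @base b a c d Db Da Dc Dd ltac:(lia) ltac:(lia) ltac:(lia) ltac:(lia) cd.
have h3 := @base c a b d Dc Da Db Dd ltac:(lia) ltac:(lia) ltac:(lia) ab ltac:(lia).
have h4 := @base d a b c Dd Da Db Dc ltac:(lia) ltac:(lia) ltac:(lia) ab bc.
rewrite !(g2C b a, g3C12 b a) in h2.
rewrite !(g2C c a, g2C c b, g3C12 c a, g3C12 c b, g3C23 _ c b) in h3.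
rewrite !(g2C d a, g2C d b, g2C d c, g3C12 d a, g3C12 d b, g3C23 _ d c, g3C23 _ d b) in h4.
exact: (plucker4_arith h3 h4 h1 h2).
Qed.

Lemma plucker_min_half u v i j k : D u -> D v -> D i -> D j -> D k ->
  i < j -> j < k -> u < v -> (v < i) \/ (i < u /\ v < j) ->
  Num.min (g3 u i k) (g3 v i k) + Num.min (g2 u j) (g2 v j) =
  Num.min (Num.min (g3 u i j) (g3 v i j) + Num.min (g2 u k) (g2 v k))
          (Num.min (g3 u j k) (g3 v j k) + Num.min (g2 u i) (g2 v i)).
Proof.
move=> Du Dv Di Dj Dk ij jk uv hij.
have ik := lt_trans ij jk.
have neq (x y : int) : x < y -> (x != y) * (y != x) by move=> xy; rewrite neq_lt xy neq_lt xy orbT.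
have neq2 (x : int) : (x < u) || (v < x) -> ((u != x) * (x != u)) * ((v != x) * (x != v)).
  case/orP=> [xu|vx]; first by rewrite !(neq _ _ xu) !(neq _ _ (lt_trans xu uv)).
  by rewrite !(neq _ _ vx) !(neq _ _ (lt_trans uv vx)).
have [hi [hj hk]] : (i < u) || (v < i) /\ ((j < u) || (v < j) /\ (k < u) || (v < k)).
  case: hij => [vi|[-> vj]]; first by rewrite vi (lt_trans vi ij) (lt_trans vi ik) !orbT.
  by rewrite vj (lt_trans vj jk) !orbT.
have Bu := base Du Di Dj Dk (neq2 _ hi).1.1 (neq2 _ hj).1.1 (neq2 _ hk).1.1 ij jk.
have Bv := base Dv Di Dj Dk (neq2 _ hi).2.1 (neq2 _ hj).2.1 (neq2 _ hk).2.1 ij jk.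
have [vi|[iu vj]] := hij.
  have [vj vk] := (lt_trans vi ij, lt_trans vi ik).
  have [ui [uj uk]] := (lt_trans uv vi, (lt_trans uv vj, lt_trans uv vk)).
  have e1 := base Di Du Dj Dk (neq _ _ ui).2 (neq _ _ ij).1 (neq _ _ ik).1 uj jk.
  have e2 := base Dj Du Di Dk (neq _ _ uj).2 (neq _ _ ij).2 (neq _ _ jk).1 ui ik.
  have e3 := base Di Dv Dj Dk (neq _ _ vi).2 (neq _ _ ij).1 (neq _ _ ik).1 vj jk.
  have e4 := base Dj Dv Di Dk (neq _ _ vj).2 (neq _ _ ij).2 (neq _ _ jk).1 vi ik.
  rewrite (g3C12 i u k) (g3C12 i u j) (g2C i u) in e1.
  rewrite (g3C12 j u k) (g2C j i) (g3C12 j u i) (g3C23 u j i) (g3C12 j i k) (g2C j u) in e2.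
  rewrite (g3C12 i v k) (g3C12 i v j) (g2C i v) in e3.
  rewrite (g3C12 j v k) (g2C j i) (g3C12 j v i) (g3C23 v j i) (g3C12 j i k) (g2C j v) in e4.
  have p1 := plucker4 Du Dv Di Dj uv vi ij.
  have p2 := plucker4 Dv Di Dj Dk vi ij jk.
  have p3 := plucker4 Du Di Dj Dk ui ij jk.
  have p4 := plucker4 Du Dv Dj Dk uv vj jk.
  have p5 := plucker4 Du Dv Di Dk uv vi ik.
  apply: (plucker_min_arith Bu Bv).
    exact: (cross_outer1 e1 Bu e2 p1 p2 p3 p4 p5).
  exact: (cross_outer2 e3 Bv e4 p1 p2 p3 p4 p5).
have vk := lt_trans vj jk.
have [iv [uj uk]] := (lt_trans iu uv, (lt_trans uv vj, lt_trans uv vk)).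
have e1 := base Di Dv Dj Dk (neq _ _ iv).1 (neq _ _ ij).1 (neq _ _ ik).1 vj jk.
have e2 := base Dj Di Dv Dk (neq _ _ ij).2 (neq _ _ vj).2 (neq _ _ jk).1 iv vk.
have e3 := base Di Du Dj Dk (neq _ _ iu).1 (neq _ _ ij).1 (neq _ _ ik).1 uj jk.
have e4 := base Dj Di Du Dk (neq _ _ ij).2 (neq _ _ uj).2 (neq _ _ jk).1 iu uk.
have p1 := plucker4 Di Du Dj Dk iu uj jk.
have p2 := plucker4 Di Dv Dj Dk iv vj jk.
have p3 := plucker4 Di Du Dv Dj iu uv vj.
have p4 := plucker4 Di Du Dv Dk iu uv vk.
have p5 := plucker4 Du Dv Dj Dk uv vj jk.

rewrite (g3C12 i v k) (g3C12 i v j) (g2C i v) in e1.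
rewrite (g3C12 j i k) (g2C j v) (g3C23 j i v) (g3C12 j v i) (g3C23 v j i) (g3C12 j v k) (g2C j i) in e2.
rewrite (g3C12 i u k) (g3C12 i u j) (g2C i u) in e3.
rewrite (g3C12 j i k) (g2C j u) (g3C23 j i u) (g3C12 j u i) (g3C23 u j i) (g3C12 j u k) (g2C j i) in e4.
rewrite (g2C i u) in p1 p3 p4; rewrite (g2C i v) in p2 p3 p4.
(* In the inner position the two halves hold with u and v exchanged. *)
rewrite ![Num.min (_ u _ _) _]minC ![Num.min (_ u _) _]minC.
apply: (plucker_min_arith Bv Bu).
  exact: (cross_inner1 e1 Bv e2 p1 p2 p3 p4 p5).
exact: (cross_inner2 e3 Bu e4 p1 p2 p3 p4 p5).
Qed.
End Cross.

(* The cases not covered by [plucker_min_half] are its mirror images under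
   [x |-> - x], which exchanges [i] and [k]. *)
Lemma plucker_min (g2 : int -> int -> int) (g3 : int -> int -> int -> int) (D : int -> Prop)
    (u v i j k : int) :
  (forall x y, g2 x y = g2 y x) -> (forall x y z, g3 x y z = g3 y x z) ->
  (forall x y z, g3 x y z = g3 x z y) ->
  (forall x i j k, D x -> D i -> D j -> D k -> x != i -> x != j -> x != k ->
     i < j -> j < k ->
     g3 x i k + g2 x j = Num.min (g3 x i j + g2 x k) (g3 x j k + g2 x i)) ->
  D u -> D v -> D i -> D j -> D k -> i < j -> j < k -> u < v ->
  (i < u) || (v < i) -> (j < u) || (v < j) -> (k < u) || (v < k) ->
  Num.min (g3 u i k) (g3 v i k) + Num.min (g2 u j) (g2 v j) =
  Num.min (Num.min (g3 u i j) (g3 v i j) + Num.min (g2 u k) (g2 v k))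
          (Num.min (g3 u j k) (g3 v j k) + Num.min (g2 u i) (g2 v i)).
Proof.
move=> g2C g3C12 g3C23 base Du Dv Di Dj Dk ij jk uv hi hj hk.
have [hij|hij] := boolP ((v < i) || ((i < u) && (v < j))).
  apply: plucker_min_half Du Dv Di Dj Dk _ _ _ _ => //.
  by case/orP: hij => [|/andP[]]; [left|right].
have hkj : (k < u) \/ (v < k /\ j < u) by lia.
pose f2 x y := g2 (- x) (- y); pose f3 x y z := g3 (- x) (- y) (- z).
have := @plucker_min_half f2 f3 (fun x => D (- x)) _ _ _ _ (- v) (- u) (- k) (- j) (- i).
rewrite /f2 /f3 !opprK !ltrN2 => H.
rewrite (minC (g3 u i k)) (minC (g2 u j)) (minC (g3 u i j)) (minC (g2 u k)) (minC (g3 u j k)).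
rewrite (minC (g2 u i)) [RHS]minC !(g3C23 _ i k) !(g3C23 _ i j) !(g3C23 _ j k).
apply: H => //.
- move=> x a b c Dx Da Db Dc xa xb xc ab bc.
  rewrite (g3C23 _ (- a)) (base (- x) (- c) (- b) (- a)) ?eqr_opp ?ltrN2 //.
  by rewrite minC (g3C23 _ (- b) (- a)) (g3C23 _ (- c) (- b)).
Qed.

(** The tropical Chevalley generator with parameter 0. Other parameters arise by conjugation with
    the tropical torus, which acts as in [plucker_linear]. *)
Definition swapmin (u v : int) (G : {fset int} -> int) (K : {fset int}) : int :=
  if (u \in K) && (v \notin K) then Num.min (G K) (G (v |` (K `\ u))%fset) else G K.

Section SwapMin.
Variables (l r : int) (n : nat) (G : {fset int} -> int).
Hypothesis PG : plucker l r n G.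

Lemma plucker_base (x i j k : int) (K : {fset int}) :
  l <= x <= r -> l <= i <= r -> l <= k <= r -> i < j -> j < k -> in_window l r K ->
  x != i -> x != j -> x != k -> x \notin K ->
  i \notin K -> j \notin K -> k \notin K -> (#|` K|).+1 = n ->
  G (x |` (i |` (k |` K)))%fset + G (x |` (j |` K))%fset =
  Num.min (G (x |` (i |` (j |` K)))%fset + G (x |` (k |` K))%fset)
            (G (x |` (j |` (k |` K)))%fset + G (x |` (i |` K))%fset).
Proof.
move=> hx /andP[li _] /andP[_ kr] ij jk hK xi xj xk xK iK jK kK cK.
have := PG (K := (x |` K)%fset) li ij jk kr.
rewrite !(fset1UC k x, fset1UC i x, fset1UC j x); apply; rewrite ?card1U ?cK //.
- exact: in_window1.
all: by rewrite !inE negb_or eq_sym; apply/andP.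
Qed.

Variables (u v : int).
Hypotheses (uv : (v == u + 1) || (u == v + 1)) (hu : l <= u <= r) (hv : l <= v <= r).

Lemma swapminU K : u \notin K -> v \notin K ->
  swapmin u v G (u |` K)%fset = Num.min (G (u |` K)%fset) (G (v |` K)%fset).
Proof.
move=> uK vK; rewrite /swapmin !inE eqxx (negPf vK) orbF /=.
by rewrite fsetU1K // ifT //; lia.
Qed.

Lemma swapmin_id K : (u \notin K) || (v \in K) -> swapmin u v G K = G K.
Proof. by rewrite /swapmin; case: (u \in K); case: (v \in K). Qed.

Lemma swapmin_plucker : plucker l r n (swapmin u v G).
Proof.
move=> i j k K li ij jk kr hK iK jK kK cK.
have Hi : l <= i <= r by lia.
have Hj : l <= j <= r by lia.
have Hk : l <= k <= r by lia.
have P0 := PG li ij jk kr hK iK jK kK cK.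
have neuv : u != v by lia.
have [vK|vK] := boolP (v \in K).
  by rewrite !swapmin_id // !inE vK ?orbT.
have [uK|uK] := boolP (u \in K).
- have eK : K = (u |` (K `\ u))%fset by rewrite fsetD1K.
  have uJ : u \notin (K `\ u)%fset by rewrite !inE eqxx.
  have vJ : v \notin (K `\ u)%fset by rewrite !inE negb_and vK orbT.
  have hJ : in_window l r (K `\ u)%fset by apply: in_windowS hK; exact: fsubD1set.
  have cJ : (#|` (K `\ u)%fset|).+1 = n by rewrite -cK (cardfsD1 u K) uK.
  have iu : i != u by apply: contraNneq iK => ->.
  have ju : j != u by apply: contraNneq jK => ->.
  have ku : k != u by apply: contraNneq kK => ->.
  have NJ x : x \notin K -> x \notin (K `\ u)%fset.
    by move=> xK; rewrite !inE negb_and xK orbT.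
  have {NJ} [iJ jJ kJ] := And3 (NJ _ iK) (NJ _ jK) (NJ _ kK).
  move: P0; rewrite {}eK; move: (K `\ u)%fset uJ vJ hJ cJ iJ jJ kJ => {iK jK kK hK cK vK uK K}.
  move=> J uJ vJ hJ cJ iJ jJ kJ.
  rewrite !(fset1UC i u, fset1UC j u, fset1UC k u) => P0.
  (* If v is one of i, j, k, the sets that contain both u and v are fixed, and the relation with u
     and v exchanged governs the other terms. *)
  have [vi|vi] := eqVneq v i.
    subst i; have uj : u < j by lia.
    have := plucker_base hv hu Hk uj jk hJ _ _ _ vJ uJ jJ kJ cJ.
    move=> /(_ ltac:(lia) ltac:(lia) ltac:(lia)).
    rewrite !(fset1UC v u) => P1.
    rewrite !(swapmin_id (K := (u |` (v |` _))%fset)) ?swapminU ?inE ?negb_or ?uJ ?vJ ?eqxx ?orbT //; lia.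
  have [vj|vj] := eqVneq v j.
    subst j; have [iu' uk'] : i < u /\ u < k by lia.
    have := plucker_base hv Hi Hk iu' uk' hJ _ _ _ vJ iJ uJ kJ cJ.
    move=> /(_ ltac:(lia) ltac:(lia) ltac:(lia)); move: P0.
    rewrite !(fset1UC i u, fset1UC v u, fset1UC i v) => P0 P1.
    rewrite !(swapmin_id (K := (u |` (v |` _))%fset)) ?swapminU ?inE ?negb_or ?uJ ?vJ ?eqxx ?orbT //; lia.
  have [vk|vk] := eqVneq v k.
    subst k; have uj : j < u by lia.
    have := plucker_base hv Hi hu ij uj hJ _ _ _ vJ iJ jJ uJ cJ.
    move=> /(_ ltac:(lia) ltac:(lia) ltac:(lia)); move: P0.
    rewrite !(fset1UC i u, fset1UC j u, fset1UC v u, fset1UC i v, fset1UC j v) => P0 P1.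
    rewrite !(swapmin_id (K := (u |` (v |` _))%fset)) ?swapminU ?inE ?negb_or ?uJ ?vJ ?eqxx ?orbT //; lia.
  (* All six sets contain u and not v, so both factors of every product are minima: this needs the
     cross relation. *)
  rewrite !swapminU ?inE ?negb_or ?uJ ?vJ ?[u == _]eq_sym ?iu ?ju ?ku ?vi ?vj ?vk //.
  pose g2 x y := G (x |` (y |` J))%fset; pose g3 x y z := G (x |` (y |` (z |` J)))%fset.
  pose D x := l <= x <= r /\ x \notin J.
  have g2C x y : g2 x y = g2 y x by rewrite /g2 fset1UC.
  have g3C12 x y z : g3 x y z = g3 y x z by rewrite /g3 fset1UC.
  have g3C23 x y z : g3 x y z = g3 x z y by rewrite /g3 (fset1UC y).
  have bD x a b c : D x -> D a -> D b -> D c -> x != a -> x != b -> x != c -> a < b -> b < c ->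
      g3 x a c + g2 x b = Num.min (g3 x a b + g2 x c) (g3 x b c + g2 x a).
    case=> [hx xJ] [ha aJ] [hb bJ] [hc cJ'] xa xb xc ab bc.
    exact: plucker_base hx ha hc ab bc hJ xa xb xc xJ aJ bJ cJ' cJ.
  have Du : D u by []. have Dv : D v by []. have Di : D i by [].
  have Dj : D j by []. have Dk : D k by [].
  have [uv'|vu'] : u < v \/ v < u by lia.
    by apply: (plucker_min g2C g3C12 g3C23 bD Du Dv Di Dj Dk ij jk uv'); lia.
  rewrite ![Num.min (G (u |` _)%fset) _]minC.
  by apply: (plucker_min g2C g3C12 g3C23 bD Dv Du Di Dj Dk ij jk vu'); lia.
(* Neither u nor v is in K. If u is one of i, j, k and v is not, the relation with v in place of u
   is combined with the given one; as u and v are neighbours, the order of the three indices is the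
   same. *)
- have [ui|ui] := eqVneq u i.
    subst i; have vk : v != k by lia.
    have [vj|vj] := eqVneq v j.
      subst j; rewrite ?(swapmin_id (K := (u |` (v |` _))%fset)) ?swapminU ?swapmin_id ?inE ?negb_or ?eqxx ?orbT ?uK ?vK //; first [lia | by apply/orP; left; rewrite ?andbT; lia].
    have P1 := @PG v j k K ltac:(lia) ltac:(lia) jk kr hK vK jK kK cK.
    rewrite ?(swapmin_id (K := (u |` (v |` _))%fset)) ?swapminU ?swapmin_id ?inE ?negb_or ?eqxx ?orbT ?uK ?vK //; first [lia | by apply/orP; left; rewrite ?andbT; lia].
  have [uj|uj] := eqVneq u j.
    subst j.
    have [vi|vi] := eqVneq v i.
      subst i; move: P0; rewrite !(fset1UC v u) => P0.
      rewrite ?(swapmin_id (K := (u |` (v |` _))%fset)) ?swapminU ?swapmin_id ?inE ?negb_or ?eqxx ?orbT ?uK ?vK //; first [lia | by apply/orP; left; rewrite ?andbT; lia].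
    have [vk|vk] := eqVneq v k.
      subst k; move: P0; rewrite !(fset1UC i u, fset1UC i v) => P0.
      rewrite ?(swapmin_id (K := (u |` (v |` _))%fset)) ?swapminU ?swapmin_id ?inE ?negb_or ?eqxx ?orbT ?uK ?vK //; first [lia | by apply/orP; left; rewrite ?andbT; lia].
    have := @PG i v k K li ltac:(lia) ltac:(lia) kr hK iK vK kK cK.
    move: P0; rewrite !(fset1UC i u, fset1UC i v) => P0 P1.
    rewrite ?(swapmin_id (K := (u |` (v |` _))%fset)) ?swapminU ?swapmin_id ?inE ?negb_or ?eqxx ?orbT ?uK ?vK //; first [lia | by apply/orP; left; rewrite ?andbT; lia].
  have [uk|uk] := eqVneq u k.
    subst k; have vi : v != i by lia.
    have [vj|vj] := eqVneq v j.
      subst j; move: P0; rewrite !(fset1UC i u, fset1UC v u, fset1UC i v) => P0.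
      rewrite ?(swapmin_id (K := (u |` (v |` _))%fset)) ?swapminU ?swapmin_id ?inE ?negb_or ?eqxx ?orbT ?uK ?vK //; first [lia | by apply/orP; left; rewrite ?andbT; lia].
    have := @PG i j v K li ij ltac:(lia) ltac:(lia) hK iK jK vK cK.
    move: P0; rewrite !(fset1UC i u, fset1UC j u, fset1UC i v, fset1UC j v) => P0 P1.
    rewrite ?(swapmin_id (K := (u |` (v |` _))%fset)) ?swapminU ?swapmin_id ?inE ?negb_or ?eqxx ?orbT ?uK ?vK //; first [lia | by apply/orP; left; rewrite ?andbT; lia].
  by rewrite !swapmin_id ?inE ?negb_or ?ui ?uj ?uk ?uK.
Qed.
End SwapMin.

(** * Consequences of the Pluecker relations *)

Definition plucker_all (l r : int) (G : {fset int} -> int) : Prop := forall n, plucker l r n G.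

Definition zitv (l r : int) : {fset int} :=
  [fset x in [seq (l + n%:Z)%R | n <- iota 0 (if (l <= r)%R then `|r - l|%N.+1 else 0%N)]]%fset.

Lemma mem_zitv (l r x : int) : (x \in zitv l r) = (l <= x <= r).
Proof.
rewrite !inE; apply/mapP/idP => [[n]|lxr]; first by rewrite mem_iota; case: ifP => //; lia.
by exists `|x - l|%N; rewrite ?mem_iota; [rewrite ifT; lia|lia].
Qed.

Lemma plucker_linear l r n G (x c : int) : plucker l r n G ->
  plucker l r n (fun K => G K + if x \in K then c else 0).
Proof.
move=> PG i j k K li ij jk kr hK iK jK kK cK.
have P0 := PG i j k K li ij jk kr hK iK jK kK cK; move: P0.
rewrite !inE; have [xK|xK] := boolP (x \in K); first by rewrite !orbT; lia.
rewrite !orbF; case: (eqVneq x i) => xi; case: (eqVneq x j) => xj; case: (eqVneq x k) => xk /=; lia.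
Qed.

Lemma eq_plucker l r n G H : G =1 H -> plucker l r n G -> plucker l r n H.
Proof. by move=> GH PG i j k K *; rewrite -!GH; apply: PG. Qed.

(** If J contains both ends x and y of its hull and misses j between them, the relation for x < j <
    y expresses the value at J through five sets with a smaller hull. *)
Lemma plucker_determined l r G H : plucker_all l r G -> plucker_all l r H ->
  (forall x y : int, l <= x -> y <= r -> G (zitv x y) = H (zitv x y)) ->
  forall K, in_window l r K -> G K = H K.
Proof.
move=> PG PH GH K.
suff main (n : nat) (x y : int) (J : {fset int}) : l <= x -> y <= r -> in_window x y J -> y - x + #|` J|%:Z <= n%:Z ->
    G J = H J.
  move=> hK; apply: (main (absz (r - l + #|` K|%:Z)%R) l r) => //; lia.
elim: n x y J => [|n IH] x y J lx yr hJ cJ; have [->|[z zJ]] := fset_0Vmem J.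
(* The empty set counts as an interval; its left end has to be at least [l] and to exceed [r]. *)
- have -> : fset0 = zitv (Num.max l (r + 1)) r by apply/fsetP => z; rewrite mem_zitv inE; lia.
  by apply: GH; lia.
- by have := hJ z zJ; have : (0 < #|` J|)%N by [rewrite cardfs_gt0; apply/fset0Pn; exists z]; lia.
- have -> : fset0 = zitv (Num.max l (r + 1)) r by apply/fsetP => z; rewrite mem_zitv inE; lia.
  by apply: GH; lia.
have xy : x <= y by have := hJ z zJ; lia.
have [xJ|xJ] := boolP (x \in J); last first.
  apply: (IH (x + 1) y) => //; try lia.
  by move=> t tJ; have := hJ t tJ; have : t != x by [apply: contraNneq xJ => <-]; lia.
have [yJ|yJ] := boolP (y \in J); last first.
  apply: (IH x (y - 1)) => //; try lia.
  by move=> t tJ; have := hJ t tJ; have : t != y by [apply: contraNneq yJ => <-]; lia.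
have [sub|/fsubsetPn[j]] := boolP (zitv x y `<=` J)%fset.
  have -> : J = zitv x y; last by apply: GH.
  apply/eqP; rewrite eqEfsubset sub andbT; apply/fsubsetP => t /hJ; by rewrite mem_zitv.
rewrite mem_zitv => xjy jJ.
have xj : x < j by have : j != x by [apply: contraNneq jJ => ->]; lia.
have jy : j < y by have : j != y by [apply: contraNneq jJ => ->]; lia.
have {xjy} xy' : x < y by lia.
pose L := ((J `\ x) `\ y)%fset.
have hL t : t \in L -> x < t < y.
  by rewrite /L !inE => /and3P[ty tx /hJ]; lia.
have xL : x \notin L by rewrite /L !inE eqxx !andbF.
have yL : y \notin L by rewrite /L !inE eqxx.
have jL : j \notin L by rewrite /L !inE (negPf jJ) !andbF.
have eJ : J = (x |` (y |` L))%fset.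
  by rewrite /L fsetD1K ?fsetD1K // !inE yJ andbT; lia.
clearbody L.
have yxL : x \notin (y |` L)%fset by rewrite !inE negb_or xL andbT; lia.
have cL : #|` J| = (#|` L|).+2 by rewrite eJ !card1U.
have wL : in_window l r L by move=> t /hL; lia.
have W a b : x <= a -> b <= y -> forall N : {fset int}, (forall t, t \in N -> a <= t <= b) ->
   b - a + #|` N|%:Z <= n%:Z -> G N = H N.
  by move=> xa yb N hN; apply: IH => //; lia.
have e1 : G (x |` (j |` L))%fset = H (x |` (j |` L))%fset.
  apply: (W x (y - 1)); [lia|lia| |by rewrite !card1U // ?inE ?negb_or ?xL; lia].
  by move=> t; rewrite !inE => /or3P[/eqP->|/eqP->|/hL]; lia.
have e2 : G (y |` L)%fset = H (y |` L)%fset.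
  apply: (W (x + 1) y); [lia|lia| |by rewrite card1U //; lia].
  by move=> t; rewrite !inE => /orP[/eqP->|/hL]; lia.
have e3 : G (j |` (y |` L))%fset = H (j |` (y |` L))%fset.
  apply: (W (x + 1) y); [lia|lia| |by rewrite !card1U // ?inE ?negb_or ?jL; lia].
  by move=> t; rewrite !inE => /or3P[/eqP->|/eqP->|/hL]; lia.
have e4 : G (x |` L)%fset = H (x |` L)%fset.
  apply: (W x (y - 1)); [lia|lia| |by rewrite card1U //; lia].
  by move=> t; rewrite !inE => /orP[/eqP->|/hL]; lia.
have e5 : G (j |` L)%fset = H (j |` L)%fset.
  apply: (W x (y - 1)); [lia|lia| |by rewrite card1U //; lia].
  by move=> t; rewrite !inE => /orP[/eqP->|/hL]; lia.
have pG := PG #|` L| x j y L lx xj jy yr wL xL jL yL erefl.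
have pH := PH #|` L| x j y L lx xj jy yr wL xL jL yL erefl.
by apply: (addIr (G (j |` L)%fset)); rewrite eJ pG e5 pH e1 e2 e3 e4.
Qed.

Definition supermodular_at (G : {fset int} -> int) (i j : int) (K : {fset int}) : Prop :=
  G (i |` K)%fset + G (j |` K)%fset <= G (i |` (j |` K))%fset + G K.

(* Induction on the hull of [i, j] and [K]: the Pluecker relations push [i] and [j]
   to the end points of the hull, and then insert a missing point between them. *)
Lemma plucker_supermodular l r G : plucker_all l r G ->
  (forall x y : int, l <= x -> x < y -> y <= r -> supermodular_at G x y (zitv (x + 1) (y - 1))) ->
  forall (i j : int) (K : {fset int}), l <= i -> i < j -> j <= r -> in_window l r K -> i \notin K -> j \notin K ->
  supermodular_at G i j K.
Proof.
move=> PG HG i j K li ij jr hK iK jK.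
suff main (n : nat) (x y : int) : l <= x -> y <= r -> y - x <= n%:Z -> forall (a b : int) (J : {fset int}), in_window x y J ->
    x <= a -> a < b -> b <= y -> a \notin J -> b \notin J -> supermodular_at G a b J.
  apply: (main (absz (r - l)%R) l r) => //; lia.
move: {i j K li ij jr hK iK jK} n x y; elim=> [|n IH] x y lx yr nxy.
  by move=> a b J _ xa ab yb; have := le_lt_trans xa (lt_le_trans ab yb); lia.
have H0 : x < y -> forall J, in_window x y J -> x \notin J -> y \notin J ->
    supermodular_at G x y J.
  move=> xy J hJ xJ yJ.
  have hJ' t : t \in J -> x < t < y.
    by move=> tJ; rewrite !lt_neqAle (eq_sym x t) (memPn xJ) // (memPn yJ) //; exact: hJ.
  have [sub|/fsubsetPn[j]] := boolP (zitv (x + 1) (y - 1) `<=` J)%fset.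
    have -> : J = zitv (x + 1) (y - 1); last exact: HG.
    apply/eqP; rewrite eqEfsubset sub andbT; apply/fsubsetP => t /hJ'.
    by rewrite mem_zitv; clear; lia.
  rewrite mem_zitv => hj jJ.
  have [xj jy] : x < j /\ j < y by move: hj; clear; lia.
  have Px := PG #|` J| x j y J lx xj jy yr.
  have {}Px := Px _ xJ jJ yJ erefl.
  have wl : in_window x (y - 1) J by move=> t /hJ'; clear; lia.
  have wr : in_window (x + 1) y J by move=> t /hJ'; clear; lia.
  have SMl : supermodular_at G x j J.
    by apply: (IH x (y - 1)) => //; move: xj jy yr nxy; clear; lia.
  have SMr : supermodular_at G j y J.
    by apply: (IH (x + 1) y) => //; move: xj jy lx nxy; clear; lia.
  have hJr : in_window l r J by move=> t /hJ; move: lx yr; clear; lia.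
  by move: (Px hJr) SMl SMr; rewrite /supermodular_at; clear; lia.
have H1 (a : int) (J : {fset int}) : x <= a -> a < y -> in_window x y J -> a \notin J -> y \notin J ->
    supermodular_at G a y J.
  move=> xa ay hJ aJ yJ; have xy : x < y by exact: le_lt_trans ay.
  have [xJ|xJ] := boolP (x \in J); last first.
    have [ax|ax] := eqVneq a x; first by rewrite ax in aJ *; apply: H0.
    apply: (IH (x + 1) y) => //; try by move: xa ax lx nxy; clear; lia.
    move=> t tJ; have := hJ t tJ; have : t != x by exact: memPn tJ.
    by clear; lia.
  have xa' : x < a by rewrite lt_neqAle xa andbT (memPn aJ).
  have wJ : in_window l r J by move=> t /hJ; move: lx yr; clear; lia.
  have := fsetD1K xJ; move: (J `\ x)%fset (negbT (fsetD11 x J)) => N xN eJ.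
  have wN : in_window l r N by apply: in_windowS wJ; rewrite -eJ fsubsetUr.
  have aN : a \notin N by apply: contra aJ; rewrite -eJ !inE => ->; rewrite orbT.
  have yN : y \notin N by apply: contra yJ; rewrite -eJ !inE => ->; rewrite orbT.
  have := PG #|` N| x a y N lx xa' ay yr wN xN aN yN erefl.
  have : supermodular_at G x y (a |` N)%fset.
    apply: H0 => //; rewrite ?inE ?negb_or ?xN ?yN ?(lt_eqF xa') ?(gt_eqF ay) //.
    move=> t; rewrite !inE => /orP[/eqP->|tN]; first by rewrite xa ltW.
    by apply: hJ; rewrite -eJ !inE tN orbT.
  rewrite /supermodular_at -eJ !(fset1UC a x, fset1UC y x, fset1UC y a).
  by clear; lia.
move=> a b J hJ xa ab yb aJ bJ.
have [yJ|yJ] := boolP (y \in J); last first.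
  have [yb'|yb'] := eqVneq b y; first by rewrite yb' in ab bJ *; apply: H1.
  apply: (IH x (y - 1)) => //; try by move: yb yb' yr nxy; clear; lia.
  move=> t tJ; have := hJ t tJ; have : t != y by exact: memPn tJ.
  by clear; lia.
have yb' : b < y by rewrite lt_neqAle yb andbT eq_sym (memPn bJ).
have wJ : in_window l r J by move=> t /hJ; move: lx yr; clear; lia.
have := fsetD1K yJ; move: (J `\ y)%fset (negbT (fsetD11 y J)) => N yN eJ.
have wN : in_window l r N by apply: in_windowS wJ; rewrite -eJ fsubsetUr.
have aN : a \notin N by apply: contra aJ; rewrite -eJ !inE => ->; rewrite orbT.
have bN : b \notin N by apply: contra bJ; rewrite -eJ !inE => ->; rewrite orbT.
have := PG #|` N| a b y N (le_trans lx xa) ab yb' yr wN aN bN yN erefl.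
have : supermodular_at G a y (b |` N)%fset.
  apply: H1 => //; rewrite ?inE ?negb_or ?aN ?yN ?(lt_eqF ab) ?(gt_eqF yb') //.
    exact: lt_trans yb'.
  move=> t; rewrite !inE => /orP[/eqP->|tN].
    by move: xa ab yb; clear; lia.
  by apply: hJ; rewrite -eJ !inE tN orbT.
rewrite /supermodular_at -eJ !(fset1UC y b).
by clear; lia.
Qed.

(** * Data on a window and the Anderson-Mirkovic formula *)

Definition bz (l r : int) (G : {fset int} -> int) : Prop :=
  [/\ forall x : int, l - 1 <= x <= r -> G (zitv l x) = 0,
      plucker_all l r G
    & forall (i j : int) (K : {fset int}), l <= i -> i < j -> j <= r -> in_window l r K ->
        i \notin K -> j \notin K -> supermodular_at G i j K].

(** The subtracted value, at [l, q - 1] with q + 1 added, is -eps_q. *)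
Definition am_op (l q : int) (G : {fset int} -> int) (K : {fset int}) : int :=
  if q \in K then
    if q + 1 \in K then G K
    else Num.min (G K + 1) (G ((q + 1)%R |` (K `\ q))%fset - G ((q + 1)%R |` zitv l (q - 1))%fset)
  else if q + 1 \in K then G K - 1 else G K.

Lemma in_window_zitv l r x y : l <= x -> y <= r -> in_window l r (zitv x y).
Proof. by move=> lx yr z; rewrite mem_zitv => /andP[xz zy]; rewrite (le_trans lx) ?(le_trans zy). Qed.

Lemma zitv_recr (l x : int) : l <= x -> zitv l x = (x |` zitv l (x - 1))%fset.
Proof. by move=> lx; apply/fsetP => z; rewrite !(mem_zitv, inE); move: lx; clear; lia. Qed.

Lemma zitv_recl (l x : int) : l <= x -> zitv l x = (l |` zitv (l + 1) x)%fset.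
Proof. by move=> lx; apply/fsetP => z; rewrite !(mem_zitv, inE); move: lx; clear; lia. Qed.

(** Up to linear terms the formula is [swapmin]: before it, e = eps_q - 1 is added on the sets
    containing q + 1; after it, 1 is added on those containing q and - e - 1 on those containing q +
    1. *)
Lemma am_op_plucker (l r l' q : int) n G : l <= q -> q < r -> plucker l r n G -> plucker l r n (am_op l' q G).
Proof.
move=> lq qr PG; pose e : int := - G ((q + 1)%R |` zitv l' (q - 1))%fset - 1.
pose G1 (K : {fset int}) : int := G K + if q + 1 \in K then e else 0.
have P1 : plucker l r n (swapmin q (q + 1) G1).
  by apply: swapmin_plucker; [exact: plucker_linear|rewrite eqxx|rewrite lq ltW|lia].
have := plucker_linear (q + 1) (- e - 1) (plucker_linear q 1 P1).
apply: eq_plucker => K; rewrite /swapmin /am_op /G1.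
have qq : (q + 1 == q) = false by clear; lia.
have [qK|qK] := boolP (q \in K); have [q1K|q1K] := boolP (q + 1 \in K) => /=;
  rewrite ?(negPf q1K) ?q1K /= ?inE ?eqxx ?qq /e /=; try (clear; lia).
by rewrite !addr0 addr_minl addrA subrK.
Qed.

Section Bz.
Variables (l r q : int) (qr : q < r).

(* Every [J] avoiding [q, q + 1] is joined to the interval [l, q - 1] by deleting points above
   [q + 1] and inserting points below [q]. *)
Lemma gap_ind (Pr : {fset int} -> Prop) :
  Pr (zitv l (q - 1)) ->
  (forall (y : int) (J : {fset int}), q + 1 < y -> y <= r -> in_window l r J ->
     q \notin J -> q + 1 \notin J -> y \notin J -> Pr J -> Pr (y |` J)%fset) ->
  (forall (i : int) (J : {fset int}), l <= i -> i < q -> in_window l r J ->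
     q \notin J -> q + 1 \notin J -> i \notin J -> Pr (i |` J)%fset -> Pr J) ->
  forall J, in_window l r J -> q \notin J -> q + 1 \notin J -> Pr J.
Proof.
move=> P0 Pup Pdn J.
have [n] := ubnP (#|` (J `\` zitv l (q - 1))%fset| + #|` (zitv l (q - 1) `\` J)%fset|)%N.
elim: n J => // n IH J; rewrite ltnS => nJ hJ qJ q1J.
have [/fsubsetP sub|/fsubsetPn[y yJ]] := boolP (J `<=` zitv l (q - 1))%fset.
  have [/fsubsetP sub'|/fsubsetPn[i]] := boolP (zitv l (q - 1) `<=` J)%fset.
    have -> // : J = zitv l (q - 1).
    by apply/fsetP => z; apply/idP/idP => [/sub|/sub'].
  rewrite mem_zitv => /andP[li iq] iJ; have iq' : i < q by move: iq; clear; lia.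
  apply: (Pdn i) => //; apply: IH; last 1 first.
  - by rewrite !inE negb_or q1J andbT; move: iq'; clear; lia.
  - apply: leq_trans nJ; rewrite -addnS leq_add //.
      apply: fsubset_leq_card; apply/fsubsetP => z; rewrite !(mem_zitv, inE).
      by case/andP => zq /orP[/eqP zi|->]; rewrite ?zq //; move: zq; rewrite zi; move: li iq; clear; lia.
    rewrite [leqRHS](cardfsD1 i) !(mem_zitv, inE) iJ li iq /= add1n ltnS.
    by apply: fsubset_leq_card; apply/fsubsetP => z; rewrite !inE negb_or => /andP[/andP[-> ->] ->].
  - by apply: in_window1 hJ; move: li iq' qr; clear; lia.
  - by rewrite !inE negb_or qJ andbT; move: iq'; clear; lia.
rewrite mem_zitv => yq; have hy := hJ y yJ.
have q1y : q + 1 < y.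
  have := memPn qJ y yJ; have := memPn q1J y yJ; move: yq hy; clear; lia.
have := fsetD1K yJ; move: (J `\ y)%fset (negbT (fsetD11 y J)) => N yN eJ.
have sN : (N `<=` J)%fset by rewrite -eJ fsubsetUr.
have wN := in_windowS sN hJ.
have qN : q \notin N by apply: contra qJ; apply: (fsubsetP sN).
have q1N : q + 1 \notin N by apply: contra q1J; apply: (fsubsetP sN).
rewrite -eJ; apply: Pup => //; first by case/andP: hy.
apply: IH => //; apply: leq_trans nJ; rewrite -addSn leq_add //.
  rewrite -[in leqRHS]eJ [leqRHS](cardfsD1 y) !(mem_zitv, inE) eqxx yq /= add1n ltnS.
  apply: fsubset_leq_card; apply/fsubsetP => z; rewrite !inE => /andP[-> zN].
  by rewrite zN orbT !andbT; apply: contraNneq yN => <-.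
apply: fsubset_leq_card; apply/fsubsetP => z; rewrite -eJ !(mem_zitv, inE) negb_or.
by case/andP=> -> hz; rewrite hz !andbT; apply: contraNneq yq => <-.
Qed.

End Bz.

Ltac lia_values G := do ![let g := fresh in move: (G _) => g]; clear; lia.

Section Bz.
Variables (l r : int).

(** The difference of the values at q + J and (q + 1) + J equals eps_q for J = [l, q - 1], where the
    first value is 0, and by the Pluecker relations it cannot increase along the steps of
    [gap_ind]. *)
Lemma eps_bound (q : int) G : l <= q -> q < r -> bz l r G ->
  forall J, in_window l r J -> q \notin J -> q + 1 \notin J ->
  G (q |` J)%fset + G ((q + 1)%R |` zitv l (q - 1))%fset <= G ((q + 1)%R |` J)%fset.
Proof.
move=> lq qr [G0 PG _].
have q1r : q + 1 <= r by lia.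
have qq1 : q < q + 1 by lia.
apply: (gap_ind (Pr := fun J => G (q |` J)%fset + G ((q + 1)%R |` zitv l (q - 1))%fset
  <= G ((q + 1)%R |` J)%fset) qr).
- by rewrite -zitv_recr // G0 ?add0r //; move: lq qr; clear; lia.
- move=> y J qy yr hJ qJ q1J yJ.
  have := PG #|` J| q (q + 1) y J lq qq1 qy yr hJ qJ q1J yJ erefl.
  by cbv beta; lia_values G.
- move=> i J li iq hJ qJ q1J iJ.
  have := PG #|` J| i q (q + 1) J li iq qq1 q1r hJ iJ qJ q1J erefl.
  by cbv beta; rewrite !(fset1UC i); lia_values G.
Qed.

(** Outside the sets that contain q but not q + 1 the formula can be read backwards at once. On
    those sets G is determined by its other values: it vanishes at [l, q], and each step of
    [gap_ind] gives a relation with a single unknown. *)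
Lemma am_op_inj (q : int) G H : l <= q -> q < r -> bz l r G -> bz l r H ->
  (forall K, in_window l r K -> am_op l q G K = am_op l q H K) ->
  forall K, in_window l r K -> G K = H K.
Proof.
move=> lq qr [G0 PG _] [H0 PH _] GH.
have q1r : q + 1 <= r by lia.
have qq1 : q < q + 1 by lia.
have fix0 K : in_window l r K -> (q \in K) = (q + 1 \in K) -> G K = H K.
  by move=> /GH; rewrite /am_op => + e; rewrite e; case: (q + 1 \in K).
have fix1 K : in_window l r K -> q \notin K -> q + 1 \in K -> G K = H K.
  by move=> /GH e /negPf qK q1K; move: e; rewrite /am_op qK q1K => /addIr.
have main : forall J, in_window l r J -> q \notin J -> q + 1 \notin J ->
    G (q |` J)%fset = H (q |` J)%fset.
  apply: (gap_ind (Pr := fun J => G (q |` J)%fset = H (q |` J)%fset) qr).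
  - by rewrite -zitv_recr // G0 ?H0 //; move: lq qr; clear; lia.
  - move=> y J qy yr hJ qJ q1J yJ.
    have := PG #|` J| q (q + 1) y J lq qq1 qy yr hJ qJ q1J yJ erefl.
    have := PH #|` J| q (q + 1) y J lq qq1 qy yr hJ qJ q1J yJ erefl.
    have wq : l <= q <= r by rewrite lq ltW.
    have wq1 : l <= q + 1 <= r by rewrite q1r andbT; move: lq; clear; lia.
    have wy : l <= y <= r by move: lq qy yr; clear; lia.
    have qy' : (q == y) = false by move: qy; clear; lia.
    have q1y' : (q + 1 == y) = false by move: qy; clear; lia.
    have qq1' : (q == q + 1) = false by move: qy; clear; lia.
    rewrite (fix1 ((q + 1)%R |` J)%fset); last first.
    - by rewrite !inE eqxx.
    - by rewrite !inE qq1'.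
    - exact: in_window1.
    rewrite (fix0 (q |` ((q + 1)%R |` J))%fset); last first.
    - by rewrite !inE !eqxx orbT.
    - by do 2 apply: in_window1 => //.
    rewrite (fix0 (y |` J)%fset); last first.
    - by rewrite !inE qy' q1y' (negPf qJ) (negPf q1J).
    - exact: in_window1.
    rewrite (fix1 ((q + 1)%R |` (y |` J))%fset); last first.
    - by rewrite !inE eqxx.
    - by rewrite !inE qq1' qy'.
    - by do 2 apply: in_window1 => //.
    by cbv beta; do ![move: (G _) => ?]; lia_values H.
  - move=> i J li iq hJ qJ q1J iJ.
    have := PG #|` J| i q (q + 1) J li iq qq1 q1r hJ iJ qJ q1J erefl.
    have := PH #|` J| i q (q + 1) J li iq qq1 q1r hJ iJ qJ q1J erefl.
    have wq : l <= q <= r by rewrite lq ltW.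
    have wq1 : l <= q + 1 <= r by rewrite q1r andbT; move: lq; clear; lia.
    have wi : l <= i <= r by move: li iq qr; clear; lia.
    have qy' : (q == i) = false by move: iq; clear; lia.
    have q1y' : (q + 1 == i) = false by move: iq; clear; lia.
    have qq1' : (q == q + 1) = false by clear; lia.
    rewrite !(fset1UC i).
    rewrite (fix1 ((q + 1)%R |` J)%fset); last first.
    - by rewrite !inE eqxx.
    - by rewrite !inE qq1'.
    - exact: in_window1.
    rewrite (fix0 (q |` ((q + 1)%R |` J))%fset); last first.
    - by rewrite !inE !eqxx orbT.
    - by do 2 apply: in_window1 => //.
    rewrite (fix0 (i |` J)%fset); last first.
    - by rewrite !inE qy' q1y' (negPf qJ) (negPf q1J).
    - exact: in_window1.
    rewrite (fix1 ((q + 1)%R |` (i |` J))%fset); last first.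
    - by rewrite !inE eqxx.
    - by rewrite !inE qq1' qy'.
    - by do 2 apply: in_window1 => //.
    by cbv beta => hH hG e; move: hG; rewrite e -hH => /addrI.
move=> K hK; have [qK|qK] := boolP (q \in K); have [q1K|q1K] := boolP (q + 1 \in K).
- by apply: fix0 => //; rewrite qK q1K.
- rewrite -(fsetD1K qK); apply: main.
  + by apply: in_windowS hK; exact: fsubD1set.
  + by rewrite !inE eqxx.
  + by rewrite !inE (negPf q1K) andbF.
- exact: fix1.
- by apply: fix0 => //; rewrite (negPf qK) (negPf q1K).
Qed.

Lemma bz_supermodular1 G (x : int) (C D : {fset int}) : bz l r G -> (C `<=` D)%fset ->
  in_window l r (x |` D)%fset -> x \notin D ->
  G (x |` C)%fset + G D <= G (x |` D)%fset + G C.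
Proof.
move=> [_ _ SM] CD hD xD; have [n] := ubnP #|` (D `\` C)%fset|.
elim: n D CD hD xD => // n IH D CD hD xD; rewrite ltnS => nD.
have [DC|/fsubsetPn[d dD dC]] := boolP (D `<=` C)%fset.
  by have -> : C = D by [apply/eqP; rewrite eqEfsubset CD]; rewrite addrC.
have := fsetD1K dD; move: (D `\ d)%fset (negbT (fsetD11 d D)) => N dN eD.
have ND : (N `<=` D)%fset by rewrite -eD fsubsetUr.
have xN : x \notin N by apply: contra xD; apply: (fsubsetP ND).
have CN : (C `<=` N)%fset.
  apply/fsubsetP => z zC; have := fsubsetP CD z zC; rewrite -eD !inE => /orP[/eqP zd|//].
  by move: dC; rewrite -zd zC.
have wD : in_window l r D by apply: in_windowS hD; rewrite fsubsetUr.
have wN : in_window l r N by apply: in_windowS wD.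
have wx : l <= x <= r by apply: hD; rewrite !inE eqxx.
have wd : l <= d <= r by apply: wD.
have wxN : in_window l r (x |` N)%fset by exact: in_window1.
have cN : (#|` (N `\` C)%fset| < n)%N.
  apply: leq_trans nD; rewrite [leqRHS](cardfsD1 d) -eD !inE eqxx dC /= add1n ltnS.
  apply: fsubset_leq_card; apply/fsubsetP => z; rewrite !inE => /andP[-> zN].
  by rewrite zN orbT !andbT; apply: contraNneq dN => <-.
have I1 := IH N CN wxN xN cN.
have xd : x != d by apply: contraNneq xD => ->.
have I2 : G (x |` N)%fset + G (d |` N)%fset <= G (x |` (d |` N))%fset + G N.
  case: (ltgtP x d) xd => // xd _.
    by apply: SM => //; [case/andP: wx|case/andP: wd].
  by rewrite addrC fset1UC; apply: SM => //; [case/andP: wd|case/andP: wx].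
by move: I1 I2; rewrite -eD; clear; lia.
Qed.

Lemma bz_supermodular G (A B : {fset int}) : bz l r G -> in_window l r A -> in_window l r B ->
  G A + G B <= G (A `|` B)%fset + G (A `&` B)%fset.
Proof.
move=> bG wA; have [n] := ubnP #|` (B `\` A)%fset|.
elim: n B => // n IH B; rewrite ltnS => nB wB.
have [BA|/fsubsetPn[x xB xA]] := boolP (B `<=` A)%fset.
  by rewrite (fsetUidPl _ _ BA) (fsetIidPr BA).
have := fsetD1K xB; move: (B `\ x)%fset (negbT (fsetD11 x B)) => N xN eB.
have wN : in_window l r N by apply: in_windowS wB; rewrite -eB fsubsetUr.
have xU : x \notin (A `|` N)%fset by rewrite !inE negb_or xA xN.
have wU : in_window l r (x |` (A `|` N))%fset.
  by move=> z; rewrite !inE => /or3P[/eqP->|/wA|/wN] //; apply: wB.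
have I1 := bz_supermodular1 bG (fsubsetUr A N) wU xU.
have cN : (#|` (N `\` A)%fset| < n)%N.
  apply: leq_trans nB; rewrite [leqRHS](cardfsD1 x) -eB !inE eqxx xA /= add1n ltnS.
  apply: fsubset_leq_card; apply/fsubsetP => z; rewrite !inE => /andP[-> zN].
  by rewrite zN orbT !andbT; apply: contraNneq xN => <-.
have := IH N cN wN.
have -> : (A `&` B = A `&` N)%fset.
  apply/fsetP => z; rewrite -eB !inE; case: eqVneq => [->|//].
  by rewrite (negPf xA).
have -> : (A `|` B = x |` (A `|` N))%fset by rewrite -eB fsetUCA.
by move: I1; rewrite eB; clear; lia.
Qed.

End Bz.

(** All points of the larger window to the left of the smaller one are joined to every set, as a
    Maya diagram contains everything far to the left. *)
Lemma bz_sub (l r l' r' : int) G : l <= l' -> l' <= r' + 1 -> r' <= r -> bz l r G ->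
  bz l' r' (fun K => G (zitv l (l' - 1) `|` K)%fset).
Proof.
move=> ll lr rr [G0 PG SM].
have U1 (i : int) K : (zitv l (l' - 1) `|` (i |` K) = i |` (zitv l (l' - 1) `|` K))%fset.
  by rewrite fsetUCA.
have NU (i : int) K : l' <= i -> i \notin K -> i \notin (zitv l (l' - 1) `|` K)%fset.
  by move=> li iK; rewrite in_fsetU mem_zitv negb_or iK andbT; move: li; clear; lia.
have wU K : in_window l' r' K -> in_window l r (zitv l (l' - 1) `|` K)%fset.
  move=> hK z; rewrite in_fsetU mem_zitv => /orP[|/hK]; move: ll lr rr; clear; lia.
split.
- move=> x hx; rewrite -(G0 x); last by move: hx ll lr rr; clear; lia.
  by congr G; apply/fsetP => z; rewrite in_fsetU !mem_zitv; move: hx ll; clear; lia.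
- move=> n i j k K li ij jk kr hK iK jK kK _; rewrite !U1.
  apply: (PG #|` (zitv l (l' - 1) `|` K)%fset|) => //.
  + exact: le_trans li.
  + exact: le_trans rr.
  + exact: wU.
  + exact: NU.
  + by apply: NU => //; move: li ij; clear; lia.
  + by apply: NU => //; move: li ij jk; clear; lia.
- move=> i j K li ij jr hK iK jK; rewrite /supermodular_at !U1.
  apply: SM => //.
  + exact: le_trans li.
  + exact: le_trans rr.
  + exact: wU.
  + exact: NU.
  + by apply: NU => //; move: li ij; clear; lia.
Qed.

Lemma bz_eq l r G H : (forall K, in_window l r K -> G K = H K) -> bz l r G -> bz l r H.
Proof.
move=> GH [G0 PG SM].
have w1 (i : int) K : l <= i -> i <= r -> in_window l r K -> in_window l r (i |` K)%fset.
  by move=> li ir; apply: in_window1; rewrite li ir.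
split.
- by move=> x hx; rewrite -GH ?G0 //; apply: in_window_zitv => //; case/andP: hx.
- move=> n i j k K li ij jk kr hK iK jK kK cK.
  have [lj jr] : l <= j /\ j <= r by move: li ij jk kr; clear; lia.
  have [lk ir] : l <= k /\ i <= r by move: li ij jk kr; clear; lia.
  by rewrite -!GH; auto; apply: PG cK.
- move=> i j K li ij jr hK iK jK.
  have [lj ir] : l <= j /\ i <= r by move: li ij jr; clear; lia.
  by rewrite /supermodular_at -!GH; auto; apply: SM.
Qed.

(** * The tableau formula *)

Lemma sorted_elts_lt (K : {fset int}) : sorted <%O (sorted_elts K).
Proof.
by rewrite lt_sorted_uniq_le sort_uniq fset_uniq sort_sorted //; exact: le_total.
Qed.

Lemma size_sorted_elts (K : {fset int}) : size (sorted_elts K) = #|` K|.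
Proof. by rewrite size_sort. Qed.

Lemma mem_sorted_elts (K : {fset int}) : sorted_elts K =i K.
Proof. by move=> x; rewrite mem_sort. Qed.

Lemma sorted_elts_eq (K : {fset int}) (s : seq int) :
  sorted <%O s -> s =i K -> sorted_elts K = s.
Proof.
move=> ss sK; apply: (lt_sorted_eq (sorted_elts_lt K) ss) => x.
by rewrite mem_sorted_elts sK.
Qed.

Lemma sorted_elts_mkseq (f : nat -> int) (u : nat) :
  (forall p, (p.+1 < u)%N -> f p < f p.+1) ->
  sorted_elts [fset x in mkseq f u]%fset = mkseq f u.
Proof.
move=> fS; apply: sorted_elts_eq; last by move=> x; rewrite !inE.
apply/(sortedP 0) => i; rewrite size_mkseq => iu.
by rewrite !nth_mkseq //; [exact: fS|exact: ltnW].
Qed.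

Lemma big_sorted_elts (T : Type) (idx : T) (op : Monoid.com_law idx) (F : int -> T)
    (K : {fset int}) :
  \big[op/idx]_(x <- K) F x = \big[op/idx]_(p < #|` K|) F (nth 0 (sorted_elts K) p).
Proof.
rewrite -(size_sorted_elts K) -(big_mkord xpredT (fun p => F (nth 0 (sorted_elts K) p))).
rewrite -(big_nth 0 xpredT F); apply: perm_big.
by rewrite perm_sym; apply/permPl; exact: perm_sort.
Qed.

(* Removing the diagonal of a tableau leaves a tableau whose diagonal entries,
   increased by 1, interlace with those of the original one. *)
Definition strip (a : ldata) : ldata := fun i j => a (i - 1) j.

(** Adding 1 to the entries keeps the second index, as c + (q + 1 - p) = (c + 1) + (q - p); only the
    first index has to be corrected by [strip]. *)
Lemma tableau_weight_strip a K R C : #|` K| = (#|` R|).+1 ->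
  tableau_weight a K C =
  (\sum_(q < #|` R|) a (C q q.+1) (C q q.+1 + 1)%R
   + tableau_weight (strip a) R (fun p q => C p q.+1 + 1)%R)%N.
Proof.
rewrite /tableau_weight => ->; move: (#|` R|) => u.
rewrite big_ord_recl big1 ?add0n => [|i]; last by rewrite ltn0.
rewrite -big_split /=; apply: eq_bigr => q _.
rewrite /bump /= add1n.
rewrite -(big_ord_widen u.+1 (fun p => a (C p q.+1) (C p q.+1 + (q.+1 - p)%:Z))) //.
rewrite -(big_ord_widen u (fun p => strip a (C p q.+1 + 1) (C p q.+1 + 1 + (q - p)%:Z))).
  rewrite big_ord_recr /= addnC subSnn; congr (_ + _)%N.
  apply: eq_bigr => p _; rewrite /strip addrK; congr (a _ _).
  by rewrite subSn ?(ltnW (ltn_ord p)) // -addrA -[(q - p).+1]add1n PoszD.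
- exact: ltnW.
- exact: leqW.
Qed.

Definition interlaces (R K : {fset int}) : Prop :=
  #|` K| = (#|` R|).+1 /\ forall p, (p < #|` R|)%N ->
    nth 0 (sorted_elts K) p < nth 0 (sorted_elts R) p <= nth 0 (sorted_elts K) p.+1.

Lemma tableau_strip a K w : (0 < #|` K|)%N -> tableau_weights a K w ->
  exists2 R, interlaces R K &
    exists2 w', tableau_weights (strip a) R w' & w = (\sum_(x <- R) strip a x x + w')%N.
Proof.
case e: #|` K| => [//|u] _ [C [Cd Cr Cc] ->].
pose f p := C p p.+1 + 1.
have fS p : (p.+1 < u)%N -> f p < f p.+1.
  move=> pu; rewrite ltrD2r; apply: lt_le_trans (_ : C p.+1 p.+1 <= _).
    by apply: Cc => //; rewrite e ltnW.
  by apply: Cr => //; rewrite e.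
pose R := [fset x in mkseq f u]%fset.
have sR : sorted_elts R = mkseq f u by exact: sorted_elts_mkseq.
have cR : #|` R| = u by rewrite -size_sorted_elts sR size_mkseq.
exists R.
  split; rewrite ?e ?cR // => p pu; rewrite sR nth_mkseq // -!Cd ?e ?ltnS //; last exact: ltnW.
  rewrite ltzD1 lezD1; apply/andP; split; first by apply: Cr; rewrite ?e.
  by apply: Cc; rewrite ?e.
exists (tableau_weight (strip a) R (fun p q => C p q.+1 + 1)).
  exists (fun p q => C p q.+1 + 1) => //; split; rewrite cR.
  - by move=> p pu; rewrite sR nth_mkseq.
  - by move=> p q pq qu; rewrite lerD2r; apply: Cr; rewrite ?e // ltnW.
  - by move=> p q pq qu; rewrite ltrD2r; apply: Cc; rewrite ?e // ltnW.
rewrite (@tableau_weight_strip _ _ R) ?e ?cR // big_sorted_elts cR sR; congr (_ + _)%N.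
by apply: eq_bigr => q _; rewrite nth_mkseq // /strip addrK.
Qed.

Lemma tableau_unstrip a R K w' : interlaces R K -> tableau_weights (strip a) R w' ->
  tableau_weights a K (\sum_(x <- R) strip a x x + w')%N.
Proof.
move=> [e RK] [C [Cd Cr Cc] ->].
pose D p q := if p == q then nth 0 (sorted_elts K) p else C p q.-1 - 1.
have DE p q : (p <= q)%N -> D p q.+1 = C p q - 1.
  by move=> pq; rewrite /D ltn_eqF.
have Dd p : D p p = nth 0 (sorted_elts K) p by rewrite /D eqxx.
exists D; last first.
  rewrite (tableau_weight_strip _ _ e) big_sorted_elts; congr (_ + _)%N.
    by apply: eq_bigr => q _; rewrite DE // Cd // subrK /strip.
  apply: eq_bigr => q _; apply: eq_bigr => p pq.
  by rewrite DE ?subrK // ltnW.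
split=> [//|p q|p [//|q]]; rewrite e !ltnS.
- rewrite leq_eqVlt => /orP[/eqP<- pu|].
    by rewrite Dd DE // Cd // lerBrDr lezD1; case/andP: (RK _ pu).
  by case: q => // q pq qu; rewrite !DE ?leqW // lerD2r; apply: Cr.
- move=> pq; rewrite (DE p q) //; move: pq; rewrite leq_eqVlt => /orP[/eqP-> qu|].
    by rewrite Dd Cd // ltrBlDr ltzD1; case/andP: (RK _ qu).
  by case: q => // q pq qu; rewrite DE // ltrD2r; apply: Cc.
Qed.

(** * Interlacing in terms of counting functions *)

Definition cnt (K : {fset int}) (x : int) : nat := #|` [fset y in K | (y <= x)%R]%fset|.

Lemma cntE (K : {fset int}) (x : int) : cnt K x = count (<= x) (sorted_elts K).
Proof.
rewrite /cnt -size_sorted_elts -size_filter; apply: perm_size.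
apply: uniq_perm; [exact: lt_sorted_uniq (sorted_elts_lt _)| |].
  by rewrite filter_uniq // lt_sorted_uniq // sorted_elts_lt.
by move=> y; rewrite mem_sorted_elts mem_filter mem_sorted_elts !inE andbC.
Qed.

Lemma nth_cnt (K : {fset int}) (p : nat) (x : int) : (p < #|` K|)%N ->
  (nth 0 (sorted_elts K) p <= x) = (p < cnt K x)%N.
Proof.
have sK : sorted <=%O (sorted_elts K) by apply: sort_sorted; exact: le_total.
rewrite cntE => pK; apply/idP/idP; last exact: nth_count_le.
rewrite leNgt; apply: contraR; rewrite -leqNgt => cp.
by apply: nth_count_gt => //; rewrite cp size_sorted_elts.
Qed.

Lemma cnt_le_card (K : {fset int}) (x : int) : (cnt K x <= #|` K|)%N.
Proof. by apply: fsubset_leq_card; apply/fsubsetP => y; rewrite !inE => /andP[]. Qed.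

Lemma cntU1 (K : {fset int}) (x y : int) : y \notin K -> cnt (y |` K)%fset x = ((y <= x)%R + cnt K x)%N.
Proof.
move=> yK; rewrite /cnt; case: leP => yx.
  have -> : [fset z in y |` K | (z <= x)%R]%fset = (y |` [fset z in K | (z <= x)%R])%fset.
    by apply/fsetP => z; rewrite !inE; case: eqVneq => // ->; rewrite yx.
  by rewrite card1U // !inE (negPf yK).
rewrite add0n; congr #|` _|; apply/fsetP => z; rewrite !inE; case: eqVneq => // ->.
by rewrite (negPf yK) leNgt yx.
Qed.

Lemma cnt_pred (K : {fset int}) (x : int) : cnt K x = (cnt K (x - 1) + (x \in K))%N.
Proof.
have [xK|xK] := boolP (x \in K); last first.
  rewrite addn0; congr #|` _|; apply/fsetP => z; rewrite !inE; case: (boolP (z \in K)) => //= zK.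
  have : z != x by exact: memPn zK.
  by clear; lia.
rewrite -(fsetD1K xK) !cntU1 ?inE ?eqxx //= lexx; have -> : (x <= x - 1) = false by clear; lia.
rewrite add0n addn1 add1n; congr _.+1; congr #|` _|; apply/fsetP => z; rewrite !inE.
by case: (boolP (z \in K)) => //= _; rewrite ?andbT; clear; lia.
Qed.

Lemma cnt_eq0 (K : {fset int}) (x : int) : {in K, forall y, x < y} -> cnt K x = 0%N.
Proof.
move=> Kx; apply/eqP; rewrite cardfs_eq0; apply/eqP/fsetP => y; rewrite !inE.
by apply/negbTE/negP => /andP[/Kx]; rewrite ltNge => /negP.
Qed.

Lemma cnt_above (K R : {fset int}) (x : int) : #|` K| = #|` R| -> (forall y : int, x < y -> (y \in K) = (y \in R)) ->
  cnt K x = cnt R x.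
Proof.
move=> KR agr; have split (A : {fset int}) :
    #|` A| = (cnt A x + #|` [fset y in A | (x < y)%R]%fset|)%N.
  rewrite -(cardfsID [fset y in A | (y <= x)%R]%fset A) /cnt.
congr addn; congr size; congr enum_fset.
    by apply/fsetP => y; rewrite !inE; case: (y \in A).
  by apply/fsetP => y; rewrite !inE ltNge; case: (y \in A); rewrite ?andbT ?andbF.
move: KR; rewrite (split K) (split R).
have -> : [fset y in K | (x < y)%R]%fset = [fset y in R | (x < y)%R]%fset.
  by apply/fsetP => y; rewrite !inE; case: (ltP x y) => [/agr->|_]; rewrite ?andbF.
by move/eqP; rewrite eqn_add2r => /eqP.
Qed.

(** Inequalities between the p-th elements become inequalities between counting functions in the
    opposite direction; the strict one accounts for [x - 1]. *)
Lemma interlacesP (R K : {fset int}) : interlaces R K <->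
  #|` K| = (#|` R|).+1 /\
  forall x, (cnt R x <= cnt K (x - 1))%N /\ (cnt K x <= (cnt R x).+1)%N.
Proof.
split=> -[e RK]; split=> //.
- move=> x; split; rewrite leqNgt; apply/negP => lt.
    have mR := leq_trans lt (cnt_le_card R x); have /andP[h1 _] := RK _ mR.
    move: lt; rewrite -nth_cnt // => /(lt_le_trans h1).
    by rewrite -lezD1 -lerBrDr nth_cnt ?ltnn // e leqW.
  have mK := leq_trans lt (cnt_le_card K x).
  have mR : (cnt R x < #|` R|)%N by rewrite -ltnS -e.
  have /andP[_ h2] := RK _ mR.
  by move: lt; rewrite -nth_cnt // => /(le_trans h2); rewrite nth_cnt // ltnn.
- move=> p pR; apply/andP; split.
    have [h _] := RK (nth 0 (sorted_elts R) p).
    rewrite -lezD1 -lerBrDr nth_cnt; last by rewrite e leqW.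
    by apply: leq_trans h; rewrite -nth_cnt.
  have [_ h] := RK (nth 0 (sorted_elts K) p.+1).
  rewrite nth_cnt // -ltnS; apply: leq_trans h; rewrite -nth_cnt // e ltnS //.
Qed.

(** In increasing order this says k0_0 <= k_0 < k0_1 <= k_1 < ...; without its smallest element, K0
    interlaces K. *)
Definition below (K0 K : {fset int}) : Prop :=
  #|` K0| = #|` K| /\ forall x, (cnt K x <= cnt K0 x <= (cnt K (x - 1)).+1)%N.

(** The generators are applied to K from the top downwards, so an element can move down several
    places, but not to or past the old position of the next smaller one. Tropically this is
    multiplication by the triangular matrix of ones. *)
Fixpoint slide (l : int) (n : nat) (F : {fset int} -> int) : {fset int} -> int :=
  if n is n'.+1 then swapmin (l + n'%:Z + 1) (l + n'%:Z) (slide l n' F) else F.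

Lemma below_refl K : below K K.
Proof. by split=> // x; rewrite leqnn /= cnt_pred -addn1 leq_add2l leq_b1. Qed.

Lemma cnt_swap (K : {fset int}) (p x : int) : p \notin K -> p + 1 \in K ->
  cnt (p |` (K `\ (p + 1)%R))%fset x = (cnt K x + (x == p))%N.
Proof.
move=> pK p1K; have := fsetD1K p1K.
move: (K `\ (p + 1)%R)%fset (negbT (fsetD11 (p + 1) K)) => N p1N eK.
have pN : p \notin N by apply: contra pK; rewrite -eK !inE => ->; rewrite orbT.
rewrite -eK !cntU1 //; clear; lia.
Qed.

Section Slide.
Variables (l : int) (F : {fset int} -> int).

Let slideP (n : nat) (K : {fset int}) : {in K, forall x, l <= x} ->
  exists K0, [/\ slide l n F K = F K0, below K0 K, {in K0, forall x, l <= x}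
    & forall x, l + n%:Z < x -> (x \in K0) = (x \in K)].
Proof.
elim: n K => [|n IH] K hK; first by exists K; split=> //; exact: below_refl.
rewrite /= /swapmin; set p := l + n%:Z.
have pn : l + n.+1%:Z = p + 1 by rewrite /p; clear; lia.
have keep : exists K0, [/\ slide l n F K = F K0, below K0 K, {in K0, forall x, l <= x}
    & forall x, l + n.+1%:Z < x -> (x \in K0) = (x \in K)].
  have [K0 [e b h a]] := IH K hK; exists K0; split=> // x xp; apply: a.
  by move: xp; clear; lia.
case: ifP => // /andP[p1K pK]; case: leP => // _.
have [z|K0 [e b h a]] := IH (p |` (K `\ (p + 1)%R))%fset.
  by rewrite !inE => /orP[/eqP->|/andP[_ /hK//]]; rewrite /p; clear; lia.
have p1K0 : p + 1 \notin K0.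
  by rewrite a ?inE ?eqxx /= ?orbF; rewrite /p; clear; lia.
exists K0; split=> //; last first.
  move=> x; rewrite pn => xp; rewrite a; last by move: xp; rewrite /p; clear; lia.
  by rewrite !inE; have [-> ->] : (x == p) = false /\ x != p + 1 by move: xp; clear; lia.
case: b => cK b; split.
  rewrite cK -[in RHS](fsetD1K p1K) !card1U ?inE ?eqxx //.
  by rewrite negb_and pK orbT.
move=> x; have := b x; rewrite !cnt_swap //.
have [->|xp] := eqVneq x p.
  have -> : (p - 1 == p) = false by clear; lia.
  by clear; lia.
(* At x = p + 1 the bound for the moved set is too weak by 1; as p + 1 is not in K0, the bound at p
   can be used instead. *)
have [x1|x1] := eqVneq (x - 1) p; last by clear; lia.
have -> : x = p + 1 by rewrite -x1 subrK.
have := b p; rewrite !cnt_swap // eqxx (_ : (p - 1 == p) = false); last by clear; lia.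
rewrite [cnt K0 (p + 1)]cnt_pred (negPf p1K0) addrK [cnt K (p + 1)]cnt_pred p1K addrK.
rewrite [cnt K p]cnt_pred (negPf pK); clear; lia.
Qed.

Let slide_le (n : nat) (K0 K : {fset int}) : {in K, forall x, l <= x} -> {in K0, forall x, l <= x} ->
  below K0 K -> (forall x, l + n%:Z < x -> (x \in K0) = (x \in K)) -> slide l n F K <= F K0.
Proof.
elim: n K => [|n IH] K hK hK0 b agr.
  have sub : (K `<=` K0)%fset.
    apply/fsubsetP => x xK; have := hK x xK; rewrite le_eqVlt => /orP[/eqP lx|lx]; last first.
      by rewrite agr // addr0.
    have [_ /(_ l)/andP[+ _]] := b; rewrite (cnt_pred K) (cnt_pred K0) !cnt_eq0 ?lx ?xK.
    - by case: (x \in K0).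
    - by move=> y /hK0; rewrite -lx; clear; lia.
    - by move=> y /hK; rewrite -lx; clear; lia.
  suff -> : K0 = K by [].
  by apply/eqP; rewrite eq_sym eqEfcard sub /=; case: b => -> _; exact: leqnn.
rewrite /= /swapmin; set p := l + n%:Z.
have pn : l + n.+1%:Z = p + 1 by rewrite /p; clear; lia.
rewrite pn in agr; have [cK bb] := b.
have e1 : cnt K0 (p + 1) = cnt K (p + 1) by exact: cnt_above.
have agr' : (p + 1 \in K0) = (p + 1 \in K) ->
    forall x, l + n%:Z < x -> (x \in K0) = (x \in K).
  move=> e x px; have [->//|xp] := eqVneq x (p + 1); apply: agr.
  by move: px xp; rewrite /p; clear; lia.
have [p1K|p1K] := boolP (p + 1 \in K); last first.
  rewrite /=; apply: IH => //; apply: agr'; rewrite (negPf p1K).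
  apply/negbTE/negP => p1K0; move: e1 (bb p); rewrite (cnt_pred K (p + 1)) (cnt_pred K0 (p + 1)) addrK.
  by rewrite p1K0 (negPf p1K); clear; lia.
have [p1K0|p1K0] := boolP (p + 1 \in K0).
  have le : slide l n F K <= F K0 by apply: IH => //; apply: agr'; rewrite p1K.
  by case: ifP => // _; rewrite ge_min le.
(* The element p + 1 has to move, and p is free for it: otherwise K would have two elements in {p, p
   + 1}, and K0 could not catch up with its count at p + 1. *)
have pK : p \notin K.
  apply/negP => pK; move: e1 (bb p); rewrite (cnt_pred K (p + 1)) (cnt_pred K0 (p + 1)) addrK.
  by rewrite (negPf p1K0) p1K [cnt K p]cnt_pred pK; clear; lia.
rewrite pK /= ge_min; apply/orP; right; apply: IH => //.
- by move=> z; rewrite !inE => /orP[/eqP->|/andP[_ /hK//]]; rewrite /p; clear; lia.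
- split.
    rewrite cK -[in LHS](fsetD1K p1K) !card1U ?inE ?eqxx //.
    by rewrite negb_and pK orbT.
  move=> x; have := bb x; rewrite !cnt_swap //.
  have [->|xp] := eqVneq x p.
    have -> : (p - 1 == p) = false by clear; lia.
    move: e1; rewrite (cnt_pred K (p + 1)) (cnt_pred K0 (p + 1)) addrK p1K (negPf p1K0); clear; lia.
  by clear; lia.
- move=> x px; rewrite !inE.
  have -> : (x == p) = false by move: px; rewrite /p; clear; lia.
  by have [->|xp] := eqVneq x (p + 1); rewrite ?(negPf p1K0) //= agr //; move: px xp; rewrite /p; clear; lia.
Qed.

Lemma slide_plucker r n N : l + n%:Z <= r -> plucker l r N F -> plucker l r N (slide l n F).
Proof.
elim: n => // n IH nr PF /=; apply: swapmin_plucker.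
- by apply: IH => //; move: nr; clear; lia.
- by rewrite eqxx orbT.
- by move: nr; clear; lia.
- by move: nr; clear; lia.
Qed.

Lemma slide_min (n : nat) (K : {fset int}) : in_window l (l + n%:Z) K ->
  (exists K0, [/\ slide l n F K = F K0, below K0 K & {in K0, forall x, l <= x}]) /\
  forall K0, below K0 K -> {in K0, forall x, l <= x} -> slide l n F K <= F K0.
Proof.
move=> hK; have lK : {in K, forall x, l <= x} by move=> x /hK /andP[].
split; first by have [K0 [e b h _]] := slideP n lK; exists K0.
move=> K0 b hK0; apply: slide_le => // x lx.
have xK : x \notin K by apply/negP => /hK; move: lx; clear; lia.
rewrite (negPf xK); apply/negbTE/negP => xK0; case: b => cK b.
have nK : cnt K (x - 1) = #|` K|.
  congr #|` _|; apply/fsetP => z; rewrite !inE; case: (boolP (z \in K)) => //= /hK.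
  by move: lx; clear; lia.
have : (cnt K0 x <= #|` K0|)%N by exact: cnt_le_card.
have /andP[+ _] := b (x - 1).
by rewrite (cnt_pred K0 x) xK0 nK cK addn1 => h1 /leq_trans/(_ h1); rewrite ltnn.
Qed.
End Slide.

(** * The Pluecker relations for the tableau formula *)

Definition tabmin (a : ldata) (K : {fset int}) : nat := ex_minn (tableau_weights_nonempty a K).

(** The cheapest tableau for [K] with prescribed remainder R costs this much, so [tabmin a K] is its
    minimum over the R interlacing [K]. *)
Definition stripmin (a : ldata) (R : {fset int}) : int :=
  (tabmin (strip a) R)%:Z + \sum_(x <- R) (strip a x x)%:Z.

Lemma tabminP a K : tableau_weights a K (tabmin a K) /\
  forall w, tableau_weights a K w -> (tabmin a K <= w)%N.
Proof.
rewrite /tabmin; case: ex_minnP => w /set_mem hw mw; split=> // w' /mem_set; exact: mw.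
Qed.

Lemma Posz_sum (I : Type) (s : seq I) (P : pred I) (f : I -> nat) :
  (\sum_(x <- s | P x) f x)%N%:Z = \sum_(x <- s | P x) (f x)%:Z.
Proof. exact: (big_morph Posz PoszD erefl). Qed.

Lemma tabmin_interlaces a K R : interlaces R K -> (tabmin a K)%:Z <= stripmin a R.
Proof.
move=> RK; rewrite /stripmin addrC -Posz_sum -PoszD lez_nat; apply: (tabminP a K).2.
by apply: tableau_unstrip RK _; exact: (tabminP _ _).1.
Qed.

Lemma tabmin_attained a K : (0 < #|` K|)%N ->
  exists2 R, interlaces R K & (tabmin a K)%:Z = stripmin a R.
Proof.
move=> K0; have [R RK [w' hw' e]] := tableau_strip K0 (tabminP a K).1; exists R => //.
apply/eqP; rewrite eq_le tabmin_interlaces //= /stripmin addrC -Posz_sum -PoszD lez_nat e leq_add2l.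
exact: (tabminP _ _).2.
Qed.

Lemma plucker_sum l r n G (f : int -> int) : plucker l r n G ->
  plucker l r n (fun K => G K + \sum_(x <- K) f x).
Proof.
move=> PG i j k K li ij jk kr hK iK jK kK cK.
have P0 := PG i j k K li ij jk kr hK iK jK kK cK.
have [ij' jk'] : i != j /\ j != k by move: ij jk; clear; lia.
have ik' : i != k by move: ij jk; clear; lia.
rewrite !big_fsetU1 ?inE ?negb_or ?ij' ?jk' ?ik' //=.
move: P0; move: (\sum_(x <- K) f x) => s; move: (f i) (f j) (f k) => fi fj fk; lia_values G.
Qed.

Lemma bounded_window (l r : int) (V : {fset int} -> int) :
  exists2 B : int, 0 <= B & forall K, in_window l r K -> `|V K| <= B.
Proof.
pose B := (\max_(K <- fpowerset (zitv l r)) `|V K|)%N.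
exists B%:Z => // K hK; rewrite -abszE lez_nat.
apply: (@bigop.leq_bigmax_seq _ _ xpredT (fun K => `|V K|%N)) => //; rewrite fpowersetE.
by apply/fsubsetP => x /hK; rewrite mem_zitv.
Qed.

Definition min_elt (K : {fset int}) : int := nth 0 (sorted_elts K) 0.

Lemma min_elt_mem (K : {fset int}) : K != fset0 -> min_elt K \in K.
Proof.
by rewrite -cardfs_gt0 => K0; rewrite -mem_sorted_elts mem_nth // size_sorted_elts.
Qed.

Lemma min_elt_le (K : {fset int}) x : x \in K -> min_elt K <= x.
Proof.
rewrite -mem_sorted_elts => /(nthP 0)[p ps <-].
have [->//|p0] := posnP p.
by apply/ltW; rewrite (lt_sorted_ltn_nth 0 (sorted_elts_lt K)) ?inE // (leq_ltn_trans _ ps).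
Qed.

Lemma min_elt_U1 (m : int) (K : {fset int}) : {in K, forall x, m < x} -> min_elt (m |` K)%fset = m.
Proof.
move=> mK; apply/eqP; rewrite eq_le min_elt_le ?inE ?eqxx //=.
have : min_elt (m |` K)%fset \in (m |` K)%fset.
  by apply: min_elt_mem; apply/fset0Pn; exists m; rewrite !inE eqxx.
by rewrite !inE => /orP[/eqP->//|/mK/ltW].
Qed.

Section Spread.
Variables (l r L B : int) (n : nat) (V : {fset int} -> int).
Hypotheses (B0 : 0 <= B) (hB : forall K, in_window l r K -> `|V K| <= B) (LB : 4 * B <= L).
Hypothesis PV : (0 < n)%N -> plucker l r n.-1 V.

(* For large [L], the minimum over the positions of the smallest element is attained at
   the smallest position: tropically this adds a generic first row to a matrix. *)
Definition spread (K : {fset int}) : int := L * min_elt K + V (K `\ min_elt K)%fset.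

Lemma spreadU1 (m : int) (N : {fset int}) : {in N, forall x, m < x} ->
  spread (m |` N)%fset = L * m + V N.
Proof.
move=> mN; rewrite /spread min_elt_U1 // fsetU1K //.
by apply/negP => /mN; rewrite ltxx.
Qed.

(** Let m be the smallest element of K. For m < i and for i < m < j the relation reduces to one for
    [V], with indices i, j, k or m, j, k. Otherwise the left side equals the second term of the
    minimum, and the first term is not smaller: it gains at least [L], against at most four values
    of [V]. Hence the constant 4. *)
Lemma spread_plucker : plucker l r n spread.
Proof.
move=> i j k K li ij jk kr hK iK jK kK cK.
have ik := lt_trans ij jk.
have L0 : 0 <= L by move: B0 LB; clear; lia.
have gap (x y : int) : x < y -> L * x + L <= L * y.
  by move=> xy; rewrite -[X in _ + X]mulr1 -mulrDr ler_wpM2l //; move: xy; clear; lia.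
have wi : l <= i <= r by move: li ij jk kr; clear; lia.
have wj : l <= j <= r by move: li ij jk kr; clear; lia.
have wk : l <= k <= r by move: li ij jk kr; clear; lia.
have w1 := in_window1.
have [hk|hk] := boolP [forall x : K, k < val x].
  have Kk : {in K, forall x, k < x} by move=> x xK; exact: (forallP hk [` xK]%fset).
  have above (y : int) : y <= k -> {in K, forall x, y < x} by move=> yk x /Kk; exact: le_lt_trans.
  have aboveU (y z : int) : y < z -> z <= k -> {in (z |` K)%fset, forall x, y < x}.
    move=> yz zk x; rewrite !inE => /orP[/eqP->//|]; apply: above; exact: ltW (lt_le_trans yz zk).
  rewrite !spreadU1; try by [apply: above => //; exact: ltW|apply: aboveU => //; exact: ltW].
  have := gap j k jk; have := hB (w1 _ _ _ _ wk hK); have := hB (w1 _ _ _ _ wj hK).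
  move: B0 LB (L * i) (L * j) (L * k) (V _) (V _) (V _); clear; lia.
have K0 : K != fset0.
  by apply: contraNneq hk => ->; apply/forallP => -[].
have hm := min_elt_le (K := K); have eK := fsetD1K (min_elt_mem K0).
move: (min_elt K) (min_elt_mem K0) hm eK => m mK hm eK.
move: eK cK; move: (K `\ m)%fset (negbT (fsetD11 m K)) => N mN eK cK.
have NK : (N `<=` K)%fset by rewrite -eK fsubsetUr.
have hN : {in N, forall x, m < x}.
  by move=> x xN; rewrite lt_neqAle eq_sym (memPn mN) //; apply/hm/(fsubsetP NK).
have NN x : x \notin K -> x \notin N by apply/contra/(fsubsetP NK).
have [iN jN kN] := And3 (NN _ iK) (NN _ jK) (NN _ kK).
have wm := hK _ mK; have wN := in_windowS NK hK.
have [mi mj mk] := And3 (memPn iK _ mK) (memPn jK _ mK) (memPn kK _ mK).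
have {hk} mk' : m < k.
  have [y yk] : exists y, y \in K /\ y <= k.
    move: hk; rewrite negb_forall => /existsP[[y yK]] /=; rewrite -leNgt; by exists y.
  by rewrite lt_neqAle mk (le_trans (hm _ yk.1) yk.2).
have cN : #|` N| = n.-1 by rewrite -cK -eK card1U.
have n0 : (0 < n)%N by rewrite -cK -eK card1U.
have PV' (x y z : int) (xN : x \notin N) (yN : y \notin N) (zN : z \notin N) lx xy yz zr :=
  @PV n0 x y z N lx xy yz zr wN xN yN zN cN.
have up (y z : int) : y < m -> y < z -> {in (z |` N)%fset, forall x, y < x}.
  by move=> ym yz x; rewrite !inE => /orP[/eqP->//|/hN]; exact: lt_trans.
have upm (z : int) : m < z -> {in (z |` N)%fset, forall x, m < x}.
  by move=> mz x; rewrite !inE => /orP[/eqP->//|/hN].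
have up2 (y z t : int) : y < m -> y < z -> y < t -> {in (z |` (t |` N))%fset, forall x, y < x}.
  by move=> ym yz yt x; rewrite !inE => /or3P[/eqP->//|/eqP->//|/hN]; exact: lt_trans.
have up2m (z t : int) : m < z -> m < t -> {in (z |` (t |` N))%fset, forall x, m < x}.
  by move=> mz mt x; rewrite !inE => /or3P[/eqP->//|/eqP->//|/hN].
rewrite -eK; case: (ltgtP m i) mi => // [mi _|im _].
  have mj' := lt_trans mi ij.
  rewrite !(fset1UC i m, fset1UC j m, fset1UC k m) !spreadU1; auto.
  have := PV' i j k iN jN kN li ij jk kr.
  by move: (L * m); lia_values V.
case: (ltgtP m j) mj => // [mj' _|jm _].
  rewrite !(fset1UC j m, fset1UC k m) !spreadU1; auto.
  have := PV' m j k mN jN kN (proj1 (andP wm)) mj' jk kr.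
  by move: (L * m) (L * i); lia_values V.
rewrite !(fset1UC k m) !spreadU1; auto.
have b1 := hB (w1 _ _ _ _ wj (w1 _ _ _ _ wm wN)); have b2 := hB (w1 _ _ _ _ wk wN).
have b3 := hB (w1 _ _ _ _ wk (w1 _ _ _ _ wm wN)); have b4 := hB (w1 _ _ _ _ wm wN).
move: (gap _ _ jm) b1 b2 b3 b4 B0 LB; rewrite ?(fset1UC k m).
by move: (L * m) (L * i) (L * j); lia_values V.
Qed.
End Spread.

Lemma below_interlaces (m : int) (R K : {fset int}) : {in R, forall x, m < x} -> m \notin R ->
  below (m |` R)%fset K -> interlaces R K.
Proof.
move=> mR mR' [cK b]; apply/interlacesP; split; first by rewrite -cK card1U.
move=> x; have := b x; rewrite !cntU1 //; case: (leP m x) => mx /=.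
  by clear; lia.
rewrite (@cnt_eq0 R x); last by move=> y /mR; exact: lt_trans.
by clear; lia.
Qed.

Lemma interlaces_below (l : int) (R K : {fset int}) : {in K, forall x, l <= x} ->
  interlaces R K -> below (l |` R)%fset K /\ {in R, forall x, l < x}.
Proof.
move=> lK /interlacesP[cK b].
have lR : {in R, forall x, l < x}.
  move=> x xR; rewrite ltNge; apply/negP => xl.
  have [+ _] := b x; rewrite (cnt_pred R) xR (@cnt_eq0 K); first by clear; lia.
  by move=> y /lK; move: xl; clear; lia.
have lR' : l \notin R by apply/negP => /lR; rewrite ltxx.
split=> //; split; first by rewrite card1U.
move=> x; have := b x; rewrite !cntU1 //; case: (leP l x) => lx /=; first by clear; lia.
rewrite (@cnt_eq0 K x); last by move=> y /lK; exact: lt_le_trans.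
by clear; lia.
Qed.

(** A set below K consists of a set R interlacing K and a smaller element m >= l. The choice m = l
    is possible for every R and costs least, so the minimum over R remains, which is the recursion
    for [tabmin]. *)
Lemma slide_spread (l r L : int) (a : ldata) (K : {fset int}) : 0 <= L -> K != fset0 ->
  in_window l r K -> slide l `|r - l|%N (spread L (stripmin a)) K = L * l + (tabmin a K)%:Z.
Proof.
move=> L0 K0 hK; have /fset0Pn[z /hK hz] := K0.
have e : l + `|r - l|%N%:Z = r by move: hz; clear; lia.
have lK : {in K, forall x, l <= x} by move=> x /hK /andP[].
have := @slide_min l (spread L (stripmin a)) `|r - l|%N K; rewrite e => /(_ hK)[[K1 [e1 b1 l1]] le].
apply/eqP; rewrite eq_le; apply/andP; split.
  have [|R RK ->] := @tabmin_attained a K; first by rewrite cardfs_gt0.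
  have [b lR] := interlaces_below lK RK; rewrite -spreadU1 //; apply: le b _.
  by move=> x; rewrite !inE => /orP[/eqP->|/lR/ltW].
have K10 : K1 != fset0 by rewrite -cardfs_gt0 b1.1 cardfs_gt0.
rewrite e1; have eK := fsetD1K (min_elt_mem K10); have hm := min_elt_le (K := K1).
move: b1 eK (l1 _ (min_elt_mem K10)) hm; move: (min_elt K1) => m.
move: (K1 `\ m)%fset (negbT (fsetD11 m K1)) => R mR b1 eK lm hm.
have mR' : {in R, forall x, m < x}.
  move=> x xR; rewrite lt_neqAle eq_sym (memPn mR) //; apply: hm.
  by rewrite -eK !inE xR orbT.
rewrite -eK spreadU1 //; apply: lerD; first by rewrite ler_wpM2l.
by apply: tabmin_interlaces; apply: below_interlaces mR' mR _; rewrite eK.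
Qed.

Lemma tabmin_plucker (a : ldata) (l r : int) (n : nat) :
  plucker l r n (fun K => (tabmin a K)%:Z).
Proof.
elim/ltn_ind: n a => n IH a i j k K li ij jk kr hK iK jK kK cK.
have [B B0 hB] := bounded_window l r (stripmin a).
have PV : (0 < n)%N -> plucker l r n.-1 (stripmin a).
  by case: n IH {cK} => // n IH _; apply: plucker_sum; exact: IH.
have B4 : 0 <= 4 * B by move: B0; clear; lia.
have := @slide_plucker l (spread (4 * B) (stripmin a)) r `|r - l|%N n.
have -> : l + `|r - l|%N%:Z = r by move: li ij jk kr; clear; lia.
move=> /(_ (lexx _) (spread_plucker B0 hB (lexx _) PV)) P.
have {P} := P i j k K li ij jk kr hK iK jK kK cK.
have U1 (x : int) (J : {fset int}) : (x |` J)%fset != fset0.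
  by apply/fset0Pn; exists x; rewrite !inE eqxx.
have w1 (x : int) (J : {fset int}) : l <= x <= r -> in_window l r J -> in_window l r (x |` J)%fset.
  exact: in_window1.
have wi : l <= i <= r by move: li ij jk kr; clear; lia.
have wj : l <= j <= r by move: li ij jk kr; clear; lia.
have wk : l <= k <= r by move: li ij jk kr; clear; lia.
rewrite !slide_spread //; try by apply: w1.
- by move: (4 * B * l) (tabmin _ _) (tabmin _ _) (tabmin _ _) (tabmin _ _) (tabmin _ _) (tabmin _ _); clear; lia.
- exact: (w1 _ _ wj (w1 _ _ wk hK)).
- exact: (w1 _ _ wi (w1 _ _ wj hK)).
- exact: (w1 _ _ wi (w1 _ _ wk hK)).
Qed.

(** * Lusztig data *)

Lemma M_of_plucker (I : fitv) (a : ldata) l r : plucker_all l r (M_of I a).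
Proof.
move=> n; have := plucker_sum (fun j => - \sum_(i <- tilde_seq I | i < j) (a i j)%:Z) (@tabmin_plucker a l r n).
by apply: eq_plucker => K; rewrite /M_of addrC sumrN.
Qed.

Definition colsum (l : int) (a : ldata) (s j : int) : int := \sum_(i <- zitv l (s - 1)) (a i j)%:Z.

Lemma sorted_elts_zitv (s t : int) :
  sorted_elts (zitv s t) = mkseq (fun p => s + p%:Z) (absz (Num.max 0 (t - s + 1))%R).
Proof.
apply: sorted_elts_eq.
  apply/(sortedP 0) => i; rewrite size_mkseq => iu.
  by rewrite !nth_mkseq //; [clear; lia|exact: ltnW].
move=> x; rewrite mem_zitv; apply/mapP/idP => [[p]|hx].
  by rewrite mem_iota; clear; lia.
by exists `|x - s|%N; rewrite ?mem_iota; move: hx; clear; lia.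
Qed.

Lemma nth_zitv (s t : int) p : (p < #|` zitv s t|)%N ->
  nth 0 (sorted_elts (zitv s t)) p = s + p%:Z.
Proof.
by rewrite -size_sorted_elts sorted_elts_zitv size_mkseq => pu; rewrite nth_mkseq.
Qed.

(** An interval has only one tableau: going right from the diagonal gives the lower bound s + p,
    going down to the diagonal the upper one. *)
Lemma tableau_zitv (s t : int) C : is_tableau (zitv s t) C ->
  forall p q, (p <= q)%N -> (q < #|` zitv s t|)%N -> C p q = s + p%:Z.
Proof.
case=> Cd Cr Cc.
have Cd' k : (k < #|` zitv s t|)%N -> C k k = s + k%:Z by move=> ku; rewrite Cd // nth_zitv.
have lower d p : (p + d < #|` zitv s t|)%N -> s + p%:Z <= C p (p + d)%N.
  elim: d => [|d IH] pd; first by rewrite addn0 Cd' // -(addn0 p).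
  rewrite addnS; rewrite addnS in pd; apply: le_trans (IH (ltnW pd)) _.
  by apply: Cr => //; exact: leq_addr.
have upper d p : (p + d < #|` zitv s t|)%N -> C p (p + d)%N <= s + p%:Z.
  elim: d p => [|d IH] p pd; first by rewrite addn0 Cd' // -(addn0 p).
  have := IH p.+1; rewrite addSnnS => /(_ pd) h.
  have := Cc p (p + d.+1)%N; rewrite addnS ltnS leq_addr -addnS => /(_ isT pd) h'.
  by move: h h'; clear; lia.
move=> p q pq qu; apply/eqP; rewrite eq_le -(subnKC pq).
by rewrite lower ?upper // subnKC.
Qed.

Lemma colsum_recr l a (s j : int) : l <= s -> colsum l a (s + 1) j = colsum l a s j + (a s j)%:Z.
Proof.
move=> ls; rewrite /colsum addrK zitv_recr // big_fsetU1 ?mem_zitv /=; first by rewrite addrC.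
by move: ls; clear; lia.
Qed.

Lemma colsum_addn l a (s j : int) (q : nat) : l <= s ->
  colsum l a (s + q%:Z) j = colsum l a s j + \sum_(p < q) (a (s + p%:Z) j)%:Z.
Proof.
move=> ls; elim: q => [|q IH]; first by rewrite big_ord0 !addr0.
rewrite big_ord_recr /= addrA -IH -colsum_recr; last by move: ls; clear; lia.
by congr colsum; clear; lia.
Qed.

Section OfLusztig.
Variables (I : fitv) (a : ldata).
Let l := lo I + 1.
Let r := lo I + (len I)%:Z + 1.

Lemma mem_tilde_seq x : (x \in tilde_seq I) = (l <= x <= r).
Proof.
apply/mapP/idP => [[p]|hx]; first by rewrite mem_iota /l /r; clear; lia.
by exists `|x - l|%N; rewrite ?mem_iota; move: hx; rewrite /l /r; clear; lia.
Qed.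

Lemma tilde_seq_uniq : uniq (tilde_seq I).
Proof. by rewrite map_inj_uniq ?iota_uniq // => x y; rewrite /=; clear; lia. Qed.

Lemma sum_tilde_seq (j : int) : j <= r + 1 ->
  \sum_(i <- tilde_seq I | i < j) (a i j)%:Z = colsum l a j j.
Proof.
move=> jr; rewrite -big_filter /colsum; apply: perm_big; apply: uniq_perm.
- by rewrite filter_uniq // tilde_seq_uniq.
- exact: fset_uniq.
- move=> x; rewrite mem_filter mem_tilde_seq (mem_zitv l (j - 1) x); move: jr; clear; lia.
Qed.

(** The weight of the only tableau cancels the terms with i >= s of the first sum in [M_of]. *)
Lemma M_of_zitv (s t : int) : l <= s -> t <= r ->
  M_of I a (zitv s t) = - \sum_(j <- zitv s t) colsum l a s j.
Proof.
move=> ls tr; have [[C CT e] _] := tabminP a (zitv s t).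
rewrite /M_of -/(tabmin a (zitv s t)) {}e /tableau_weight Posz_sum.
rewrite !big_sorted_elts -!sumrN -big_split /=; apply: eq_bigr => q _.
have hj : nth 0 (sorted_elts (zitv s t)) q \in zitv s t.
  by rewrite -mem_sorted_elts mem_nth // size_sorted_elts.
rewrite sum_tilde_seq; last first.
  move: hj; rewrite mem_zitv => /andP[_ jt]; apply: le_trans (le_trans jt tr) _.
  by rewrite lerDl.
rewrite {hj} !nth_zitv // colsum_addn // Posz_sum.
rewrite -(big_ord_widen _ (fun p => (a (C p q) (C p q + (q - p)%N%:Z))%:Z)); last exact: ltnW.
rewrite opprD -addrA -[RHS]addr0; congr (_ + _); rewrite addrC; apply/eqP.
rewrite subr_eq0; apply/eqP; apply: eq_bigr => p _; congr Posz.
rewrite (tableau_zitv CT) //; last exact: ltnW.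
by congr (a _ _); have := ltn_ord p; clear; lia.
Qed.
End OfLusztig.

Section Lusztig.
Variable I : fitv.
Notation l := (lo I + 1).
Notation r := (lo I + (len I)%:Z + 1).

Lemma window_lt : l < r. Proof. have := len_gt0 I; clear; lia. Qed.

Lemma tilde_zitv : tilde I = zitv l r.
Proof. by apply/fsetP => x; rewrite mem_zitv /tilde in_fset; exact: mem_tilde_seq. Qed.

Lemma colsum_prefix a j : colsum l a l j = 0.
Proof.
rewrite /colsum (_ : zitv l (l - 1) = fset0) ?big_nil //.
by apply/fsetP => x; rewrite mem_zitv inE; clear; lia.
Qed.

Lemma zitv0 (s : int) : zitv s (s - 1) = fset0.
Proof. by apply/fsetP => x; rewrite mem_zitv inE; clear; lia. Qed.

Lemma M_of0 a : M_of I a fset0 = 0.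
Proof.
rewrite -(zitv0 l) M_of_zitv ?lexx //; first by rewrite zitv0 big_nil oppr0.
by have := window_lt; clear; lia.
Qed.

Lemma M_of_prefix a (x : int) : l - 1 <= x <= r -> M_of I a (zitv l x) = 0.
Proof.
move=> /andP[_ xr]; rewrite M_of_zitv ?lexx // big1 ?oppr0 // => j _.
exact: colsum_prefix.
Qed.

Lemma M_of_zitv_recr a (s t : int) : l <= s -> s <= t -> t <= r ->
  M_of I a (zitv s t) = M_of I a (zitv s (t - 1)) - colsum l a s t.
Proof.
move=> ls st tr; rewrite !M_of_zitv //; last by move: tr; clear; lia.
rewrite (zitv_recr st) big_fsetU1 ?mem_zitv /= ?opprD 1?addrC //.
by move: st; clear; lia.
Qed.

(** By [plucker_supermodular] only intervals matter, and there the defect of supermodularity at s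
    and t is the entry a_{s,t} >= 0. *)
Lemma M_of_bz a : bz l r (M_of I a).
Proof.
have PM n := @M_of_plucker I a l r n.
split=> //; first exact: M_of_prefix.
apply: plucker_supermodular PM _ => s t ls st tr.
have e1 : (s |` (t |` zitv (s + 1) (t - 1)))%fset = zitv s t.
  by rewrite -zitv_recr -?zitv_recl //; move: st; clear; lia.
have e2 : (s |` zitv (s + 1) (t - 1))%fset = zitv s (t - 1).
  by rewrite -zitv_recl //; move: st; clear; lia.
have e3 : (t |` zitv (s + 1) (t - 1))%fset = zitv (s + 1) t.
  by rewrite -zitv_recr //; move: st; clear; lia.
rewrite /supermodular_at e1 e2 e3.
rewrite (M_of_zitv_recr _ ls (ltW st) tr) (@M_of_zitv_recr _ (s + 1) t) //; first last.
- by move: st; clear; lia.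
- by move: ls; clear; lia.
have a0 : 0 <= (a s t)%:Z by [].
rewrite colsum_recr //; move: a0; move: (Posz (a s t)) (colsum l a s t) => x y.
by lia_values (M_of I a).
Qed.

(** The inverse of [M_of]: a_{s,t} is the defect of supermodularity at s and t over the interval
    between them. It is nonnegative for a [bz] function, so [absz] does not change it. *)
Definition lusztig_coord (G : {fset int} -> int) : ldata := fun s t =>
  if [&& l <= s, s < t & t <= r]
  then absz (G (zitv s t) + G (zitv (s + 1) (t - 1)) - G (zitv (s + 1) t) - G (zitv s (t - 1)))%R
  else 0%N.

Lemma lusztig_coordE G (s t : int) : bz l r G -> l <= s -> s < t -> t <= r ->
  (lusztig_coord G s t)%:Z =
  G (zitv s t) + G (zitv (s + 1) (t - 1)) - G (zitv (s + 1) t) - G (zitv s (t - 1)).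
Proof.
move=> [_ _ SM] ls st tr; rewrite /lusztig_coord ls st tr /= gez0_abs //.
have := SM s t (zitv (s + 1) (t - 1)) ls st tr.
have e1 : (s |` (t |` zitv (s + 1) (t - 1)))%fset = zitv s t.
  by rewrite -zitv_recr -?zitv_recl //; move: st; clear; lia.
have e2 : (s |` zitv (s + 1) (t - 1))%fset = zitv s (t - 1).
  by rewrite -zitv_recl //; move: st; clear; lia.
have e3 : (t |` zitv (s + 1) (t - 1))%fset = zitv (s + 1) t.
  by rewrite -zitv_recr //; move: st; clear; lia.
rewrite /supermodular_at e1 e2 e3 !mem_zitv => H.
have {}H := H ltac:(apply: in_window_zitv; move: ls tr; clear; lia) ltac:(clear; lia) ltac:(clear; lia).
by move: H; lia_values G.
Qed.

Lemma M_of_lusztig_coord G : bz l r G ->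
  forall K, in_window l r K -> M_of I (lusztig_coord G) K = G K.
Proof.
move=> bG; have [G0 PG _] := bG.
apply: plucker_determined => //; first by case: (M_of_bz (lusztig_coord G)).
have G00 (s : int) : G (zitv s (s - 1)) = 0.
  by rewrite zitv0 -(zitv0 l) G0 //; have := window_lt; clear; lia.
(* The entries are second differences of G on intervals, so a column sum telescopes to a first
   difference. *)
have col (n : nat) (j : int) : l + n%:Z <= j -> j <= r ->
    colsum l (lusztig_coord G) (l + n%:Z) j = G (zitv (l + n%:Z) (j - 1)) - G (zitv (l + n%:Z) j).
  elim: n => [|n IH] nj jr.
    by rewrite addr0 colsum_prefix !G0 //; move: nj jr; clear; lia.
  rewrite (_ : l + n.+1%:Z = l + n%:Z + 1); last by clear; lia.
  rewrite colsum_recr ?IH //; [|by move: nj; clear; lia|by clear; lia].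
  by rewrite lusztig_coordE //; [lia_values G|clear; lia|move: nj; clear; lia].
move=> s t ls tr; have [st|ts] := leP s t; last first.
  have -> : zitv s t = fset0 by apply/fsetP => x; rewrite mem_zitv inE; move: ts; clear; lia.
  by rewrite M_of0 -(zitv0 s) G00.
have -> : t = s + `|t - s|%N%:Z by move: st; clear; lia.
have : s + `|t - s|%N%:Z <= r by move: st tr; clear; lia.
elim: `|t - s|%N => [|n IH] nr.
  rewrite addr0 M_of_zitv_recr ?lexx //; last by move: nr; clear; lia.
  rewrite zitv0 M_of0 add0r.
  have := col `|s - l|%N s; rewrite (_ : l + `|s - l|%N%:Z = s); last by move: ls; clear; lia.
  by rewrite G00 => ->; rewrite ?sub0r ?opprK //; move: nr; clear; lia.
rewrite M_of_zitv_recr //; last by clear; lia.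
have e : s + n.+1%:Z - 1 = s + n%:Z by clear; lia.
rewrite e IH; last by move: nr; clear; lia.
have := col `|s - l|%N (s + n.+1%:Z); rewrite (_ : l + `|s - l|%N%:Z = s); last by move: ls; clear; lia.
rewrite e => ->; [lia_values G|clear; lia|exact: nr].
Qed.
End Lusztig.

(** * The operators on Lusztig data *)

Section LusztigOperators.
Variables (I : fitv) (i : int).
Notation l := (lo I + 1).
Notation r := (lo I + (len I)%:Z + 1).
Hypotheses (li : l <= i) (ir : i < r).

Lemma mem_itv_seq (x : int) : (x \in itv_seq I) = (l <= x < r).
Proof.
apply/mapP/idP => [[p]|hx]; first by rewrite mem_iota; clear; lia.
by exists `|x - l|%N; rewrite ?mem_iota; move: hx; clear; lia.
Qed.

Lemma itv_seq_sorted : sorted <%O (itv_seq I).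
Proof.
rewrite /itv_seq sorted_map.
apply: sub_sorted (iota_ltn_sorted 0 (len I)) => x y; rewrite /= => xy.
by rewrite /relpre /= ltrD2l ltz_nat.
Qed.

Definition A_col (a : ldata) (k : int) : int := colsum l a (k + 1) (i + 1) - colsum l a k i.

Lemma A_colS a k : l <= k -> A_col a (k + 1) = A_col a k + (a (k + 1) (i + 1))%:Z - (a k i)%:Z.
Proof.
move=> lk; rewrite /A_col (@colsum_recr _ a k i lk) (@colsum_recr _ a (k + 1)) ?addrA; last by move: lk; clear; lia.
by move: (colsum _ _ _ _) (colsum _ _ _ _) => *; clear; lia.
Qed.

Lemma A_ofE a k : is_lusztig I a -> l <= k < r -> A_of I a i k = A_col a k.
Proof.
move=> La /andP[lk kr].
rewrite /A_of -big_filter (_ : \sum_(s <- _) _ =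
    \sum_(s <- zitv l k) ((a s (i + 1))%:Z - (a (s - 1) i)%:Z)); last first.
  apply: perm_big; apply: uniq_perm.
  - by rewrite filter_uniq // lt_sorted_uniq // itv_seq_sorted.
  - exact: fset_uniq.
  - move=> x; rewrite mem_filter mem_itv_seq (mem_zitv l k x); move: kr; clear; lia.
have -> : k = l + `|k - l|%N%:Z by move: lk; clear; lia.
elim: `|k - l|%N => [|n IH].
  rewrite addr0 zitv_recr ?lexx // big_fsetU1 /= ?mem_zitv; last by clear; lia.
  rewrite zitv0 big_nil addr0 /A_col colsum_recr ?lexx // !colsum_prefix add0r.
  (* This is the convention a_{n,i} = 0: l - 1 = n lies outside I~. *)
  rewrite (La (l - 1) i) ?subr0 ?addr0 //.
  by rewrite tilde_zitv mem_zitv (_ : (l <= l - 1) = false) //; clear; lia.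
rewrite (_ : l + n.+1%:Z = l + n%:Z + 1); last by clear; lia.
rewrite zitv_recr ?big_fsetU1 /= ?mem_zitv; [|clear; lia|clear; lia].
rewrite addrK IH A_colS; last by clear; lia.
by rewrite [LHS]addrC addrA.
Qed.

Lemma eps_l_ge a k : is_lusztig I a -> l <= k <= i -> A_col a k <= eps_l I i a.
Proof.
move=> La /andP[lk ki]; rewrite -A_ofE //; last by rewrite lk (le_lt_trans ki).
by rewrite /eps_l; apply: le_bigmax_seq; rewrite // mem_itv_seq lk (le_lt_trans ki).
Qed.

Lemma mem_argmaxs a k : is_lusztig I a ->
  (k \in argmaxs I i a) = (l <= k <= i) && (A_col a k == eps_l I i a).
Proof.
move=> La; rewrite mem_filter mem_itv_seq.
have [/andP[lk ki]|nk] := boolP (l <= k <= i); last first.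
  by apply/negbTE; move: nk; apply: contraNN; clear; lia.
have kr := le_lt_trans ki ir.
by rewrite ki lk kr A_ofE ?lk ?kr ?andbT.
Qed.

Lemma argmaxs_neq0 a : is_lusztig I a -> argmaxs I i a != [::].
Proof.
move=> La.
have [k hk e] : exists2 k, l <= k <= i & A_of I a i k = eps_l I i a.
  rewrite /eps_l big_seq_cond; elim/big_ind: _ => [|x y [kx hx <-] [ky hy <-]|k].
  - by exists l; rewrite ?lexx ?li.
  - by case: (leP (A_of I a i kx) (A_of I a i ky)); [exists ky|exists kx].
  - by rewrite mem_itv_seq => /andP[/andP[lk _] ki]; exists k; rewrite ?lk.
have : k \in argmaxs I i a.
  rewrite mem_argmaxs // hk -e A_ofE ?eqxx //; case/andP: hk => -> ki; exact: le_lt_trans ir.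
by case: (argmaxs I i a).
Qed.

Lemma argmaxs_sorted a : sorted <%O (argmaxs I i a).
Proof. by apply: sorted_filter itv_seq_sorted; exact: lt_trans. Qed.

Lemma k_eP a : is_lusztig I a -> [/\ l <= k_e I i a <= i, A_col a (k_e I i a) = eps_l I i a
  & forall k, l <= k < k_e I i a -> A_col a k < eps_l I i a].
Proof.
move=> La; have ke : k_e I i a \in argmaxs I i a.
  by rewrite /k_e; case: (argmaxs I i a) (argmaxs_neq0 La) => //= x s _; rewrite inE eqxx.
move: (ke); rewrite mem_argmaxs // => /andP[hk /eqP e]; split=> // k /andP[lk kk].
have ki : k <= i by case/andP: hk => _; apply: le_trans; exact: ltW.
rewrite lt_neqAle eps_l_ge ?lk // andbT; apply/negP => ek.
have : k \in argmaxs I i a by rewrite mem_argmaxs // lk ki.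
move: kk (argmaxs_sorted a); rewrite /k_e; case: (argmaxs I i a) => //= x s kx.
rewrite inE => xs /orP[/eqP kx'|ks]; first by rewrite kx' ltxx in kx.
have := allP (order_path_min lt_trans xs) _ ks.
by move=> /(lt_trans kx); rewrite ltxx.
Qed.

Lemma k_fP a : is_lusztig I a -> [/\ l <= k_f I i a <= i, A_col a (k_f I i a) = eps_l I i a
  & forall k, k_f I i a < k <= i -> A_col a k < eps_l I i a].
Proof.
move=> La; have ke : k_f I i a \in argmaxs I i a.
  rewrite /k_f; case: (argmaxs I i a) (argmaxs_neq0 La) => // x s _.
  by rewrite [last 0 _]/=; exact: mem_last.
move: (ke); rewrite mem_argmaxs // => /andP[hk /eqP e]; split=> // k /andP[kk ki].
have lk : l <= k by case/andP: hk => + _; move/le_trans; apply; exact: ltW.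
rewrite lt_neqAle eps_l_ge ?lk // andbT; apply/negP => ek.
have : k \in argmaxs I i a by rewrite mem_argmaxs // lk ki.
move: kk (argmaxs_sorted a); rewrite /k_f.
case: (lastP (argmaxs I i a)) => // s x; rewrite last_rcons => kx.
rewrite -cats1 => xs; rewrite mem_cat inE => /orP[ks|/eqP kx']; last by rewrite kx' ltxx in kx.
move: xs; rewrite cats1 (sorted_pairwise lt_trans) pairwise_rcons => /andP[/allP/(_ _ ks) kx' _].
by have := lt_trans kx kx'; rewrite ltxx.
Qed.

Lemma k_f_uniq a k : is_lusztig I a -> l <= k <= i ->
  (forall k', l <= k' <= i -> A_col a k' <= A_col a k) ->
  (forall k', k < k' <= i -> A_col a k' < A_col a k) -> k_f I i a = k /\ eps_l I i a = A_col a k.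
Proof.
move=> La hk mx mx'; have [hf ef _] := k_fP La.
have ek : eps_l I i a = A_col a k by apply/eqP; rewrite eq_le eps_l_ge // -ef mx.
split=> //; case: (ltgtP (k_f I i a) k) => // lt.
  have [_ _ /(_ k)] := k_fP La; rewrite lt; case/andP: hk => _ -> /(_ isT).
  by rewrite ek ltxx.
by have := mx' (k_f I i a); rewrite lt ef ek ltxx; case/andP: hf => _ -> /(_ isT).
Qed.

Lemma sum_update (f g : int -> int) (k c : int) (K : {fset int}) :
  (forall x, x != k -> f x = g x) -> f k = g k + c ->
  \sum_(x <- K) f x = \sum_(x <- K) g x + if k \in K then c else 0.
Proof.
move=> fg fk; have [kK|kK] := boolP (k \in K); last first.
  rewrite addr0; apply: eq_big_seq => x xK; apply: fg; exact: memPn xK.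
rewrite -(fsetD1K kK) !big_fsetU1 ?inE ?eqxx //= fk -!addrA [c + _]addrC; congr (_ + (_ + _)).
by apply: eq_big_seq => x; rewrite !inE => /andP[xk _]; apply: fg.
Qed.

Definition indic (b : bool) : int := if b then 1 else 0.

(** After the last maximum k the sums drop strictly, and A_{k+1} - A_k = a_{k+1,i+1} - a_{k,i}.
    Hence the subtraction in [f_l] is not truncated; [e_l_pos] does the same for [e_l]. *)
Lemma f_l_pos a : is_lusztig I a -> k_f I i a < i -> (0 < a (k_f I i a) i)%N.
Proof.
move=> La; have [/andP[lk ki] ek mx] := k_fP La => ki'.
have := mx (k_f I i a + 1); rewrite A_colS // ek.
have -> : k_f I i a < k_f I i a + 1 <= i by move: ki'; clear; lia.
by move=> /(_ isT); clear; lia.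
Qed.

Lemma e_l_pos a : is_lusztig I a -> eps_l I i a != 0 -> (0 < a (k_e I i a) (i + 1)%R)%N.
Proof.
move=> La e0; have [/andP[lk ki] ek mx] := k_eP La.
have [kl|kl] := eqVneq (k_e I i a) l.
  move: ek e0; rewrite kl /A_col colsum_recr ?lexx // !colsum_prefix add0r subr0 => <-.
  by clear; lia.
have lk1 : l <= k_e I i a - 1 by move: lk kl; clear; lia.
have := A_colS a lk1; rewrite subrK ek; have := mx (k_e I i a - 1).
have -> : l <= k_e I i a - 1 < k_e I i a by move: lk1; clear; lia.
by move=> /(_ isT); clear; lia.
Qed.

Lemma colsum_f_l a s j : is_lusztig I a ->
  colsum l (f_l I i a) s j = colsum l a s j
    + indic ((k_f I i a < s) && (j == i + 1)) - indic [&& k_f I i a < s, k_f I i a < i & j == i].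
Proof.
move=> La; have fp := f_l_pos La; have [/andP[lk ki] _ _] := k_fP La.
rewrite /f_l; move: (k_f I i a) fp lk ki => k fp lk ki.
have ii : (i == i + 1) = false by clear; lia.
rewrite /colsum; have [->|ji] := eqVneq j i.
  rewrite ii andbF addr0.
  rewrite (@sum_update _ (fun x => (a x i)%:Z) k (- indic (k < i))).
  - rewrite mem_zitv /indic andbT; have -> : (l <= k <= s - 1) = (k < s) by move: lk; clear; lia.
    by case: (k < s) => //; rewrite oppr0.
  - by move=> x /negPf->.
  - rewrite !eqxx ?ii ?andbF /= /indic; case: (ltP k i) => [/fp|_]; last by rewrite oppr0 addr0.
    by clear; lia.
have [->|ji1] := eqVneq j (i + 1).
  rewrite (@sum_update _ (fun x => (a x (i + 1))%:Z) k 1).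
  - rewrite mem_zitv /indic andbT !andbF subr0.
    by have -> : (l <= k <= s - 1) = (k < s) by move: lk; clear; lia.
  - by move=> x /negPf->.
  - by rewrite eqxx /= PoszD.
rewrite !andbF /indic subr0 addr0; apply: eq_bigr => x _.
by rewrite !andbF.
Qed.

(** The first maximum k of the sums for a is the last one for b = e_i a, so f_i undoes the change at
    the same place. *)
Lemma e_lP a : is_lusztig I a -> eps_l I i a != 0 ->
  exists2 b, e_l I i a = Some b & is_lusztig I b /\ f_l I i b = a.
Proof.
move=> La e0; have ep := e_l_pos La e0.
rewrite /e_l (negPf e0); have [hk ek mx] := k_eP La.
have ege := fun k => @eps_l_ge a k La.
move: (k_e I i a) (eps_l I i a) ep hk ek mx ege {e0} => k e ep /andP[lk ki] ek mx ege.
pose b : ldata := fun s t =>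
  if [&& s == k, t == i & k < i] then (a s t + 1)%N
  else if (s == k) && (t == i + 1) then (a s t - 1)%N else a s t.
exists b => //.
have ii : (i == i + 1) = false by clear; lia.
have ii' : (i + 1 == i) = false by clear; lia.
have Lb : is_lusztig I b.
  move=> s t; rewrite /b !tilde_zitv !mem_zitv => nst.
  case: ifP => [/and3P[/eqP sk /eqP ti ki']|_].
    by move: nst; rewrite sk ti; move: lk ki' ir; clear; lia.
  case: ifP => [/andP[/eqP sk /eqP ti]|_].
    by move: nst; rewrite sk ti; move: lk ki ir; clear; lia.
  by apply: La; rewrite !tilde_zitv !mem_zitv.
have bcol s j : colsum l b s j = colsum l a s j
    - indic ((k < s) && (j == i + 1)) + indic [&& k < s, k < i & j == i].
  rewrite /colsum /b; have [->|ji] := eqVneq j i.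
    rewrite ii andbF subr0.
    rewrite (@sum_update _ (fun x => (a x i)%:Z) k (indic (k < i))).
    - rewrite mem_zitv /indic andbT; have -> : (l <= k <= s - 1) = (k < s) by move: lk; clear; lia.
      by case: (k < s).
    - by move=> x /negPf->.
    - by rewrite !eqxx ?ii ?andbF /= /indic; case: (ltP k i) => _; rewrite ?addr0 ?PoszD.
  have [->|ji1] := eqVneq j (i + 1).
    rewrite (@sum_update _ (fun x => (a x (i + 1))%:Z) k (- 1)).
    - rewrite mem_zitv /indic andbT !andbF addr0.
      have -> : (l <= k <= s - 1) = (k < s) by move: lk; clear; lia.
      by case: (k < s); rewrite ?oppr0.
    - by move=> x /negPf->.
    - by rewrite eqxx /= -subzn.
  rewrite !andbF /indic subr0 addr0; apply: eq_bigr => x _.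
  by rewrite !andbF.
(* The sums drop by 1 at k and by 2 after it; before k they were already smaller than the maximum.
   So the new maximum is one less, and k is the last place where it is attained. *)
have bA k' : A_col b k' = A_col a k' - indic (k <= k') - indic ((k < k') && (k < i)).
  rewrite /A_col !bcol !eqxx ii ii' !andbF !andbT /indic.
  have -> : (k < k' + 1) = (k <= k') by clear; lia.
  by case: (k <= k'); case: (k < k'); case: (k < i); move: (colsum _ _ _ _) (colsum _ _ _ _) => *; clear; lia.
have [kf _] : k_f I i b = k /\ eps_l I i b = A_col b k.
  apply: k_f_uniq => //; first by rewrite lk.
    move=> k' /andP[lk' ki']; rewrite !bA ek lexx ltxx /indic /=.
    have := mx k'; have := ege k'; rewrite lk' ki' /= => /(_ isT).
    case: (ltgtP k k') => [kk'|kk'|->] /=; rewrite ?ek.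
    - by rewrite (lt_le_trans kk' ki'); clear; lia.
    - by move=> _ /(_ isT); clear; lia.
    - by clear; lia.
  move=> k' /andP[kk' ki']; rewrite !bA ek lexx ltxx /indic /= kk' (ltW kk') (lt_le_trans kk' ki') /=.
  have lk' : l <= k' by exact: le_trans (ltW kk').
  by have := ege k'; rewrite lk' ki' => /(_ isT); clear; lia.
split=> //; rewrite /f_l kf; apply: funext => s; apply: funext => t; rewrite /b.
have [->|sk] := eqVneq s k; last by [].
have [->|ti] := eqVneq t i; last first.
  have [->|ti1] := eqVneq t (i + 1) => //=.
  by rewrite subnK.
rewrite ii /=; case: (ltP k i) => //= _.
by rewrite addnK.
Qed.

End LusztigOperators.

(** * Comparison of f_i with the Anderson-Mirkovic formula *)

Section FopLusztig.
Variables (I : fitv) (i : int).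
Notation l := (lo I + 1).
Notation r := (lo I + (len I)%:Z + 1).
Hypotheses (li : l <= i) (ir : i < r).
Variable a : ldata.
Hypothesis La : is_lusztig I a.

Let G := M_of I a.
(** The value at [s, i] with i moved to i + 1. By [X_i] and [X_rec], G[s, i] - X s is the maximum of
    the A_k over s <= k <= i. *)
Let X (s : int) := G ((i + 1)%R |` zitv s (i - 1))%fset.

Let X_i : X i = G (zitv i i) - A_col I i a i.
Proof.
rewrite /X zitv0 (_ : ((i + 1)%R |` fset0)%fset = zitv (i + 1) (i + 1)); last first.
  by rewrite zitv_recr ?lexx // zitv0.
have one s : l <= s -> s <= r -> G (zitv s s) = - colsum l a s s.
  by move=> ls sr; rewrite /G M_of_zitv_recr ?lexx // zitv0 M_of0 sub0r.
rewrite !one //; [|exact: ltW|by move: li; clear; lia|by move: ir; clear; lia].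
by rewrite /A_col; move: (colsum _ _ _ _) (colsum _ _ _ _); clear; lia.
Qed.

Let X_rec (s : int) : l <= s -> s < i -> 
  X s = Num.min (G (zitv s i) + X (s + 1) - G (zitv (s + 1) i)) (G (zitv s i) - A_col I i a s).
Proof.
move=> ls si; have [_ PG _] := M_of_bz I a.
have ii1 : i < i + 1 by clear; lia.
have := PG #|` zitv (s + 1) (i - 1)| s i (i + 1) (zitv (s + 1) (i - 1)) ls si ii1.
have e1 : (s |` ((i + 1)%R |` zitv (s + 1) (i - 1)))%fset = ((i + 1)%R |` zitv s (i - 1))%fset.
  by rewrite fset1UC -zitv_recl //; move: si; clear; lia.
have e2 : (i |` zitv (s + 1) (i - 1))%fset = zitv (s + 1) i.
  by rewrite -zitv_recr //; move: si; clear; lia.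
have e3 : (s |` zitv (s + 1) i)%fset = zitv s i.
  by rewrite -zitv_recl //; exact: ltW.
have e4 : (i |` ((i + 1)%R |` zitv (s + 1) (i - 1)))%fset = zitv (s + 1) (i + 1).
  by rewrite fset1UC e2 [RHS]zitv_recr ?addrK //; move: si; clear; lia.
have e5 : (s |` zitv (s + 1) (i - 1))%fset = zitv s (i - 1).
  by rewrite -zitv_recl //; move: si; clear; lia.
rewrite e1 e2 e3 e4 e5 -/(X s) -/(X (s + 1)) !mem_zitv -/G => H.
have {}H := H ltac:(move: ir; clear; lia) ltac:(apply: in_window_zitv; move: ls ir; clear; lia)
  ltac:(clear; lia) ltac:(clear; lia) ltac:(clear; lia) erefl.
have h1 : G (zitv (s + 1) (i + 1)) = G (zitv (s + 1) i) - colsum l a (s + 1) (i + 1).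
  rewrite /G M_of_zitv_recr ?addrK //; [by move: ls; clear; lia|by move: si; clear; lia|].
  by move: ir; clear; lia.
have h2 : G (zitv s i) = G (zitv s (i - 1)) - colsum l a s i.
  by rewrite /G M_of_zitv_recr //; exact: ltW.
move: H; rewrite h1 h2 /A_col /X.
move: (colsum _ _ _ _) (colsum _ _ _ _); lia_values G.
Qed.

(** The partial maximum over k >= s reaches eps_i exactly when s <= [k_f]; the induction follows the
    recursion down from s = i. *)
Let X_bound (n : nat) (s : int) : s = i - n%:Z -> l <= s ->
  [/\ G (zitv s i) - eps_l I i a <= X s,
      s <= k_f I i a -> X s = G (zitv s i) - eps_l I i a
    & k_f I i a < s -> G (zitv s i) - eps_l I i a + 1 <= X s].
Proof.
have [/andP[lk ki] ek mx] := k_fP li ir La.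
elim: n s => [|n IH] s es ls.
  have {es} -> : s = i by move: es; clear; lia.
  rewrite X_i; split.
  - by have := eps_l_ge (k := i) ir La; rewrite li lexx => /(_ isT); move: (A_col _ _ _ _); lia_values G.
  - by move=> ik; rewrite -ek (_ : k_f I i a = i) //; apply/eqP; rewrite eq_le ki.
  - by move=> ik; have := mx i; rewrite ik lexx => /(_ isT); move: (A_col _ _ _ _); lia_values G.
have si : s < i by move: es; clear; lia.
have [b1 b2 b3] := IH (s + 1) ltac:(move: es; clear; lia) ltac:(move: ls; clear; lia).
have ge := eps_l_ge (k := s) ir La; rewrite ls (ltW si) in ge; have {}ge := ge isT.
rewrite (X_rec ls si); split.
- by move: b1 ge; move: (X (s + 1)) (A_col _ _ _ _); lia_values G.
- rewrite le_eqVlt => /orP[/eqP sk|sk].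
    rewrite sk ek -sk; move: b1; move: (X (s + 1)); lia_values G.
  have {}b2 : X (s + 1) = G (zitv (s + 1) i) - eps_l I i a by apply: b2; move: sk; clear; lia.
  by rewrite b2; move: ge; move: (A_col _ _ _ _); lia_values G.
- move=> ks; have := mx s; rewrite ks (ltW si) => /(_ isT).
  have {}b3 : G (zitv (s + 1) i) - eps_l I i a + 1 <= X (s + 1).
    by apply: b3; move: ks; clear; lia.
  by move: b3; move: (X (s + 1)) (A_col _ _ _ _); lia_values G.
Qed.

Lemma eps_M_of : eps_l I i a = - M_of I a ((i + 1)%R |` zitv l (i - 1))%fset.
Proof.
have [/andP[lk ki] _ _] := k_fP li ir La.
have [_ /(_ lk) + _] := @X_bound `|i - l|%N l ltac:(move: li; clear; lia) (lexx _).
rewrite /X /G => ->; rewrite M_of_prefix; first by clear; lia.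
by move: li ir; clear; lia.
Qed.

(** Both sides satisfy the Pluecker relations, so intervals suffice. The minimum in the formula
    occurs only at [s, i]; by [X_bound] it leaves the value for s <= [k_f] and raises it by 1 for s
    > [k_f], which is the change of the column sums under f_i. *)
Lemma am_op_M_of K : in_window l r K -> am_op l i (M_of I a) K = M_of I (f_l I i a) K.
Proof.
have [G0 PG _] := M_of_bz I a; have [_ PG' _] := M_of_bz I (f_l I i a).
apply: plucker_determined => //; first by move=> n; apply: am_op_plucker.
move=> s t ls tr.
have [/andP[lk ki] ek mx] := k_fP li ir La.
have sumchg b (c : int) (J : {fset int}) : \sum_(j <- J) indic (b && (j == c)) = indic (b && (c \in J)).
  rewrite (@sum_update _ (fun _ => 0) c (indic b)).
  - by rewrite big1 // add0r; case: b; case: (c \in J).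
  - by move=> x /negPf->; rewrite andbF.
  - by rewrite eqxx andbT add0r.
have new : M_of I (f_l I i a) (zitv s t) = M_of I a (zitv s t)
   + indic [&& k_f I i a < s, s <= i & i <= t] - indic [&& k_f I i a < s, s <= i + 1 & i + 1 <= t].
  rewrite !M_of_zitv //.
  under eq_bigr => j _ do rewrite colsum_f_l // andbA.
  rewrite big_split big_split /= sumrN !sumchg !mem_zitv.
  have -> : [&& (k_f I i a < s) && (k_f I i a < i), s <= i & i <= t]
    = [&& k_f I i a < s, s <= i & i <= t] by clear; lia.
  by move: (indic _) (indic _) (\sum_(j <- _) _) => x y z; clear; lia.
rewrite new /am_op !mem_zitv.
have [/andP[si it]|ni] := boolP (s <= i <= t); have [/andP[si1 it1]|ni1] := boolP (s <= i + 1 <= t);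
  rewrite ?andbT ?andbF.
- by rewrite addrK.
- have ti : t = i by move: ni1 si it; clear; lia.
  have -> : (zitv s t `\ i)%fset = zitv s (i - 1).
    by apply/fsetP => x; rewrite in_fsetD1 !mem_zitv ti; clear; lia.
  have [] := @X_bound `|i - s|%N s ltac:(move: si; clear; lia) ls.
  rewrite -[X in _ - X]opprK -eps_M_of opprK ti [indic false]/indic subr0 /indic.
  rewrite /X -/G; move: (eps_l I i a) (G ((i + 1)%R |` zitv s (i - 1))%fset) (G (zitv s i)) => e x m.
  case: (leP s (k_f I i a)) => ks b1 b2 b3; first by move: (b2 isT); clear; lia.
  by move: (b3 isT); clear; lia.
- have -> : k_f I i a < s by move: ki si1 it1 ni; clear; lia.
  by rewrite /indic addr0.
- by rewrite /indic addr0 subr0.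
Qed.
End FopLusztig.

Lemma eq_am_op (l r q : int) (G H : {fset int} -> int) : l <= q -> q < r ->
  (forall K, in_window l r K -> G K = H K) ->
  forall K, in_window l r K -> am_op l q G K = am_op l q H K.
Proof.
move=> lq qr GH K hK; rewrite /am_op !GH //.
- by apply: in_window1; [move: lq qr|apply: in_window_zitv; move: qr]; clear; lia.
- apply: in_window1; [move: lq qr; clear; lia|apply: in_windowS hK; exact: fsubD1set].
Qed.

Lemma mem_fset_filter (A : {fset int}) (P : pred int) (y : int) :
  (y \in [fset z in A | P z]%fset) = (y \in A) && P y.
Proof. by rewrite !inE. Qed.

Section Interval.
Variable I : fitv.
Notation l := (lo I + 1).
Notation r := (lo I + (len I)%:Z + 1).

Lemma in_window_tilde K : in_window l r K <-> (K `<=` tilde I)%fset.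
Proof.
rewrite tilde_zitv; split=> [hK|/fsubsetP hK x /hK]; last by rewrite mem_zitv.
by apply/fsubsetP => x /hK; rewrite mem_zitv.
Qed.

(** The conventions at the empty set and at I~ are the cases x = l - 1 and x = r of the first clause
    of [bz]. *)
Lemma is_eBZ_bz M : is_eBZ I M <-> bz l r (ext I M).
Proof.
have lr := window_lt I.
have mt (x : int) : x \in tilde I = (l <= x <= r) by rewrite tilde_zitv mem_zitv.
have prefix (x : int) : x <= r -> [fset y in tilde I | (y <= x)%R]%fset = zitv l x.
  move=> xr; apply/fsetP => y.
  by rewrite (mem_fset_filter (tilde I) (fun z => z <= x)) mt mem_zitv; move: xr; clear; lia.
split=> [[h0 h1 h2]|[h0 h1 h2]].
- split.
  + move=> x hx; have [->|xl] := eqVneq x (l - 1); first by rewrite zitv0 /ext eqxx.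
    have [->|xr] := eqVneq x r; first by rewrite -tilde_zitv /ext eqxx orbT.
    rewrite -prefix; last by case/andP: hx.
    by apply: h0; rewrite mem_itv_seq; move: hx xl xr; clear; lia.
  + move=> n i j k K li ij jk kr hK iK jK kK _; apply: h2 => //; try exact/in_window_tilde.
    * by rewrite mt; move: li ij jk kr; clear; lia.
    * by rewrite mt; move: li ij jk kr; clear; lia.
    * by rewrite mt; move: li ij jk kr; clear; lia.
  + move=> i j K li ij jr hK iK jK; apply: h1 => //; try exact/in_window_tilde.
    * by rewrite mt; move: li ij jr; clear; lia.
    * by rewrite mt; move: li ij jr; clear; lia.
    * by rewrite lt_eqF.
- split.
  + move=> i; rewrite mem_itv_seq => hi; rewrite prefix; last by move: hi; clear; lia.
    by apply: h0; move: hi; clear; lia.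
  + move=> i j K; rewrite !mt => hi hj ij /in_window_tilde hK iK jK.
    case: (ltgtP i j) ij => // ij _.
      by apply: h2 => //; [case/andP: hi|case/andP: hj].
    by rewrite fset1UC addrC; apply: h2 => //; [case/andP: hj|case/andP: hi].
  + move=> i j k K; rewrite !mt => hi hj hk ij jk /in_window_tilde hK iK jK kK.
    by apply: h1 => //; [case/andP: hi|case/andP: hk].
Qed.

Lemma lusztig_ofP M : is_eBZ I M -> is_lusztig I (lusztig_of I M) /\
  forall K, in_window l r K -> M_of I (lusztig_of I M) K = ext I M K.
Proof.
move=> /is_eBZ_bz bM.
pose A (a : ldata) := is_lusztig I a /\ forall K, sub_proper I K -> M_of I a K = M K.
have [La aM] : A (lusztig_of I M).
  apply: (@xgetPex _ _ A); exists (lusztig_coord I (ext I M)); split.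
    by move=> i j; rewrite !tilde_zitv !mem_zitv /lusztig_coord; case: ifP => //; clear; lia.
  move=> K /and3P[KI K0 K1]; rewrite M_of_lusztig_coord //; last exact/in_window_tilde.
  by rewrite /ext (negPf K0) (negPf K1).
split=> // K /in_window_tilde KI; rewrite /ext.
have [->|K0] := eqVneq K fset0; first by rewrite M_of0.
have [->|K1] := eqVneq K (tilde I); last by apply: aM; rewrite /sub_proper KI K0.
by rewrite tilde_zitv M_of_prefix //; have := window_lt I; clear; lia.
Qed.

Variable q : int.
Hypotheses (lq : l <= q) (qr : q < r).

(** Supermodularity of the result is not visible in the formula; it holds because the result comes
    from a Lusztig datum again, whose entries are nonnegative. *)
Lemma am_op_bz G : bz l r G -> bz l r (am_op l q G).
Proof.
move=> bG; have La : is_lusztig I (lusztig_coord I G).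
  by move=> i j; rewrite !tilde_zitv !mem_zitv /lusztig_coord; case: ifP => //; clear; lia.
apply: bz_eq (M_of_bz I (f_l I q (lusztig_coord I G))) => K hK.
rewrite -am_op_M_of //; apply: eq_am_op hK => // J hJ; exact: M_of_lusztig_coord.
Qed.

Lemma f_IE M : is_eBZ I M -> forall K, in_window l r K -> f_I I q M K = am_op l q (ext I M) K.
Proof.
move=> /lusztig_ofP[La aM] K hK; rewrite /f_I -am_op_M_of //; exact: (eq_am_op lq qr aM hK).
Qed.

Lemma e_IE M : is_eBZ I M -> ext I M ((q + 1)%R |` zitv l (q - 1))%fset != 0 ->
  exists2 M', e_I I q M = Some M' &
    bz l r M' /\ forall K, in_window l r K -> am_op l q M' K = ext I M K.
Proof.
move=> /lusztig_ofP[La aM] e0.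
have [|b eb [Lb fb]] := @e_lP I q lq qr _ La.
  rewrite eps_M_of // oppr_eq0 aM //; apply: in_window1; first by move: lq qr; clear; lia.
  by apply: in_window_zitv; move: qr; clear; lia.
exists (M_of I b); first by rewrite /e_I eb.
split; first exact: M_of_bz.
by move=> K hK; rewrite am_op_M_of // fb aM.
Qed.
End Interval.

(** * Data on Maya diagrams *)

Local Notation top I := (lo I + (len I)%:Z + 1).

Lemma maya_ext (k k' : maya) : (forall x, (x \in maya_set k) = (x \in maya_set k')) -> k = k'.
Proof.
case: k k' => [A hA] [B hB] /= AB; have {}AB : A = B.
  by apply/seteqP; split=> x /mem_set; [rewrite AB|rewrite -AB] => /set_mem.
by subst B; congr Maya; exact: Prop_irrelevance.
Qed.

Lemma in_setP (A : set int) (P : bool) x : (A x <-> P) -> (x \in A) = P.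
Proof. by move=> AP; apply/idP/idP => [/set_mem/AP//|/AP/mem_set]. Qed.

Lemma mem_maya_cup (n : int) (K : {fset int}) (x : int) :
  (x \in maya_set (maya_cup n K)) = (x <= n) || (x \in K).
Proof.
apply: in_setP; rewrite /= /Zle /=; split=> [[->//|->]|/orP[]]; first by rewrite orbT.
  by left.
by right.
Qed.

Lemma mem_kLambda (p x : int) : (x \in maya_set (kLambda p)) = (x <= p).
Proof. by rewrite mem_maya_cup inE orbF. Qed.

Lemma mem_ksLambda (p x : int) :
  (x \in maya_set (ksLambda p)) = (x <= p - 1) || (x == p + 1).
Proof. by rewrite mem_maya_cup inE. Qed.

Lemma transpK p : involutive (transp p).
Proof. by move=> x; rewrite /transp; do ![case: eqP => //]; lia. Qed.

Lemma mem_sigma (q : int) (k : maya) (x : int) :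
  (x \in maya_set (sigma_maya q k)) = (transp q x \in maya_set k).
Proof.
apply: in_setP; split=> [[y ky <-]|/set_mem kx]; first by rewrite transpK; exact/mem_set.
by exists (transp q x); rewrite ?transpK.
Qed.

Lemma mem_shift (d : int) (k : maya) (x : int) :
  (x \in maya_set (shift_maya d k)) = (x - d \in maya_set k).
Proof.
apply: in_setP; split=> [[y ky <-]|/set_mem kx]; first by rewrite addrK; exact/mem_set.
by exists (x - d); rewrite ?subrK.
Qed.

Lemma mem_tilde I (x : int) : (x \in tilde I) = (lo I + 1 <= x <= top I).
Proof. by rewrite tilde_zitv mem_zitv. Qed.

Lemma mem_res I (k : maya) (x : int) :
  (x \in res I k) = (lo I + 1 <= x <= top I) && (x \in maya_set k).
Proof. by rewrite (mem_fset_filter (tilde I) (fun x => x \in maya_set k)) mem_tilde. Qed.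

Lemma mem_Omega I (k : maya) (x : int) : (x \in maya_set (Omega I k)) =
  (x <= lo I) || (lo I + 1 <= x <= top I) && (x \notin maya_set k).
Proof.
rewrite mem_maya_cup in_fsetD mem_res mem_tilde negb_and.
by case: (lo I + 1 <= x <= top I) => /=; rewrite ?andbT ?andbF.
Qed.

(** Unlike [in_MZ], this admits an empty or full trace on I~, so it passes to all subsets of the
    window and not just the proper ones. *)
Definition win (I : fitv) (k : maya) : Prop :=
  (forall x, x <= lo I -> x \in maya_set k) /\ (forall x, top I < x -> x \notin maya_set k).

Lemma in_window_res I k : in_window (lo I + 1) (top I) (res I k).
Proof. by move=> x; rewrite mem_res => /andP[]. Qed.

Lemma win_cup I k : win I k -> k = maya_cup (lo I) (res I k).
Proof.
case=> h1 h2; apply: maya_ext => x; rewrite mem_maya_cup mem_res.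
have [/h1->//|xl] := leP x (lo I); have [/h2/negPf->|xt] := ltP (top I) x; first by rewrite andbF.
by rewrite andbT (_ : lo I + 1 <= x) //; move: xl; clear; lia.
Qed.

Lemma restr_res I k M : win I k -> restr I M (res I k) = M k.
Proof. by move=> /win_cup; rewrite /restr => <-. Qed.

Lemma win_maya_cup I K : in_window (lo I + 1) (top I) K -> win I (maya_cup (lo I) K).
Proof.
move=> hK; split=> x; rewrite mem_maya_cup; first by move=> ->.
move=> xt; apply/norP; split; first by move: xt; clear; lia.
by apply/negP => /hK; move: xt; clear; lia.
Qed.

Lemma res_maya_cup I K : in_window (lo I + 1) (top I) K -> res I (maya_cup (lo I) K) = K.
Proof.
move=> hK; apply/fsetP => x; rewrite mem_res mem_maya_cup.
have [xK|xK] := boolP (x \in K); first by rewrite hK ?orbT.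
by rewrite orbF; clear; lia.
Qed.

Lemma in_MZP I k : in_MZ I k <-> win I k /\
  exists2 x, lo I + 1 <= x <= top I & x \in maya_set k
  /\ exists2 y, lo I + 1 <= y <= top I & y \notin maya_set k.
Proof.
split.
  case=> K /and3P[KI K0 K1] ->; have hK : in_window (lo I + 1) (top I) K by exact/in_window_tilde.
  split; first exact: win_maya_cup.
  have /fset0Pn[x xK] := K0; exists x; first exact: hK.
  split; first by rewrite mem_maya_cup xK orbT.
  have : ~~ (tilde I `<=` K)%fset by apply: contraNN K1 => TK; rewrite eqEfsubset KI.
  case/fsubsetPn => y; rewrite mem_tilde => hy yK; exists y => //.
  by rewrite mem_maya_cup (negPf yK) orbF; move: hy; clear; lia.
case=> wk [x hx [xk [y hy yk]]]; exists (res I k); last exact: win_cup.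
apply/and3P; split.
- by apply/in_window_tilde/in_window_res.
- by apply/fset0Pn; exists x; rewrite mem_res hx.
- by apply: contraNneq yk => e; move: hy; rewrite -mem_tilde -e mem_res => /andP[].
Qed.

Lemma in_MZ_win I k : in_MZ I k -> win I k. Proof. by case/in_MZP. Qed.

Lemma win_sub I J k : sub_itv I J -> win I k -> win J k.
Proof. by case=> h1 h2 [w1 w2]; split=> x hx; [apply: w1|apply: w2]; move: h1 h2 hx; clear; lia. Qed.

Lemma in_MZ_sub I J k : sub_itv I J -> in_MZ I k -> in_MZ J k.
Proof.
move=> IJ /in_MZP[w [x hx [xk [y hy yk]]]]; apply/in_MZP; split; first exact: win_sub w.
case: IJ => h1 h2; exists x; first by move: h1 h2 hx; clear; lia.
by split=> //; exists y => //; move: h1 h2 hy; clear; lia.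
Qed.

Lemma sub_itv_trans J I K : sub_itv I J -> sub_itv J K -> sub_itv I K.
Proof. by move=> [h1 h2] [h3 h4]; split; [exact: le_trans h1|exact: le_trans h4]. Qed.

Lemma itv_between (a b : int) : a < b -> exists2 I, lo I = a & lo I + (len I)%:Z = b.
Proof.
move=> ab; have m0 : (0 < `|b - a|)%N by move: ab; clear; lia.
by exists (Fitv a m0) => //=; move: ab; clear; lia.
Qed.

Lemma sub_itv_join I J : exists2 K, sub_itv I K & sub_itv J K.
Proof.
have h : Num.min (lo I) (lo J) < Num.max (lo I + (len I)%:Z) (lo J + (len J)%:Z).
  by have := len_gt0 I; have := len_gt0 J; clear; lia.
have [K k1 k2] := itv_between h.
by exists K; rewrite /sub_itv k2 k1 ?ge_min ?le_max ?lexx ?orbT.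
Qed.

Lemma itv_cover (a b : int) : exists I, lo I <= a /\ b <= lo I + (len I)%:Z.
Proof.
have h : a < Num.max (a + 1) b by clear; lia.
have [K k1 k2] := itv_between h; exists K; rewrite k2 k1; clear; lia.
Qed.

Lemma exists_win k : exists I, win I k.
Proof.
have [a [b [ka kb]]] := maya_bounds k; have [I [h1 h2]] := itv_cover a b.
exists I; split=> x hx; first by apply/mem_set/ka; exact: le_trans h1.
by apply/negP => /set_mem/kb; rewrite /Zle /=; move: h2 hx; clear; lia.
Qed.

Definition finitely_bz (M : coll) : Prop := forall I, is_eBZ I (restr I M).

Lemma restr_zitv I M (x : int) : lo I <= x -> restr I M (zitv (lo I + 1) x) = M (kLambda x).
Proof.
move=> lx; congr M; apply: maya_ext => y; rewrite mem_maya_cup mem_kLambda mem_zitv.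
by move: lx; clear; lia.
Qed.

Lemma finitely_bz_kLambda M (p : int) : finitely_bz M -> M (kLambda p) = 0.
Proof.
move=> bM; have [|I e1 e2] := @itv_between (p - 1) p; first by clear; lia.
have /is_eBZ_bz[/(_ p)] := bM I; rewrite e1 => h _ _.
rewrite -(@restr_zitv I); last by rewrite e1; clear; lia.
rewrite -[RHS]h; last by move: e2; rewrite e1; clear; lia.
rewrite /ext e1 ifF //; apply/norP; split.
  by apply/fset0Pn; exists p; rewrite mem_zitv; clear; lia.
apply/negP => /eqP/fsetP/(_ (p + 1)); rewrite tilde_zitv !mem_zitv e2 e1; clear; lia.
Qed.

(** The empty set and I~ correspond to diagrams of the form [kLambda x], where M vanishes anyway, so
    the convention agrees with the values of M. *)
Lemma ext_restr M I : finitely_bz M -> ext I (restr I M) = restr I M.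
Proof.
move=> bM; apply: funext => K; rewrite /ext.
have [->|K0] := eqVneq K fset0.
  by rewrite -(zitv0 (lo I + 1)) restr_zitv ?addrK // finitely_bz_kLambda.
have [->|//] := eqVneq K (tilde I).
by rewrite tilde_zitv restr_zitv ?finitely_bz_kLambda //=; have := len_gt0 I; clear; lia.
Qed.

Lemma finitely_bzP M : finitely_bz M <-> forall I, bz (lo I + 1) (top I) (restr I M).
Proof.
split=> [bM I|bM I]; first by rewrite -ext_restr //; exact/is_eBZ_bz.
apply/is_eBZ_bz; apply: bz_eq (bM I) => K hK; rewrite /ext.
have [G0 _ _] := bM I.
have [->|K0] := eqVneq K fset0.
  by rewrite -(zitv0 (lo I + 1)) G0 //; have := len_gt0 I; clear; lia.
have [->|//] := eqVneq K (tilde I).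
by rewrite tilde_zitv G0 //; have := len_gt0 I; clear; lia.
Qed.

Lemma restr_sub I J M K : sub_itv I J ->
  restr I M K = restr J M (zitv (lo J + 1) (lo I + 1 - 1) `|` K)%fset.
Proof.
case=> h1 h2; congr M; apply: maya_ext => x; rewrite !mem_maya_cup in_fsetU mem_zitv.
by case: (x \in K); rewrite ?orbT // !orbF; move: h1; clear; lia.
Qed.

Lemma bz_restr_sub I J M : sub_itv I J -> bz (lo J + 1) (top J) (restr J M) ->
  bz (lo I + 1) (top I) (restr I M).
Proof.
move=> IJ bJ; have [h1 h2] := IJ.
have := @bz_sub (lo J + 1) (top J) (lo I + 1) (top I) (restr J M).
have lI := len_gt0 I.
move=> /(_ ltac:(move: h1; clear; lia) ltac:(move: lI; clear; lia) ltac:(move: h2; clear; lia) bJ).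
by apply: bz_eq => K _; rewrite -restr_sub.
Qed.

Lemma finitely_bz_eps_ge0 M (p : int) : finitely_bz M -> 0 <= eps_Z p M.
Proof.
move=> bM; rewrite /eps_Z oppr_ge0.
have [|I e1 e2] := @itv_between (p - 1) p; first by clear; lia.
have /finitely_bzP/(_ I)[G0 _ /(_ p (p + 1) fset0)] := bM.
rewrite /supermodular_at !fsetU0 => SM.
have {}SM := SM ltac:(move: e1; clear; lia) ltac:(clear; lia) ltac:(move: e2; clear; lia)
  ltac:(done) isT isT.
have e0 : restr I M fset0 = 0.
  by rewrite -(zitv0 (lo I + 1)) G0 //; move: e1 e2; clear; lia.
have ep : restr I M [fset p]%fset = 0.
  rewrite (_ : [fset p]%fset = zitv (lo I + 1) p) ?G0 //; first by move: e1 e2; clear; lia.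
  by apply/fsetP => x; rewrite in_fset1 mem_zitv e1; clear; lia.
have epp : restr I M (p |` [fset (p + 1)%R])%fset = 0.
  rewrite (_ : (p |` [fset (p + 1)%R])%fset = zitv (lo I + 1) (p + 1)) ?G0 //.
    by move: e1 e2; clear; lia.
  by apply/fsetP => x; rewrite in_fset1U in_fset1 mem_zitv e1; clear; lia.
have ek : restr I M [fset (p + 1)%R]%fset = M (ksLambda p) by rewrite /restr e1.
by move: SM; rewrite epp ep e0 ek add0r addr0.
Qed.

(** * The operators over the integers *)

Definition am_maya (q : int) (M : coll) : coll := fun k =>
  if q \in maya_set k then
    if q + 1 \in maya_set k then M k
    else Num.min (M k + 1) (M (sigma_maya q k) + eps_Z q M)
  else if q + 1 \in maya_set k then M k - 1 else M k.

Lemma restr_am_maya I M q K : lo I + 1 <= q -> q < top I -> in_window (lo I + 1) (top I) K ->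
  restr I (am_maya q M) K = am_op (lo I + 1) q (restr I M) K.
Proof.
move=> lq qr hK; rewrite /restr /am_maya /am_op !mem_maya_cup.
have [-> ->] : (q <= lo I) = false /\ (q + 1 <= lo I) = false by move: lq; clear; lia.
rewrite /=; have [qK|//] := boolP (q \in K); have [//|q1K] := boolP (q + 1 \in K).
congr (Num.min _ (M _ - M _)).
  apply: maya_ext => x; rewrite mem_sigma !mem_maya_cup !inE /transp.
  have [->|xq] := eqVneq x q.
    by rewrite (negPf q1K) ?andbF; move: lq; clear; lia.
  have [->|xq1] := eqVneq x (q + 1); first by rewrite qK !orbT.
  by [].
apply: maya_ext => x; rewrite mem_ksLambda mem_maya_cup in_fset1U mem_zitv.
by move: lq; clear; lia.
Qed.

Lemma am_maya_locbz q M : finitely_bz M -> finitely_bz (am_maya q M).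
Proof.
move=> /finitely_bzP bM; apply/finitely_bzP => I.
have [J [h1 h2]] := itv_cover (Num.min (lo I) (q - 1)) (Num.max (lo I + (len I)%:Z) q).
have IJ : sub_itv I J by split; move: h1 h2; clear; lia.
apply: bz_restr_sub IJ _.
have lq : lo J + 1 <= q by move: h1; clear; lia.
have qr : q < top J by move: h2; clear; lia.
apply: (bz_eq _ (am_op_bz lq qr (bM J))) => K hK.
by rewrite restr_am_maya.
Qed.

(** Supermodularity is applied twice inside J. The first time it removes the new points above I~,
    the second time it adds those below; the intervals that occur besides have value 0. *)
Lemma Omega_mono I J M k : finitely_bz M -> in_MZ I k -> sub_itv I J -> M (Omega J k) <= M (Omega I k).
Proof.
move=> /finitely_bzP bM /in_MZP[[w1 w2] _] [h1 h2]; have lI := len_gt0 I; have bJ := bM J.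
have [G0 _ _] := bJ.
pose S := (tilde I `\` res I k)%fset; pose T := zitv (top I + 1) (top J).
pose A := zitv (lo J + 1) (lo I); pose B := zitv (lo J + 1) (top I).
have hS x : x \in S -> lo I + 1 <= x <= top I by rewrite in_fsetD mem_tilde => /andP[].
have wS : in_window (lo J + 1) (top J) S by move=> x /hS; move: h1 h2; clear; lia.
have wT : in_window (lo J + 1) (top J) T.
  by apply: in_window_zitv => //; move: h1 lI; clear; lia.
have wA : in_window (lo J + 1) (top J) A by apply: in_window_zitv => //; move: h2 lI; clear; lia.
have wB : in_window (lo J + 1) (top J) B by apply: in_window_zitv => //; move: h2 lI; clear; lia.
have wST : in_window (lo J + 1) (top J) (S `|` T)%fset.
  by move=> x; rewrite in_fsetU => /orP[/wS|/wT].
have G0' (x : int) : lo J <= x <= top J -> restr J M (zitv (lo J + 1) x) = 0.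
  by move=> hx; apply: G0; move: hx; clear; lia.
have GA : restr J M A = 0 by apply: G0'; move: h1 h2 lI; clear; lia.
have GB : restr J M B = 0 by apply: G0'; move: h1 h2 lI; clear; lia.
have G00 : restr J M fset0 = 0.
  by rewrite -(zitv0 (lo J + 1)) G0' //; have := len_gt0 J; clear; lia.
have := bz_supermodular bJ wST wB.
have -> : ((S `|` T) `|` B)%fset = zitv (lo J + 1) (top J).
  apply/fsetP => x; rewrite !in_fsetU !mem_zitv; have [/hS|_] := boolP (x \in S).
    by move: h1 h2 lI; clear; lia.
  by move: h1 h2 lI; clear; lia.
have -> : ((S `|` T) `&` B)%fset = S.
  apply/fsetP => x; rewrite in_fsetI in_fsetU !mem_zitv; have [/hS|_] := boolP (x \in S).
    by move: h1 h2 lI; clear; lia.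
  by move: h1 h2 lI; clear; lia.
rewrite (G0' (top J)) ?GB; last by have := len_gt0 J; clear; lia.
have := bz_supermodular bJ wS wA.
have -> : (S `&` A)%fset = fset0.
  apply/fsetP => x; rewrite in_fsetI mem_zitv inE; have [/hS|//] := boolP (x \in S).
  by move: h1 h2 lI; clear; lia.
have eI : restr J M (S `|` A)%fset = M (Omega I k).
  congr M; apply: maya_ext => x; rewrite mem_maya_cup mem_maya_cup in_fsetU mem_zitv.
  by case: (x \in S) => /=; rewrite ?orbT // orbF; move: h1; clear; lia.
have eJ : restr J M (S `|` T)%fset = M (Omega J k).
  congr M; apply: maya_ext => x; rewrite mem_maya_cup mem_Omega in_fsetU in_fsetD mem_res mem_tilde mem_zitv.
  have [xl|xl] := leP x (lo I).
    by rewrite w1 // andbF; move: xl h1 lI; clear; lia.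
  have [xt|xt] := ltP (top I) x.
    by rewrite w2 //; move: xt h1 lI; clear; lia.
  by case: (x \in maya_set k); move: xl xt h1 h2; clear; lia.
by rewrite eI eJ GA G00; clear; lia.
Qed.

(** By [Omega_mono] the values at [Omega J k] can only decrease as J grows, and integers bounded
    below become stationary. *)
Lemma BZ_Z_bounded M : finitely_bz M ->
  (forall k, exists I (B : int), in_MZ I k /\ forall J, sub_itv I J -> B <= M (Omega J k)) ->
  BZ_Z M.
Proof.
move=> bM bnd; split=> // k; have [I [B [Ik hB]]] := bnd k.
have [n] := ubnP (absz (M (Omega I k) - B)%R).
elim: n I Ik hB => // n IH I Ik hB; rewrite ltnS => In.
have [|] := pselect (exists2 J, sub_itv I J & M (Omega J k) != M (Omega I k)); last first.
  move=> nJ; exists I; split=> // J IJ; apply: contrapT => /eqP ne; apply: nJ; by exists J.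
case=> J IJ ne; apply: (IH J); first exact: in_MZ_sub Ik.
  by move=> K JK; apply: hB; exact: sub_itv_trans JK.
have := Omega_mono bM Ik IJ; have := hB J IJ; move: ne In; clear; lia.
Qed.

Lemma Int_e_sub M k I J : Int_e M k I -> sub_itv I J -> Int_e M k J.
Proof.
move=> [Ik st] IJ; split; first exact: in_MZ_sub Ik.
by move=> K JK; rewrite !st //; exact: sub_itv_trans JK.
Qed.

Lemma BZ_Z_finitely_bz M : BZ_Z M -> finitely_bz M. Proof. by case. Qed.

Lemma Int_e_kLambda M (q : int) I : Int_e M (kLambda q) I -> lo I + 1 <= q /\ q < top I.
Proof.
move=> [/in_MZP[_ [x hx [xk [y hy yk]]]] _]; move: xk yk; rewrite !mem_kLambda.
by move: hx hy; clear; lia.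
Qed.

Lemma am_maya_win I M q k : lo I + 1 <= q -> q < top I -> win I k ->
  am_maya q M k = am_op (lo I + 1) q (restr I M) (res I k).
Proof.
by move=> lq qr wk; rewrite -restr_am_maya ?restr_res //; exact: in_window_res.
Qed.

Lemma common_Int_e M (ks : seq maya) : BZ_Z M ->
  exists I, forall k, List.In k ks -> Int_e M k I.
Proof.
move=> [_ h]; elim: ks => [|k ks [I hI]]; first by have [I _] := h (kLambda 0); exists I.
have [J hJ] := h k; have [K IK JK] := sub_itv_join I J; exists K => k' [<-|k'ks].
  exact: Int_e_sub JK.
by apply: Int_e_sub IK; exact: hI.
Qed.

Lemma f_ZE (q : int) M : BZ_Z M -> f_Z q M = am_maya q M.
Proof.
move=> BM; have bM := BZ_Z_finitely_bz BM; apply: funext => k; apply: xget_unique.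
  have [I hI] := common_Int_e [:: kLambda q; ksLambda q; k; sigma_maya q k] BM.
  have i1 : Int_e M (kLambda q) I by apply: hI; left.
  have [lq qr] := Int_e_kLambda i1.
  exists I; split.
  - split; first by case: (hI k) => //; right; right; left.
    by case: (hI (sigma_maya q k)) => //; right; right; right; left.
  - by split=> //; apply: hI; right; left.
  - rewrite f_IE //; last exact: in_window_res.
    by rewrite ext_restr // (@am_maya_win I) //; case: (hI k) => [|/in_MZ_win]; [right; right; left|].
move=> v [I [[Ik _] [i1 _] ->]]; have [lq qr] := Int_e_kLambda i1.
rewrite f_IE //; last exact: in_window_res.
by rewrite ext_restr // (@am_maya_win I) //; exact: in_MZ_win.
Qed.

(** Only the second term of the minimum is in question, and by [eps_bound] it is at least [M k]. *)
Lemma am_maya_ge q M k : finitely_bz M -> M k - 1 <= am_maya q M k.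
Proof.
move=> bM; rewrite /am_maya; case: ifPn => qk; case: ifPn => q1k; try by clear; lia.
have [I0 w0] := exists_win k.
have [I [h1 h2]] := itv_cover (Num.min (lo I0) (q - 1)) (Num.max (lo I0 + (len I0)%:Z) q).
have wk : win I k by apply: win_sub w0; split; move: h1 h2; clear; lia.
have lq : lo I + 1 <= q by move: h1; clear; lia.
have qr : q < top I by move: h2; clear; lia.
have /finitely_bzP/(_ I) bI := bM; have hK := @in_window_res I k.
have := am_maya_win M lq qr wk; rewrite /am_maya (negPf q1k) qk => ->.
have rq : q \in res I k by rewrite mem_res qk andbT lq ltW.
have rq1 : q + 1 \notin res I k by rewrite mem_res (negPf q1k) andbF.
rewrite /am_op rq (negPf rq1) -(restr_res M wk).
have := eps_bound lq qr bI (J := (res I k `\ q)%fset).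
rewrite fsetD1K // => /(_ (in_windowS (fsubD1set _ _) hK)).
rewrite !in_fsetD1 eqxx (negPf rq1) andbF => /(_ isT isT).
by lia_values (restr I M).
Qed.

Lemma am_maya_le q M k : am_maya q M k <= M k + 1.
Proof. by rewrite /am_maya; case: ifPn => _; case: ifPn => _; clear; lia. Qed.

Lemma am_maya_BZ q M : BZ_Z M -> BZ_Z (am_maya q M).
Proof.
move=> BM; have bM := BZ_Z_finitely_bz BM; apply: BZ_Z_bounded; first exact: am_maya_locbz.
move=> k; have [I [Ik st]] := BM.2 k; exists I, (M (Omega I k) - 1); split=> // J IJ.
by rewrite -(st J IJ); exact: am_maya_ge.
Qed.

Lemma am_maya_inj q M N : finitely_bz M -> finitely_bz N -> am_maya q M = am_maya q N -> M = N.
Proof.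
move=> bM bN MN; apply: funext => k.
have [I0 w0] := exists_win k.
have [I [h1 h2]] := itv_cover (Num.min (lo I0) (q - 1)) (Num.max (lo I0 + (len I0)%:Z) q).
have wk : win I k by apply: win_sub w0; split; move: h1 h2; clear; lia.
have lq : lo I + 1 <= q by move: h1; clear; lia.
have qr : q < top I by move: h2; clear; lia.
have /finitely_bzP/(_ I) bMI := bM; have /finitely_bzP/(_ I) bNI := bN.
rewrite -!(restr_res _ wk); apply: (am_op_inj lq qr bMI bNI) => [K hK|].
  by rewrite -!restr_am_maya // MN.
exact: in_window_res.
Qed.

Lemma am_op_sub I J (q : int) (G : {fset int} -> int) K : sub_itv I J -> lo I + 1 <= q -> q < top I ->
  am_op (lo I + 1) q (fun K => G (zitv (lo J + 1) (lo I + 1 - 1) `|` K)%fset) K =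
  am_op (lo J + 1) q G (zitv (lo J + 1) (lo I + 1 - 1) `|` K)%fset.
Proof.
move=> [h1 h2] lq qr; rewrite /am_op !in_fsetU !mem_zitv.
have -> : (lo J + 1 <= q <= lo I + 1 - 1) = false by move: lq; clear; lia.
have -> : (lo J + 1 <= q + 1 <= lo I + 1 - 1) = false by move: lq; clear; lia.
rewrite /=; case: ifP => // qK; case: ifP => // q1K.
congr (Num.min _ (G _ - G _)); apply/fsetP => x.
  rewrite !(in_fsetU, in_fsetD1, in_fset1, mem_zitv).
  by case: (x \in K); move: lq; clear; lia.
rewrite !(in_fsetU, in_fset1, mem_zitv); move: h1 lq; clear; lia.
Qed.

(** Both sides are preimages of the same function under the injective [am_op] on the smaller
    window. *)
Lemma e_I_compat M (q : int) I J GI GJ K : sub_itv I J -> lo I + 1 <= q -> q < top I ->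
  bz (lo I + 1) (top I) GI -> bz (lo J + 1) (top J) GJ ->
  (forall K, in_window (lo I + 1) (top I) K -> am_op (lo I + 1) q GI K = restr I M K) ->
  (forall K, in_window (lo J + 1) (top J) K -> am_op (lo J + 1) q GJ K = restr J M K) ->
  in_window (lo I + 1) (top I) K ->
  GI K = GJ (zitv (lo J + 1) (lo I + 1 - 1) `|` K)%fset.
Proof.
move=> IJ lq qr bI bJ eI eJ hK; have [h1 h2] := IJ; have lI := len_gt0 I.
have bJ' := @bz_sub (lo J + 1) (top J) (lo I + 1) (top I) GJ ltac:(move: h1; clear; lia)
  ltac:(move: lI; clear; lia) ltac:(move: h2; clear; lia) bJ.
apply: (am_op_inj lq qr bI bJ') hK => N hN.
rewrite eI // am_op_sub // eJ; first exact: restr_sub.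
move=> x; rewrite in_fsetU mem_zitv => /orP[|/hN]; move: h1 h2 lI; clear; lia.
Qed.

Lemma e_ZP (q : int) M : BZ_Z M -> eps_Z q M != 0 ->
  exists2 N, e_Z q M = Some N & BZ_Z N /\ am_maya q N = M.
Proof.
move=> BM e0; have bM := BZ_Z_finitely_bz BM.
(* The default is never taken, since [eps_Z q M] is nonzero; it only gives a name to the result. *)
pose N : coll := odflt M (e_Z q M).
have eN : e_Z q M = Some N by rewrite /N /e_Z (negPf e0).
exists N => //.
pose good I M' := [/\ lo I + 1 <= q, q < top I, bz (lo I + 1) (top I) M'
  & forall K, in_window (lo I + 1) (top I) K -> am_op (lo I + 1) q M' K = restr I M K].
have goodP I : lo I + 1 <= q -> q < top I -> exists2 M', e_I I q (restr I M) = Some M' & good I M'.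
  move=> lq qr; have [|M' e1 [b1 f1]] := e_IE lq qr (bM I).
    rewrite ext_restr //; move: e0; rewrite /eps_Z oppr_eq0; congr (_ != _); congr M.
    apply: maya_ext => x; rewrite mem_ksLambda mem_maya_cup in_fset1U mem_zitv.
    by move: lq; clear; lia.
  by exists M' => //; split=> // K hK; rewrite f1 // ext_restr.
(* Two intervals are compared through a third one containing both. *)
have agree I J GI GJ k : good I GI -> good J GJ -> win I k -> win J k ->
    GI (res I k) = GJ (res J k).
  move=> [lI rI bI eI] [lJ rJ bJ eJ] wI wJ.
  have [K IK JK] := sub_itv_join I J.
  have [lK rK] : lo K + 1 <= q /\ q < top K by case: IK; move: lI rI; clear; lia.
  have [GK _ [_ _ bK eK]] := goodP K lK rK.
  rewrite (e_I_compat IK lI rI bI bK eI eK); last exact: in_window_res.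
  rewrite (e_I_compat JK lJ rJ bJ bK eJ eK); last exact: in_window_res.
  congr GK; apply/fsetP => x; rewrite !in_fsetU !mem_zitv !mem_res.
  case: IK JK => [i1 i2] [j1 j2].
  have bnd L : win L k -> (x \in maya_set k) && (x <= top L) || (x \notin maya_set k) && (lo L < x).
    move=> [w1 w2]; have [xk|xk] := boolP (x \in maya_set k) => /=.
      by rewrite orbF leNgt; apply: contraL xk => /w2.
    by rewrite ltNge; apply: contra xk => /w1.
  move: (bnd _ wI) (bnd _ wJ) i1 i2 j1 j2.
  by case: (x \in maya_set k) => /=; rewrite ?orbF; clear; lia.
(* The definition allows only intervals satisfying the stability conditions; by [agree] every window
   around k that contains q and q + 1 gives the same value. *)
have NE I GI k : good I GI -> win I k -> N k = GI (res I k).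
  move=> gI wI; pose V (v : int) := exists I M',
    [/\ in_MZ I k /\ in_MZ I (sigma_maya q k),
        [/\ Int_e M (kLambda q) I, Int_e M (ksLambda q) I,
            Int_e M (kLambda (q + 1)) I & Int_e M (kLambda (q - 1)) I],
        e_I I q (restr I M) = Some M' & v = M' (res I k)].
  have V0 : exists v, V v.
    have [J hJ] := common_Int_e [:: kLambda q; ksLambda q; kLambda (q + 1); kLambda (q - 1); k;
      sigma_maya q k] BM.
    have j1 : Int_e M (kLambda q) J by apply: hJ; do ?[by left|right].
    have j2 : Int_e M (ksLambda q) J by apply: hJ; do ?[by left|right].
    have j3 : Int_e M (kLambda (q + 1)) J by apply: hJ; do ?[by left|right].
    have j4 : Int_e M (kLambda (q - 1)) J by apply: hJ; do ?[by left|right].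
    have [j5 _] : Int_e M k J by apply: hJ; do ?[by left|right].
    have [j6 _] : Int_e M (sigma_maya q k) J by apply: hJ; do ?[by left|right].
    have [lq qr] := Int_e_kLambda j1.
    by have [GJ eJ _] := goodP J lq qr; exists (GJ (res J k)), J, GJ; split.
  have -> : N k = xget 0 (V : set int) by rewrite /N /e_Z (negPf e0).
  have [J [GJ [[Jk _] [J1 _ _ _] eJ ->]]] := @xgetPex _ 0 V V0.
  have [lq qr] := Int_e_kLambda J1; have [GJ' eJ' gJ] := goodP J lq qr.
  move: eJ; rewrite eJ' => -[<-]; apply: agree => //; exact: in_MZ_win.
have rN I GI K : good I GI -> in_window (lo I + 1) (top I) K -> restr I N K = GI K.
  by move=> gI hK; rewrite /restr (NE I GI) ?res_maya_cup //; exact: win_maya_cup.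
have cover I0 : exists I, [/\ sub_itv I0 I, lo I + 1 <= q & q < top I].
  have [I [h1 h2]] := itv_cover (Num.min (lo I0) (q - 1)) (Num.max (lo I0 + (len I0)%:Z) q).
  by exists I; split; [split; move: h1 h2|move: h1|move: h2]; clear; lia.
have bN : finitely_bz N.
  apply/finitely_bzP => I; have [J [IJ lq qr]] := cover I; apply: bz_restr_sub IJ _.
  have [GJ _ gJ] := goodP J lq qr; case: (gJ) => _ _ bJ _.
  by apply: bz_eq bJ => K hK; rewrite (rN J GJ).
have fN : am_maya q N = M.
  apply: funext => k; have [I0 w0] := exists_win k; have [I [II lq qr]] := cover I0.
  have wk := win_sub II w0; have [GI _ gI] := goodP I lq qr; case: (gI) => _ _ _ eI.
  rewrite (am_maya_win _ lq qr wk) -(restr_res M wk) -eI; last exact: in_window_res.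
  apply: eq_am_op (@in_window_res I k) => // K hK; exact: rN.
split=> //; apply: BZ_Z_bounded => // k.
have [I [Ik st]] := BM.2 k; exists I, (M (Omega I k) - 1); split=> // J IJ.
by rewrite -(st J IJ) -fN; have := am_maya_le q N (Omega J k); clear; lia.
Qed.

(** * Products of commuting operators *)

Definition step (k : maya) (q : int) : bool := (q \in maya_set k) != (q + 1 \in maya_set k).

Definition far (q q' : int) : Prop := q + 1 < q' \/ q' + 1 < q.

Lemma am_maya_nstep M q k : ~~ step k q -> am_maya q M k = M k.
Proof.
by rewrite /step /am_maya negbK => /eqP->; case: (q + 1 \in maya_set k).
Qed.

Lemma mem_sigma_far q k x : x != q -> x != q + 1 ->
  (x \in maya_set (sigma_maya q k)) = (x \in maya_set k).
Proof. by move=> /negPf xq /negPf xq1; rewrite mem_sigma /transp xq xq1. Qed.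

Lemma far_neq (q q' : int) : far q q' ->
  [/\ q' != q, q' != q + 1, q' + 1 != q & q' + 1 != q + 1].
Proof. by case=> h; split; move: h; clear; lia. Qed.

Lemma farC (q q' : int) : far q q' -> far q' q. Proof. by case; [right|left]. Qed.

Lemma step_sigma_far q q' k : far q q' -> step (sigma_maya q k) q' = step k q'.
Proof. by move=> /far_neq[h1 h2 h3 h4]; rewrite /step !mem_sigma_far. Qed.

Lemma sigma_far q q' k : far q q' ->
  sigma_maya q (sigma_maya q' k) = sigma_maya q' (sigma_maya q k).
Proof.
move=> f; apply: maya_ext => x; rewrite !mem_sigma; congr (fun y => y \in maya_set k).
have {}f : (q + 1 < q') || (q' + 1 < q) by case: f => ->; rewrite ?orbT.
by rewrite /transp; move: f; clear; do ?[case: ifP]; lia.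
Qed.

Lemma eps_am_maya_far q q' M : far q q' -> eps_Z q' (am_maya q M) = eps_Z q' M.
Proof.
move=> f; rewrite /eps_Z am_maya_nstep // /step negbK !mem_ksLambda.
by case: f => h; move: h; clear; lia.
Qed.

Lemma eps_am_maya q M : eps_Z q (am_maya q M) = eps_Z q M + 1.
Proof.
rewrite /eps_Z /am_maya !mem_ksLambda (_ : (q <= q - 1) || (q == q + 1) = false); last by clear; lia.
by rewrite (_ : (q + 1 <= q - 1) || (q + 1 == q + 1) = true); clear; lia.
Qed.

Lemma am_maya_comm q q' M : far q q' -> am_maya q (am_maya q' M) = am_maya q' (am_maya q M).
Proof.
move=> f; have [h1 h2 h3 h4] := far_neq f; have [g1 g2 g3 g4] := far_neq (farC f).
apply: funext => k; rewrite [LHS]/am_maya [RHS]/am_maya !eps_am_maya_far //; last exact: farC.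
rewrite /am_maya !mem_sigma_far // (sigma_far _ f).
case: (q \in maya_set k); case: (q' \in maya_set k); case: (q + 1 \in maya_set k);
  case: (q' + 1 \in maya_set k) => //=.
all: move: (eps_Z q M) (eps_Z q' M) => e e'; do ![let g := fresh in move: (M _) => g]; clear; lia.
Qed.

Definition am_seq (M : coll) (s : seq int) : coll := foldr am_maya M s.
Arguments am_seq : simpl never.

Lemma am_seq_cons q s M : am_seq M (q :: s) = am_maya q (am_seq M s). Proof. by []. Qed.

Section Class.
Variables (l : nat) (p : int).
Hypothesis l2 : (1 < l)%N.

Definition same_residue (q : int) : bool := (q == p %[mod l%:Z])%Z.

Lemma same_residue_far q q' : same_residue q -> same_residue q' -> q != q' -> far q q'.
Proof.
rewrite /same_residue => /eqP e /eqP e' ne.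
have : (l%:Z %| q - q')%Z by rewrite -eqz_mod_dvd e e'.
move=> /dvdzP[m em]; rewrite /far; have : m != 0.
  by apply: contra_neq ne => m0; move: em; rewrite m0 mul0r; clear; lia.
by move: em l2; clear; nia.
Qed.

Lemma am_seq_comm q s M : same_residue q -> all same_residue s -> am_maya q (am_seq M s) = am_seq (am_maya q M) s.
Proof.
move=> cq; elim: s => //= q' s IH /andP[cq' cs]; rewrite !am_seq_cons.
have [e|ne] := eqVneq q q'; first by subst q'; rewrite IH.
by rewrite am_maya_comm ?IH //; exact: same_residue_far.
Qed.

Lemma am_seq_cat s t M : am_seq M (s ++ t) = am_seq (am_seq M t) s.
Proof. by rewrite /am_seq foldr_cat. Qed.

Lemma am_seq_perm s t M : all same_residue s -> perm_eq s t -> am_seq M s = am_seq M t.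
Proof.
elim: s t => [|q s IH] t /=; first by move=> _ /perm_size/esym/size0nil->.
move=> /andP[cq cs] st; have qt : q \in t by rewrite -(perm_mem st) inE eqxx.
have ct : all same_residue t by rewrite -(perm_all _ st) /= cq.
have := perm_to_rem qt => tr; have := perm_trans st tr; rewrite perm_cons => sr.
have ctr : all same_residue (rem q t) by apply/allP => x /mem_rem; exact: allP ct x.
have [t1 [t2 et]] : exists t1 t2, t = t1 ++ q :: t2.
  by have /splitPr[t1 t2] := qt; exists t1, t2.
have crm : perm_eq (rem q t) (t1 ++ t2).
  by rewrite -(perm_cons q) -(permPl tr) et perm_catC /= perm_cons perm_catC.
rewrite am_seq_cons (IH (t1 ++ t2) cs (perm_trans sr crm)) et !am_seq_cat am_seq_cons.
rewrite et all_cat /= in ct; case/and3P: ct => c1 _ c2.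
by rewrite am_seq_comm.
Qed.

Lemma am_seq_nstep s M k : {in s, forall q, ~~ step k q} -> am_seq M s k = M k.
Proof.
elim: s => //= q s IH h; rewrite am_seq_cons am_maya_nstep ?IH //; last by apply: h; rewrite inE eqxx.
by move=> x xs; apply: h; rewrite inE xs orbT.
Qed.

(** The factors commute, so those with no step at k can be applied last, where they leave the value
    at k alone. *)
Lemma am_seq_filter s M k : all same_residue s -> am_seq M s k = am_seq M [seq q <- s | step k q] k.
Proof.
move=> cs; rewrite (@am_seq_perm _ ([seq q <- s | ~~ step k q] ++ [seq q <- s | step k q])) //.
  by rewrite am_seq_cat am_seq_nstep // => q; rewrite mem_filter => /andP[].
by rewrite perm_sym perm_catC; apply/permPl/perm_filterC.
Qed.

Lemma am_seq_BZ s M : BZ_Z M -> BZ_Z (am_seq M s).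
Proof. by move=> BM; elim: s => // q s; exact: am_maya_BZ. Qed.

Lemma am_seq_ge s M k : BZ_Z M -> M k - (size s)%:Z <= am_seq M s k.
Proof.
move=> BM; elim: s => [|q s IH]; first by rewrite subr0.
by have := am_maya_ge q k (BZ_Z_finitely_bz (am_seq_BZ s BM)); move: IH; rewrite am_seq_cons /=; clear; lia.
Qed.

Lemma am_seq_le s M k : am_seq M s k <= M k + (size s)%:Z.
Proof.
elim: s => [|q s IH]; first by rewrite addr0.
by have := am_maya_le q (am_seq M s) k; move: IH; rewrite am_seq_cons /=; clear; lia.
Qed.

Lemma am_seq_inj s M N : finitely_bz M -> finitely_bz N -> am_seq M s = am_seq N s -> M = N.
Proof.
have lFQ X t : finitely_bz X -> finitely_bz (am_seq X t).
  by move=> lX; elim: t => // q t; exact: am_maya_locbz.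
move=> lM lN; elim: s => // q s IH; rewrite !am_seq_cons => /(am_maya_inj (lFQ _ _ lM) (lFQ _ _ lN)).
exact: IH.
Qed.

Lemma foldr_f_Z s M : BZ_Z M -> foldr f_Z M s = am_seq M s.
Proof. by move=> BM; elim: s => //= q s ->; rewrite f_ZE //; exact: am_seq_BZ. Qed.

(** The diagrams whose steps of the given residue lie in [t] are stable under the transpositions at
    places of [s] and include the [ksLambda q] for q in [s]; the product reads no other values. *)
Lemma am_seq_local (s t : seq int) M N : all same_residue s -> {subset s <= t} ->
  (forall k, (forall q, same_residue q -> step k q -> q \in t) -> M k = N k) ->
  forall k, (forall q, same_residue q -> step k q -> q \in t) -> am_seq M s k = am_seq N s k.
Proof.
move=> cs st MN; elim: s cs st => [|q s IH] /=; first by move=> _ _; exact: MN.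
move=> /andP[cq cs] st.
have {}IH := IH cs (fun x xs => st x (mem_behead (s := q :: s) xs)).
have qt : q \in t by apply: st; rewrite inE eqxx.
move=> k hk; rewrite !am_seq_cons /am_maya (IH k hk) (IH (sigma_maya q k)); last first.
  move=> x cx; have [->//|ne] := eqVneq x q.
  by rewrite step_sigma_far; [exact: hk|apply: same_residue_far => //; rewrite eq_sym].
rewrite /eps_Z (IH (ksLambda q)) // => x cx; have [->//|ne] := eqVneq x q.
have /far_neq[n1 n2 n3 n4] := same_residue_far cq cx (ltac:(rewrite eq_sym; exact: ne)).
by rewrite /step !mem_ksLambda; move: n1 n2 n3 n4; clear; lia.
Qed.

End Class.

(** * Affine type *)

Section Affine.
Variables (l : nat) (p : 'I_l).
Hypothesis hl : (3 <= l)%N.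

Let l2 : (1 < l)%N. Proof. exact: ltnW. Qed.
Local Notation cls := (same_residue l p%:Z).
Local Notation Lseq k := (enum_fset (fset_set (L_e k p))).

Lemma win_step I k q : win I k -> step k q -> lo I <= q <= top I.
Proof.
move=> [w1 w2]; rewrite /step; have [ql|ql] := ltP q (lo I).
  by rewrite !w1 //; move: ql; clear; lia.
have [qt|//] := ltP (top I) q.
by rewrite (negPf (w2 _ qt)) (negPf (w2 _ _)) //; move: qt; clear; lia.
Qed.

Lemma mem_L_e k q : (q \in fset_set (L_e k p)) = cls q && step k q.
Proof.
have [I wI] := exists_win k.
have LE x : L_e k p x <-> cls x && step k x.
  rewrite /L_e /step; split.
    case=> xp h; rewrite /cls xp eqxx /=; case: h => -[h1 h2].
      by rewrite (mem_set h1) (memNset h2).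
    by rewrite (memNset h1) (mem_set h2).
  case/andP=> /eqP xp; split=> //; move: b.
  have [/set_mem h1|/negP h1] := boolP (x \in maya_set k);
    have [/set_mem h2|/negP h2] := boolP (x + 1 \in maya_set k) => // _.
    by left; split=> // /mem_set.
  by right; split=> // /mem_set.
have fin : finite_set (L_e k p).
  apply: sub_finite_set (finite_int_interval (lo I - 1) (top I)) => x /LE/andP[_ /(win_step wI)].
  by rewrite /=; clear; lia.
by rewrite in_fset_set //; apply/idP/idP => [/set_mem/LE|/LE/mem_set].
Qed.

Lemma Lseq_cls k : all cls (Lseq k).
Proof. by apply/allP => q; rewrite -[X in is_true X]/(q \in fset_set (L_e k p)) mem_L_e => /andP[]. Qed.

Lemma Lseq_perm k s : uniq s -> all cls s -> (forall q, cls q -> step k q -> q \in s) ->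
  perm_eq [seq q <- s | step k q] (Lseq k).
Proof.
move=> us cs hs; apply: uniq_perm; [by rewrite filter_uniq|exact: fset_uniq|].
move=> q; rewrite -[RHS]/(q \in fset_set (L_e k p)) mem_L_e mem_filter andbC.
apply/andP/andP => -[h1 h2]; split=> //; first exact: allP cs q h1.
exact: hs.
Qed.

(** This frees the product from its dependence on k: one list serves all diagrams whose steps it
    covers, in particular all those of one window. *)
Lemma f_hatE M k s : BZ_Z M -> uniq s -> all cls s ->
  (forall q, cls q -> step k q -> q \in s) -> f_hat p M k = am_seq M s k.
Proof.
move=> BM us cs hs; rewrite /f_hat foldr_f_Z // (am_seq_filter l2 M k cs).
rewrite (@am_seq_perm l p%:Z l2 _ _ M _ (Lseq_perm us cs hs)) // all_filter.
by apply: sub_all cs => q /= ->; rewrite implybT.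
Qed.

Definition residue_seq (a b : int) : seq int := [seq q <- enum_fset (zitv a b) | cls q].

Lemma mem_residue_seq a b q : (q \in residue_seq a b) = cls q && (a <= q <= b).
Proof. by rewrite mem_filter -(mem_zitv a b q). Qed.

Lemma residue_seq_uniq a b : uniq (residue_seq a b). Proof. by rewrite filter_uniq // fset_uniq. Qed.

Lemma residue_seq_cls a b : all cls (residue_seq a b). Proof. exact: filter_all. Qed.

Lemma f_hat_win M I k : BZ_Z M -> win I k -> f_hat p M k = am_seq M (residue_seq (lo I) (top I)) k.
Proof.
move=> BM wI; apply: f_hatE => //; [exact: residue_seq_uniq|exact: residue_seq_cls|].
by move=> q cq /(win_step wI) hq; rewrite mem_residue_seq cq.
Qed.

Lemma win_eq_finitely_bz M : (forall I, exists2 N, finitely_bz N & forall k, win I k -> M k = N k) -> finitely_bz M.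
Proof.
move=> h; apply/finitely_bzP => I; have [N /finitely_bzP/(_ I) bN MN] := h I.
by apply: bz_eq bN => K hK; rewrite /restr MN //; exact: win_maya_cup.
Qed.

Lemma f_hat_finitely_bz M : BZ_Z M -> finitely_bz (f_hat p M).
Proof.
move=> BM; apply: win_eq_finitely_bz => I; exists (am_seq M (residue_seq (lo I) (top I))).
  by apply: BZ_Z_finitely_bz; exact: am_seq_BZ.
by move=> k wI; exact: f_hat_win.
Qed.

Lemma step_Omega I k q : step (Omega I k) q -> [|| q == lo I, q == top I | step k q].
Proof.
rewrite /step !mem_Omega; have [->|ql] := eqVneq q (lo I) => //=.
have [->|qt] := eqVneq q (top I) => //=.
have [q1|q1] := leP q (lo I).
  by rewrite (_ : q + 1 <= lo I) //; move: q1 ql; clear; lia.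
have -> : (q + 1 <= lo I) = false by move: q1; clear; lia.
have [q2|q2] := ltP (top I) q.
  have -> : (q + 1 <= top I) = false by move: q2; clear; lia.
  by rewrite !andbF.
have -> : lo I + 1 <= q by move: q1; clear; lia.
have -> : lo I + 1 <= q + 1 by move: q1; clear; lia.
have -> : q + 1 <= top I by move: q2 qt; clear; lia.
by rewrite /=; case: (q \in _); case: (q + 1 \in _).
Qed.

Lemma size_Lseq_Omega I k : (size (Lseq (Omega I k)) <= (size (Lseq k)).+2)%N.
Proof.
have := @uniq_leq_size _ (Lseq (Omega I k)) (lo I :: top I :: Lseq k) (fset_uniq _); apply.
move=> q; rewrite -[X in is_true X]/(q \in fset_set (L_e (Omega I k) p)) mem_L_e => /andP[cq].
by move=> /step_Omega /or3P[] h; rewrite !inE ?h ?orbT // -[q \in enum_fset _]/(q \in fset_set (L_e k p)) mem_L_e cq h !orbT.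
Qed.

(** Each factor lowers a value by at most 1, and passing from k to [Omega J k] creates steps only at
    the two ends of J. The resulting lower bound is the same for all J. *)
Lemma f_hat_BZ M : BZ_Z M -> BZ_Z (f_hat p M).
Proof.
move=> BM; apply: BZ_Z_bounded; first exact: f_hat_finitely_bz.
move=> k; have [I [Ik st]] := BM.2 k.
exists I, (M (Omega I k) - (size (Lseq k)).+2%:Z); split=> // J IJ.
rewrite -(st J IJ) /f_hat foldr_f_Z //.
apply: le_trans (am_seq_ge _ _ BM).
by rewrite lerD2l lerN2 lez_nat; exact: size_Lseq_Omega.
Qed.

Lemma step_ksLambda (q x : int) : cls q -> cls x -> step (ksLambda q) x -> x = q.
Proof.
move=> cq cx; have [//|ne] := eqVneq x q; rewrite eq_sym in ne.
have /far_neq[n1 n2 n3 n4] := same_residue_far l2 cq cx ne.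
by rewrite /step !mem_ksLambda; move: n1 n2 n3 n4; clear; lia.
Qed.

Lemma cls_p : cls p%:Z. Proof. exact: eqxx. Qed.

Lemma eps_f_hat M : BZ_Z M -> eps_hat p (f_hat p M) = eps_hat p M + 1.
Proof.
move=> BM; rewrite -[RHS](eps_am_maya p%:Z M) /eps_hat /eps_Z.
rewrite (@f_hatE M (ksLambda p%:Z) [:: p%:Z]) //=; first by rewrite cls_p.
by move=> q cq /(step_ksLambda cls_p cq)->; rewrite inE.
Qed.

(** Neighbours of a member of the class are outside it, so moving an end by 1 is enough. Then every
    member q in the range has both q and q + 1 in the window. *)
Lemma itv_avoiding_residue (I : fitv) : exists J, [/\ sub_itv I J, ~~ cls (lo J) & ~~ cls (top J)].
Proof.
have adj x : cls x -> ~~ cls (x - 1) /\ ~~ cls (x + 1).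
  move=> cx; split; apply/negP => cx'.
    by have [] := same_residue_far l2 cx cx'; [rewrite eq_sym; clear; lia|clear; lia|clear; lia].
  by have [] := same_residue_far l2 cx cx'; clear; lia.
pose a := if cls (lo I) then lo I - 1 else lo I.
pose b := if cls (top I) then lo I + (len I)%:Z + 1 else lo I + (len I)%:Z.
have aI : a <= lo I by rewrite /a; case: ifP => _; clear; lia.
have bI : lo I + (len I)%:Z <= b by rewrite /b; case: ifP => _; clear; lia.
have ab : a < b by have := len_gt0 I; move: aI bI; clear; lia.
have [J J1 J2] := itv_between ab; exists J; split.
- by rewrite /sub_itv J2 J1.
- by rewrite J1 /a; case: ifPn => // /adj[].
- by rewrite J2 /b; case: ifPn => // /adj[].
Qed.

(** On a window with ends outside the class, \hat f_p is one finite product of operators acting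
    inside the window, and [am_op_inj] cancels them in turn. The two products are known to agree on
    this window only, so the cancellation has to stay in it. *)
Lemma f_hat_inj M N : BZ_Z M -> BZ_Z N -> f_hat p M = f_hat p N -> M = N.
Proof.
move=> BM BN MN; apply: funext => k; have [I0 w0] := exists_win k.
have [I [II cl cr]] := itv_avoiding_residue I0; have wk := win_sub II w0.
have {}MN k' : win I k' -> am_seq M (residue_seq (lo I) (top I)) k' = am_seq N (residue_seq (lo I) (top I)) k'.
  by move=> wk'; rewrite -!f_hat_win // MN.
have inner : {in residue_seq (lo I) (top I), forall q, lo I + 1 <= q /\ q < top I}.
  move=> q; rewrite mem_residue_seq => /andP[cq hq].
  have : q != lo I by apply: contraNneq cl => <-.
  have : q != top I by apply: contraNneq cr => <-.
  by move: hq; clear; lia.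
elim: (residue_seq _ _) inner MN k wk {w0} => [|q s IH] inner MN k wk; first exact: MN.
have [lq qr] := inner q (mem_head _ _).
apply: IH => // [x xs|k' wk']; first by apply: inner; rewrite inE xs orbT.
have /finitely_bzP/(_ I) b1 := BZ_Z_finitely_bz (am_seq_BZ s BM).
have /finitely_bzP/(_ I) b2 := BZ_Z_finitely_bz (am_seq_BZ s BN).
rewrite -!(restr_res _ wk'); apply: (am_op_inj lq qr b1 b2); last exact: in_window_res.
move=> K hK; rewrite -!restr_am_maya // /restr -!am_seq_cons; apply: MN; exact: win_maya_cup.
Qed.
End Affine.

(** * Translation invariance *)

Definition translate (d : int) (K : {fset int}) : {fset int} := [fset (x + d)%R | x in K]%fset.

Lemma mem_translate d K x : (x \in translate d K) = (x - d \in K).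
Proof.
apply/imfsetP/idP => [[y yK ->]|xK]; first by rewrite addrK.
by exists (x - d); rewrite ?subrK.
Qed.

Lemma translateU1 d x K : translate d (x |` K)%fset = ((x + d)%R |` translate d K)%fset.
Proof.
apply/fsetP => y; rewrite mem_translate !in_fset1U mem_translate.
by congr (_ || _); clear; lia.
Qed.

Lemma translate_zitv d a b : translate d (zitv a b) = zitv (a + d) (b + d).
Proof. by apply/fsetP => y; rewrite mem_translate !mem_zitv; clear; lia. Qed.

Lemma bz_translate (l r d : int) G : bz l r G ->
  bz (l - d) (r - d) (fun K => G (translate d K)).
Proof.
move=> [G0 PG SM].
have wT K : in_window (l - d) (r - d) K -> in_window l r (translate d K).
  by move=> hK x; rewrite mem_translate => /hK; clear; lia.
have NT (x : int) K : x \notin K -> x + d \notin translate d K by rewrite mem_translate addrK.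
split.
- by move=> x hx; rewrite translate_zitv subrK G0 //; move: hx; clear; lia.
- move=> n i j k K li ij jk kr hK iK jK kK _; rewrite !translateU1.
  apply: (PG #|` translate d K|) => //; [move: li|move: ij|move: jk|move: kr| | | | ];
    try (by clear; lia); [exact: wT|exact: NT..].
- move=> i j K li ij jr hK iK jK; rewrite /supermodular_at !translateU1.
  apply: SM => //; [move: li|move: ij|move: jr| | | ]; try (by clear; lia);
    [exact: wT|exact: NT..].
Qed.

Definition shift_itv (d : int) (I : fitv) : fitv := Fitv (lo I + d) (len_gt0 I).

Lemma shift_maya_cup d n K : shift_maya d (maya_cup n K) = maya_cup (n + d) (translate d K).
Proof.
apply: maya_ext => x; rewrite mem_shift !mem_maya_cup mem_translate.
by congr (_ || _); clear; lia.
Qed.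

Lemma sigma_finitely_bz l M : finitely_bz M -> finitely_bz (sigma_coll l M).
Proof.
move=> /finitely_bzP bM; apply/finitely_bzP => I.
have := bz_translate (- l%:Z) (bM (shift_itv (- l%:Z) I)).
have -> : lo (shift_itv (- l%:Z) I) + 1 - - l%:Z = lo I + 1 by rewrite /=; clear; lia.
have -> : top (shift_itv (- l%:Z) I) - - l%:Z = top I by rewrite /=; clear; lia.
by apply: bz_eq => K _; rewrite /restr /sigma_coll shift_maya_cup.
Qed.

Lemma in_MZ_shift d I k : in_MZ I k -> in_MZ (shift_itv d I) (shift_maya d k).
Proof.
case=> K /and3P[KI K0 K1] ->; exists (translate d K); last exact: shift_maya_cup.
apply/and3P; split.
- apply/in_window_tilde => x; rewrite mem_translate.
  by move=> xK; have /in_window_tilde/(_ _ xK) := KI; rewrite /=; clear; lia.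
- have /fset0Pn[x xK] := K0; apply/fset0Pn; exists (x + d).
  by rewrite mem_translate addrK.
- apply: contraNneq K1 => e; apply/eqP/fsetP => x.
  have /fsetP/(_ (x + d)) := e; rewrite mem_translate addrK !mem_tilde /= => ->.
  by clear; lia.
Qed.

Lemma Omega_shift d I k : shift_maya d (Omega I k) = Omega (shift_itv d I) (shift_maya d k).
Proof.
apply: maya_ext => x; rewrite mem_shift !mem_Omega mem_shift /=.
by case: (x - d \in _); clear; lia.
Qed.

Lemma shift_mayaK d k : shift_maya d (shift_maya (- d) k) = k.
Proof. by apply: maya_ext => x; rewrite !mem_shift opprK subrK. Qed.

Lemma sigma_BZ l M : BZ_Z M -> BZ_Z (sigma_coll l M).
Proof.
move=> BM; apply: BZ_Z_bounded; first exact/sigma_finitely_bz/BZ_Z_finitely_bz.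
move=> k; have [I [Ik st]] := BM.2 (shift_maya (- l%:Z) k).
exists (shift_itv l%:Z I), (M (Omega I (shift_maya (- l%:Z) k))); split.
  by rewrite -(shift_mayaK l%:Z k); exact: in_MZ_shift.
move=> J [h1 h2]; rewrite /sigma_coll Omega_shift st //.
by move: h1 h2; rewrite /sub_itv /=; clear; lia.
Qed.

Lemma sigma_am_maya l (q : int) M : am_maya (q + l%:Z) (sigma_coll l M) = sigma_coll l (am_maya q M).
Proof.
apply: funext => k; rewrite /am_maya /sigma_coll !mem_shift opprK (addrAC q 1).
congr (if _ then if _ then _ else Num.min _ (M _ - M _) else _); apply: maya_ext => x.
  rewrite mem_shift !mem_sigma mem_shift !opprK /transp.
  by rewrite (addrAC q) !(inj_eq (addIr _)); case: eqP => // _; case: eqP.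
by rewrite mem_shift opprK !mem_ksLambda; clear; lia.
Qed.

Lemma sigma_am_seq l s M :
  am_seq (sigma_coll l M) [seq q + l%:Z | q <- s] = sigma_coll l (am_seq M s).
Proof. by elim: s => // q s IH; rewrite map_cons !am_seq_cons IH sigma_am_maya. Qed.

Section Affine.
Variables (l : nat) (p : 'I_l).
Hypothesis hl : (3 <= l)%N.

Let l2 : (1 < l)%N. Proof. exact: ltnW. Qed.
Local Notation cls := (same_residue l p%:Z).
Local Notation Lseq k := (enum_fset (fset_set (L_e k p))).

Lemma cls_shift q : cls (q + l%:Z) = cls q.
Proof. by rewrite /same_residue modzDr. Qed.

Lemma f_hat_sigma M : BZ_Z M -> f_hat p (sigma_coll l M) = sigma_coll l (f_hat p M).
Proof.
move=> BM; apply: funext => k.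
set k' := shift_maya (- l%:Z) k.
have cs : all cls [seq q + l%:Z | q <- Lseq k'].
  by rewrite all_map; apply: sub_all (Lseq_cls p k') => q; rewrite /= cls_shift.
rewrite (f_hatE hl (sigma_BZ l BM) (s := [seq q + l%:Z | q <- Lseq k'])) //.
- by rewrite sigma_am_seq /sigma_coll -/k' /f_hat foldr_f_Z.
- by rewrite map_inj_uniq ?fset_uniq //; exact: addIr.
- move=> q cq sq; apply/mapP; exists (q - l%:Z); last by rewrite subrK.
  rewrite -[X in is_true X]/(q - l%:Z \in fset_set (L_e k' p)) mem_L_e -cls_shift subrK cq /=.
  by rewrite /step /k' !mem_shift opprK (addrAC _ 1) !subrK.
Qed.

Lemma f_hat_closed M : BZ_Z_sigma l M -> BZ_Z_sigma l (f_hat p M).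
Proof. by move=> [BM sM]; split; [exact: f_hat_BZ|rewrite -f_hat_sigma // sM]. Qed.

Lemma ThetaE M k I : Int_e M k I -> Theta k M = M (Omega I k).
Proof.
move=> hI; apply: xget_unique; first by exists I.
move=> v [J hJ ->]; have [K IK JK] := sub_itv_join I J.
by rewrite -(hI.2 K IK) -(hJ.2 K JK).
Qed.

(** For a stable interval J with ends outside the class, the only step of [Omega J (kLambda r)] that
    can lie in the class is r itself, and only if r = p. There p is missing and p + 1 present, so
    the factor subtracts 1. *)
Lemma Theta_f_hat M (r : 'I_l) : BZ_Z M ->
  Theta (kLambda r%:Z) (f_hat p M) = Theta (kLambda r%:Z) M - (r == p)%:Z.
Proof.
move=> BM; have [I1 hI1] := BM.2 (kLambda r%:Z).
have [I2 hI2] := (f_hat_BZ p hl BM).2 (kLambda r%:Z).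
have [I3 I13 I23] := sub_itv_join I1 I2; have [J [IJ cl cr]] := itv_avoiding_residue p hl I3.
have J1 := Int_e_sub hI1 (sub_itv_trans I13 IJ); have J2 := Int_e_sub hI2 (sub_itv_trans I23 IJ).
rewrite (ThetaE J1) (ThetaE J2); have [lr rr] := Int_e_kLambda J1.
have cr' : cls r%:Z = (r == p).
  by rewrite /same_residue !modz_small // ltz_nat ltn_ord.
have stepO q : cls q -> step (Omega J (kLambda r%:Z)) q -> r == p /\ q = p%:Z.
  move=> cq /step_Omega /or3P[/eqP e|/eqP e|].
  - by rewrite e (negPf cl) in cq.
  - by rewrite e (negPf cr) in cq.
  - rewrite /step !mem_kLambda => h; have e : q = r%:Z by move: h; clear; lia.
    by move: cq; rewrite e cr' => /eqP->.
have [rp|rp] := eqVneq r p; last first.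
  rewrite (f_hatE hl BM (s := [::])) ?subr0 // => q cq /(stepO q cq)[rp'].
  by rewrite rp' in rp.
rewrite (f_hatE hl BM (s := [:: p%:Z])) //=; first last.
- by move=> q cq /(stepO q cq)[_ ->]; rewrite inE.
- by rewrite /same_residue eqxx.
rewrite /am_seq /= /am_maya !mem_Omega !mem_kLambda -rp.
have -> : (r%:Z <= lo J) = false by move: lr; clear; lia.
have -> : (r%:Z + 1 <= lo J) = false by move: lr; clear; lia.
rewrite lexx andbF /= (_ : _ && _ = true) //.
by move: lr rr; clear; lia.
Qed.

Lemma wt_f_hat M : BZ_Z M -> wt l (f_hat p M) = wt l M - simple_root p.
Proof.
move=> BM; rewrite /wt; under eq_bigr => r _ do rewrite Theta_f_hat // mulrzBr.
rewrite sumrB; congr (_ - _); rewrite (bigD1 p) //= eqxx big1 ?addr0 ?mulr1z // => r rp.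
by rewrite (negPf rp) mulr0z.
Qed.

Lemma eps_sigma M q : sigma_coll l M = M -> eps_Z (q + l%:Z) M = eps_Z q M.
Proof.
move=> sM; rewrite /eps_Z -{1}sM /sigma_coll; congr (- M _); apply: maya_ext => x.
by rewrite mem_shift opprK !mem_ksLambda; clear; lia.
Qed.

Lemma eps_cls M q : sigma_coll l M = M -> cls q -> eps_Z q M = eps_hat p M.
Proof.
move=> sM; have up (x : int) (n : nat) : eps_Z (x + n%:Z * l%:Z) M = eps_Z x M.
  elim: n => [|n IH]; first by rewrite mul0r addr0.
  by rewrite -IH -(eps_sigma (x + n%:Z * l%:Z) sM) -addn1 PoszD mulrDl mul1r addrA.
rewrite /same_residue eqz_mod_dvd => /dvdzP[m em].
have [m0|m0] := leP 0 m.
  by rewrite /eps_hat -(up p%:Z `|m|%N) gez0_abs // -em addrC subrK.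
by rewrite -(up q `|m|%N) /eps_hat ltz0_abs // mulNr -em opprB addrC subrK.
Qed.
End Affine.

(** * The inverse operator *)

Section Affine.
Variables (l : nat) (p : 'I_l).
Hypothesis hl : (3 <= l)%N.

Let l2 : (1 < l)%N. Proof. exact: ltnW. Qed.
Local Notation cls := (same_residue l p%:Z).
Local Notation Lseq k := (enum_fset (fset_set (L_e k p))).

Lemma eps_am_seq_notin M s q : cls q -> all cls s -> q \notin s -> eps_Z q (am_seq M s) = eps_Z q M.
Proof.
move=> cq; elim: s => // x s IH /= /andP[cx cs]; rewrite inE negb_or => /andP[qx qs].
by rewrite am_seq_cons eps_am_maya_far ?IH //; apply: (same_residue_far l2 cx cq); rewrite eq_sym.
Qed.

(** No factor vanishes: the operators at other places of the class leave eps_q unchanged, and by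
    periodicity it equals the nonzero [eps_hat p M]. *)
Lemma e_Z_seqP M s : BZ_Z_sigma l M -> eps_hat p M != 0 -> uniq s -> all cls s ->
  exists N, [/\ foldr (fun q N => obind (e_Z q) N) (Some M) s = Some N, BZ_Z N & am_seq N s = M].
Proof.
move=> [BM sM] e0; elim: s => [|q s IH] /=; first by exists M.
move=> /andP[qs us] /andP[cq cs]; have [N [-> BN NM]] := IH us cs.
have [|N' eN [BN' N'N]] := @e_ZP q N BN.
  by rewrite -(eps_am_seq_notin N cq cs qs) NM (eps_cls sM cq).
by exists N'; split; rewrite //= am_seq_cons (am_seq_comm l2 _ cq cs) N'N.
Qed.

(** Preimages of M under a longer product and under the product over L^e(k, p) differ by factors
    without a step at k, so they agree at k. *)
Lemma e_hat_spec M : BZ_Z_sigma l M -> eps_hat p M != 0 ->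
  exists2 N, e_hat p M = Some N & forall k s, uniq s -> all cls s ->
    (forall q, cls q -> step k q -> q \in s) ->
    exists N', [/\ BZ_Z N', am_seq N' s = M & N k = N' k].
Proof.
move=> sM e0; rewrite /e_hat (negPf e0); eexists; first reflexivity.
move=> k s us cs hs.
have [N [-> BN NM]] := e_Z_seqP sM e0 (fset_uniq _) (Lseq_cls p k).
have [N' [_ BN' N'M]] := e_Z_seqP sM e0 us cs; exists N'; split=> //.
have ps := Lseq_perm us cs hs.
pose t := [seq q <- s | ~~ step k q].
have ct : all cls t by rewrite all_filter; apply: sub_all cs => q /= ->; rewrite implybT.
have st : perm_eq s (Lseq k ++ t).
  rewrite -(perm_cat2r t) in ps; apply: perm_trans ps.
  by rewrite perm_sym; apply/permPl/perm_filterC.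
rewrite -N'M (am_seq_perm l2 N' cs st) am_seq_cat in NM.
rewrite (am_seq_inj (BZ_Z_finitely_bz BN) (BZ_Z_finitely_bz (am_seq_BZ t BN')) NM) am_seq_nstep //.
by move=> q; rewrite mem_filter => /andP[].
Qed.

Lemma e_hatP M : BZ_Z_sigma l M -> eps_hat p M != 0 ->
  exists2 N, e_hat p M = Some N & BZ_Z_sigma l N /\ f_hat p N = M.
Proof.
move=> sM e0; have [N eN NP] := e_hat_spec sM e0; exists N => //; have [BM _] := sM.
have NL k : exists N', [/\ BZ_Z N', am_seq N' (Lseq k) = M & N k = N' k].
  apply: NP; [exact: fset_uniq|exact: Lseq_cls|move=> q cq sq].
  by rewrite -[X in is_true X]/(q \in fset_set (L_e k p)) mem_L_e cq.
have NW I : exists N', [/\ BZ_Z N', am_seq N' (residue_seq p (lo I) (top I)) = M & forall k, win I k -> N k = N' k].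
  have [N' [_ BN' N'M]] := e_Z_seqP sM e0 (residue_seq_uniq p (lo I) (top I)) (residue_seq_cls p (lo I) (top I)).
  (* On a window all values of N come from one collection, which is what the local conditions
     require. *)
  exists N'; split=> // k wk.
  have [N'' [BN'' N''M ->]] := NP k _ (residue_seq_uniq p (lo I) (top I)) (residue_seq_cls p (lo I) (top I))
    (fun q cq sq => ltac:(by rewrite mem_residue_seq cq; exact: win_step sq)).
  by rewrite -N'M in N''M; rewrite (am_seq_inj (BZ_Z_finitely_bz BN'') (BZ_Z_finitely_bz BN') N''M).
have BN : BZ_Z N.
  apply: BZ_Z_bounded.
    apply: win_eq_finitely_bz => I; have [N' [BN' _ NN']] := NW I.
    by exists N' => //; exact: BZ_Z_finitely_bz.
  move=> k; have [I [Ik st]] := BM.2 k.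
  exists I, (M (Omega I k) - (size (Lseq k)).+2%:Z); split=> // J IJ.
  rewrite -(st J IJ); have [N' [BN' N'M ->]] := NL (Omega J k).
  have := am_seq_le (Lseq (Omega J k)) N' (Omega J k); rewrite N'M => h.
  rewrite lerBlDr; apply: le_trans h _; rewrite lerD2l lez_nat; exact: size_Lseq_Omega.
have fN : f_hat p N = M.
  apply: funext => k; rewrite /f_hat foldr_f_Z //.
  have [N' [_ BN' N'M]] := e_Z_seqP sM e0 (fset_uniq _) (Lseq_cls p k).
  (* Here N is not a preimage under any one product; it agrees with N' only at the diagrams whose
     steps in the class lie in [Lseq k], and these are all that the value at k depends on. *)
  rewrite -[in RHS]N'M; apply: (am_seq_local l2 (t := Lseq k)) => //; first exact: Lseq_cls.
    move=> k' hk'; have [N'' [BN'' N''M ->]] := NP k' _ (fset_uniq _) (Lseq_cls p k) hk'.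
    by rewrite -N'M in N''M; rewrite (am_seq_inj (BZ_Z_finitely_bz BN'') (BZ_Z_finitely_bz BN') N''M).
  move=> q cq sq; by rewrite -[X in is_true X]/(q \in fset_set (L_e k p)) mem_L_e cq.
(* Invariance under the shift follows by injectivity: N and its shift have the same image, as M is
   invariant. *)
split=> //; split=> //; apply: (f_hat_inj hl (p := p)) => //; first exact: sigma_BZ.
by rewrite f_hat_sigma // fN; case: sM.
Qed.

Lemma e_hat_f_hat M N : BZ_Z_sigma l M -> BZ_Z_sigma l N ->
  (f_hat p M = N <-> e_hat p N = Some M).
Proof.
move=> sM sN; have [BM _] := sM; split=> [fM|eN].
  (* The operator raises eps by 1 from a nonnegative value. *)
  have e0 : eps_hat p N != 0.
    by rewrite -fM eps_f_hat //; have := finitely_bz_eps_ge0 p%:Z (BZ_Z_finitely_bz BM); rewrite /eps_hat; clear; lia.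
  have [N' -> [[BN' _] fN']] := e_hatP sN e0; congr Some.
  by apply: (f_hat_inj hl (p := p)) => //; rewrite fN' fM.
have e0 : eps_hat p N != 0 by apply/negP => e0; move: eN; rewrite /e_hat e0.
have [N' eN' [_ <-]] := e_hatP sN e0.
by move: eN; rewrite eN' => -[->].
Qed.
End Affine.

Theorem theorem4p3p4 (l : nat) (hl : (3 <= l)%N) :
  is_affine_crystal (BZ_Z_sigma l) (@wt l)
    (fun p M => Some (eps_hat p M)) (fun p M => Some (phi_hat p M))
    (@e_hat l) (fun p M => Some (f_hat p M)).
Proof.
have fstep (p : 'I_l) M : BZ_Z_sigma l M -> [/\ wt l (f_hat p M) = wt l M - simple_root p,
    eps_hat p (f_hat p M) = eps_hat p M + 1 & phi_hat p (f_hat p M) = phi_hat p M - 1].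
  move=> [BM _]; rewrite /phi_hat wt_f_hat // eps_f_hat //; split=> //.
  rewrite (_ : simple_coroot p (wt l M - simple_root p) = simple_coroot p (wt l M) - 2).
    by rewrite addrACA addrA; clear; lia.
  by rewrite /simple_coroot /simple_root /= !ffunE /cartan eqxx.
have eclosed (p : 'I_l) M N : BZ_Z_sigma l M -> e_hat p M = Some N -> BZ_Z_sigma l N /\ f_hat p N = M.
  move=> sM eM; have e0 : eps_hat p M != 0 by apply/negP => e0; move: eM; rewrite /e_hat e0.
  by have [N' eN' h] := e_hatP hl sM e0; move: eM; rewrite eN' => -[<-].
split.
- by move=> p M N sM /(eclosed _ _ _ sM)[].
- by move=> p M N sM [<-]; exact: f_hat_closed.
- by [].
- move=> p M N sM /(eclosed _ _ _ sM)[sN <-]; have [w e f] := fstep p N sN.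
  by rewrite w e f subrK /= addrK subrK.
- move=> p M N sM [<-]; have [w e f] := fstep p M sM.
  by rewrite w e f.
- move=> p M N sM sN; have [fe ef] := @e_hat_f_hat l p hl M N sM sN.
  by split=> [[/fe//]|/ef->].
- by [].
Qed.
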